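(* There is a deterministic algorithm that, given any sequence $P=(p_1,\dots,p_n)$ of $n$ points in $\mathbb{R}^2$ in general position (no two points share an $x$-coordinate and no two share a $y$-coordinate) that fulfils the convex hull promise, computes the upper convex hull $\mathrm{UH}(P)$ in time $O(n\sqrt{\log n})$.
   Context: The index of a point $p_i$ in the sequence is $\mathrm{index}(p_i)=i$, and $x(p)$ denotes the $x$-coordinate of $p$. Let $\mathrm{conv}(P)$ be the convex hull of $P$, and let $p_{\min},p_{\max}$ be the lexicographically smallest and largest points of $P$. The upper convex hull $\mathrm{UH}(P)$ is the part of the boundary of $\mathrm{conv}(P)$ running clockwise from $p_{\min}$ to $p_{\max}$, represented by its sequence of vertices. The sequence $P$ fulfils the convex hull promise if for any two points $p,q$ of $P$ lying on the convex hull (i.e. convex hull vertices), $\mathrm{index}(p)<\mathrm{index}(q)\iff x(p)<x(q)$. No assumption is made on the order of the other points. The running time is measured in the standard real-RAM model (unit-cost arithmetic and comparisons on real coordinates). *)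

(* Defs.v *)
From HB Require Import structures.
From mathcomp Require Import all_boot all_order all_algebra.
From mathcomp Require Import all_classical all_reals all_analysis.

Set Implicit Arguments.
Unset Strict Implicit.
Unset Printing Implicit Defensive.

Import Order.TTheory GRing.Theory Num.Theory.
Import numFieldNormedType.Exports.

Local Open Scope classical_set_scope.
Local Open Scope ring_scope.

(* R^o makes the product a left module over R, as needed by [convex_set]. *)
Definition plane (R : realType) : Type := (R^o * R^o)%type.

Section ConvexHull.
Variable R : realType.
Implicit Types (A C : set (plane R)) (p q a b : plane R) (s : seq (plane R)).

Definition convex_hull A : set (plane R) :=
  smallest (@convex_set R (R^o * R^o)%type) A.

(* Extreme points; for a polygon or a segment these are its vertices. *)
Definition vertex C p : Prop :=
  C p /\ forall a b (t : R), C a -> C b -> 0 < t < 1 ->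
           p = t *: a + (1 - t) *: b -> a = p /\ b = p.

Definition lex_le p q : Prop := p.1 < q.1 \/ (p.1 = q.1 /\ p.2 <= q.2).

Definition lex_min A p : Prop := A p /\ forall q, A q -> lex_le p q.
Definition lex_max A p : Prop := A p /\ forall q, A q -> lex_le q p.

(* q lies on or to the right of the line through a and b directed from a to b. *)
Definition on_or_right_of a b q : Prop :=
  (b.1 - a.1) * (q.2 - a.2) - (b.2 - a.2) * (q.1 - a.1) <= 0.

(* [s] lists the vertices met when following the boundary of the convex hull
   of A clockwise from the lexicographically smallest to the lexicographically
   largest point of A.  A boundary edge is traversed clockwise when the hull
   lies to its right; [uniq] forbids going round more than once, including
   back and forth when the hull is a segment. *)
Definition upper_hull A s : Prop :=
  [/\ s != [::], lex_min A (head 0 s), lex_max A (last 0 s), uniq s &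
      (forall p, p \in s -> vertex (convex_hull A) p) /\
      (forall k, (k.+1 < size s)%N ->
         forall q, convex_hull A q -> on_or_right_of s`_k s`_k.+1 q)].

Section PointSequence.
Variables (n : nat) (P : 'I_n -> plane R).

Definition general_position : Prop :=
  injective (fun i => (P i).1) /\ injective (fun i => (P i).2).

Definition hull_promise : Prop :=
  forall i j, vertex (convex_hull (range P)) (P i) ->
              vertex (convex_hull (range P)) (P j) ->
              (i < j)%N <-> (P i).1 < (P j).1.

End PointSequence.
End ConvexHull.

(* The real RAM: integer and real registers, and an integer and a real
   random-access memory addressed by the integer registers.  Programs mention
   finitely many registers and contain only integer constants.  Every
   instruction has unit cost.  There is no rounding nor any other conversion
   from reals to integers. *)
Variant int_op := IAdd | ISub | IMul | IDiv.
Variant real_op := RAdd | RSub | RMul | RDiv.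

Variant instr :=
  | IConst of nat & nat             (* ireg d <- c *)
  | IOp of int_op & nat & nat & nat (* ireg d <- ireg a op ireg b *)
  | ILoad of nat & nat              (* ireg d <- imem (ireg a) *)
  | IStore of nat & nat             (* imem (ireg a) <- ireg b *)
  | RConst of nat & nat             (* rreg d <- c *)
  | ROp of real_op & nat & nat & nat
  | RLoad of nat & nat              (* rreg d <- rmem (ireg a) *)
  | RStore of nat & nat             (* rmem (ireg a) <- rreg b *)
  | Jump of nat
  | JumpILt of nat & nat & nat      (* if ireg a < ireg b then goto l *)
  | JumpRLt of nat & nat & nat      (* if rreg a < rreg b then goto l *)
  | Halt.

Definition program := seq instr.

Section RealRAM.
Variable R : realFieldType.

Record state := State {
  pc : nat;
  ireg : nat -> nat;
  rreg : nat -> R;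
  imem : nat -> nat;
  rmem : nat -> R }.

(* Subtraction on integer registers is truncated at 0. *)
Definition eval_int_op (o : int_op) (x y : nat) : option nat :=
  match o with
  | IAdd => Some (x + y)%N
  | ISub => Some (x - y)%N
  | IMul => Some (x * y)%N
  | IDiv => if y == 0%N then None else Some (x %/ y)%N
  end.

Definition eval_real_op (o : real_op) (x y : R) : option R :=
  match o with
  | RAdd => Some (x + y)
  | RSub => Some (x - y)
  | RMul => Some (x * y)
  | RDiv => if y == 0 then None else Some (x / y)
  end.

(* W is the range of a machine word: an integer result that is not smaller
   than W is an error.  Errors, [Halt] and leaving the program have no
   successor state. *)
Section Step.
Variables (W : nat) (prog : program).

Definition set_ireg (s : state) (d v : nat) : option state :=
  if (v < W)%N then
    Some (State (pc s).+1 [eta ireg s with d |-> v] (rreg s) (imem s) (rmem s))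
  else None.

Definition set_rreg (s : state) (d : nat) (v : R) : state :=
  State (pc s).+1 (ireg s) [eta rreg s with d |-> v] (imem s) (rmem s).

Definition goto (s : state) (l : nat) : state :=
  State l (ireg s) (rreg s) (imem s) (rmem s).

Definition exec_instr (i : instr) (s : state) : option state :=
  match i with
  | IConst d c => set_ireg s d c
  | IOp o d a b => obind (set_ireg s d) (eval_int_op o (ireg s a) (ireg s b))
  | ILoad d a => set_ireg s d (imem s (ireg s a))
  | IStore a b =>
      Some (State (pc s).+1 (ireg s) (rreg s)
                  [eta imem s with ireg s a |-> ireg s b] (rmem s))
  | RConst d c => Some (set_rreg s d c%:R)
  | ROp o d a b => omap (set_rreg s d) (eval_real_op o (rreg s a) (rreg s b))
  | RLoad d a => Some (set_rreg s d (rmem s (ireg s a)))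
  | RStore a b =>
      Some (State (pc s).+1 (ireg s) (rreg s) (imem s)
                  [eta rmem s with ireg s a |-> rreg s b])
  | Jump l => Some (goto s l)
  | JumpILt a b l =>
      Some (goto s (if (ireg s a < ireg s b)%N then l else (pc s).+1))
  | JumpRLt a b l =>
      Some (goto s (if rreg s a < rreg s b then l else (pc s).+1))
  | Halt => None
  end.

Definition step (s : state) : option state :=
  obind (exec_instr^~ s) (onth prog (pc s)).

(* Started in s, the program executes exactly t instructions and then reaches
   a [Halt] instruction in state s'. *)
Definition halts_in (s : state) (t : nat) (s' : state) : Prop :=
  iter t (obind step) (Some s) = Some s' /\ onth prog (pc s') = Some Halt.

End Step.
End RealRAM.

Section InputOutput.
Variable R : realType.

(* The i-th point is stored in the real cells 2i and 2i+1 (i counted from 0),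
   integer register 0 contains n, and everything else is 0. *)
Definition input n (P : 'I_n -> plane R) : state R :=
  State 0 [eta fun=> 0%N with 0%N |-> n] (fun=> 0) (fun=> 0%N)
    (fun a => if insub a./2 is Some i then
                if odd a then (P i).2 else (P i).1
              else 0).

(* Integer register 0 contains the length of the result, whose i-th point is
   in the real cells 2i and 2i+1. *)
Definition output (s : state R) : seq (plane R) :=
  mkseq (fun i => (rmem s i.*2, rmem s i.*2.+1)) (ireg s 0).

(* On every admissible input of n points, the program, run on words with
   range (n + 2)^K, that is, of O(log n) bits, halts within T n steps. *)
Definition computes_upper_hull_in_time (prog : program) (K : nat)
    (T : nat -> nat) : Prop :=
  forall (n : nat) (P : 'I_n -> plane R),
    (0 < n)%N -> general_position P -> hull_promise P ->
    exists (t : nat) (s : state R),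
      [/\ (t <= T n)%N, halts_in ((n + 2) ^ K)%N prog (input P) t s &
          upper_hull (range P) (output s)].

End InputOutput.

(* Main.v *)
(** The points are cut, in the order of the sequence, into M blocks of
    b = L^2 points, L ~ log n.  The upper hull of each block is computed by
    sorting and a Graham scan, in total time O(n log b).  The outer normals of
    every L-th edge of these chains, and the two horizontal directions, are
    sorted; there are r = O(n / L) of them.

    The extreme point of all points in a given direction is a hull vertex, so
    by the promise its index increases as the direction turns clockwise.
    Hence the r extreme points can be found by divide and conquer as the row
    maxima of a monotone r x M array, whose entries are found by binary
    search in the block chains.  This takes O(M + r) searches for each of the
    O(L) levels, thus O(n log b) time.

    A hull vertex that is extreme between two consecutive directions lies, by
    the promise again, in a block between those of the two extreme points, and
    on its chain between the extreme points of the block.  There are less than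
    2 L vertices in between, so that the candidates for hull vertices, sorted
    separately for each pair of consecutive directions, are O(n) in number:
    pairs whose extreme points share a block have O(L) candidates and cost
    O(L log L), the others involve O(M) blocks altogether and cost
    O(M L log n) = O(n).  A final Graham scan over the candidates yields the
    upper hull.  In fact the running time is O(n log log n). *)

Require Import Defs.
From mathcomp Require Import all_boot all_order all_algebra.
From mathcomp Require Import all_classical all_reals all_analysis.
From mathcomp Require Import zify ring lra.
Import Order.TTheory GRing.Theory Num.Theory.
Import numFieldNormedType.Exports.
Set Implicit Arguments.
Unset Strict Implicit.
Unset Printing Implicit Defensive.
Local Open Scope classical_set_scope.
Local Open Scope ring_scope.

(** * A structured language and its compiler *)

(** Sorting all points by abscissa would cost n log n, and the promise says nothing about points
    that are not hull vertices, so no global order of the input is available. What can be compared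
    are extreme points in known directions: they are hull vertices, hence ordered by index. This
    needs the extreme point to be a single vertex also when the direction is normal to an edge; ties
    are therefore resolved to the left throughout.

    The block size is squeezed from two sides. It must be polylogarithmic, so that sorting inside
    the blocks costs only a log log n factor. The exponent 2 in b = L^2 makes room for two
    logarithmic factors: the O(L) vertices that a block may contribute between two directions, and
    the log n rounds of sorting them when several blocks are involved. Sampling only every L-th edge
    keeps the directions so few that sorting them, and going through log n levels of divide and
    conquer over them, stays affordable. The bound of the theorem follows because log log n is
    O(sqrt(log n)). *)

Variant var :=
  | vn | vlen | vpow | vblk | vM | vR | vi | vj | vk | vkh | vlo | vhi | vtop
  | vw | vp | vmd | ve | vx | vy | vz | vgo | vq | vt | vu | vbest | vcnt
  | vst | vf | vm.

Definition vars : seq var :=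
  [:: vn; vlen; vpow; vblk; vM; vR; vi; vj; vk; vkh; vlo; vhi; vtop;
      vw; vp; vmd; ve; vx; vy; vz; vgo; vq; vt; vu; vbest; vcnt; vst; vf; vm].

Definition vcode (x : var) : nat :=
  match x with
  | vn => 0 | vlen => 1 | vpow => 2 | vblk => 3 | vM => 4 | vR => 5 | vi => 6
  | vj => 7 | vk => 8 | vkh => 9 | vlo => 10 | vhi => 11 | vtop => 12
  | vw => 13 | vp => 14 | vmd => 15 | ve => 16 | vx => 17 | vy => 18 | vz => 19
  | vgo => 20 | vq => 21 | vt => 22 | vu => 23 | vbest => 24 | vcnt => 25
  | vst => 26 | vf => 27 | vm => 28
  end%N.

Lemma vcodeK : cancel vcode (nth vn vars). Proof. by case. Qed.

Variant arr := aIdx | aTmp | aChain | aEnd | aDir | aVtx | aCand | aHull.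

Definition acode (a : arr) : nat :=
  match a with
  | aIdx => 0 | aTmp => 1 | aChain => 2 | aEnd => 3 | aDir => 4 | aVtx => 5
  | aCand => 6 | aHull => 7
  end%N.

Lemma acodeK :
  cancel acode (nth aIdx [:: aIdx; aTmp; aChain; aEnd; aDir; aVtx; aCand;
    aHull]).
Proof. by case. Qed.

Lemma acode_lt a : (acode a < 8)%N. Proof. by case: a. Qed.

(** On concrete variables this reduces to a Boolean constant, so that frame conditions hold by
    computation. *)
Definition veq x y := eqn (vcode x) (vcode y).
Definition aeq a b := eqn (acode a) (acode b).

Lemma veqP x y : reflect (x = y) (veq x y).
Proof.
by apply: (iffP eqnP) => [/(can_inj vcodeK)|->].
Qed.
Lemma aeqP x y : reflect (x = y) (aeq x y).
Proof.
by apply: (iffP eqnP) => [/(can_inj acodeK)|->].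
Qed.

Inductive iexp :=
  | IV of var
  | IC of nat
  | IB of int_op & iexp & iexp
  | IG of arr & iexp.

Inductive rexp :=
  | RC of nat
  | RB of real_op & rexp & rexp
  | RM of bool & iexp.

Variant cond := LtI of iexp & iexp | LtR of rexp & rexp.

Inductive com :=
  | Skip
  | SetI of var & iexp
  | SetA of arr & iexp & iexp
  | SetR of bool & iexp & rexp
  | Seq of com & com
  | If of cond & com & com
  | While of cond & com.

Notation RX := (RM false).
Notation RY := (RM true).
Notation SetX := (SetR false).
Notation SetY := (SetR true).

Section Language.
Variable R : realFieldType.

Record store := Store {
  iv : var -> nat;
  ar : arr -> nat -> nat;
  px : nat -> R;
  py : nat -> R }.

Definition pxy s (c : bool) := if c then py s else px s.

Definition iop (o : int_op) (x y : nat) : nat :=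
  match o with
  | IAdd => (x + y)%N | ISub => (x - y)%N
  | IMul => (x * y)%N | IDiv => (x %/ y)%N
  end.

Definition rop (o : real_op) (x y : R) : R :=
  match o with
  | RAdd => x + y | RSub => x - y | RMul => x * y | RDiv => x / y
  end.

Fixpoint ieval (e : iexp) (s : store) : nat :=
  match e with
  | IV x => iv s x
  | IC c => c
  | IB o e1 e2 => iop o (ieval e1 s) (ieval e2 s)
  | IG a e => ar s a (ieval e s)
  end.

Fixpoint reval (e : rexp) (s : store) : R :=
  match e with
  | RC c => c%:R
  | RB o e1 e2 => rop o (reval e1 s) (reval e2 s)
  | RM c e => pxy s c (ieval e s)
  end.

Definition qeval (q : cond) (s : store) : bool :=
  match q with
  | LtI e1 e2 => (ieval e1 s < ieval e2 s)%N
  | LtR e1 e2 => reval e1 s < reval e2 s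
  end.

Definition seti s x v :=
  Store (fun y => if veq y x then v else iv s y) (ar s) (px s) (py s).
Definition seta s a i v :=
  Store (iv s) (fun b j => if aeq b a then (if j == i then v else ar s b j)
                           else ar s b j) (px s) (py s).
Definition setx s i v :=
  Store (iv s) (ar s) (fun j => if j == i then v else px s j) (py s).
Definition sety s i v :=
  Store (iv s) (ar s) (px s) (fun j => if j == i then v else py s j).
Definition setr s (c : bool) := if c then sety s else setx s.

Section Exec.
Variable W : nat.

(** Evaluation itself is total; this is the condition under which the machine raises no error.
    Differences and quotients cannot overflow, and for a load the address [8 * i + c] with [c < 8]
    must fit in a word. *)
Fixpoint iok (e : iexp) (s : store) : Prop :=
  match e with
  | IV _ => True
  | IC c => (c < W)%N
  | IB o e1 e2 =>
      [/\ iok e1 s, iok e2 s &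
       match o with
       | IAdd => (ieval e1 s + ieval e2 s < W)%N
       | ISub => True
       | IMul => (ieval e1 s * ieval e2 s < W)%N
       | IDiv => (0 < ieval e2 s)%N
       end]
  | IG _ e => iok e s /\ (8 * ieval e s + 8 <= W)%N
  end.

Fixpoint rok (e : rexp) (s : store) : Prop :=
  match e with
  | RC _ => True
  | RB o e1 e2 =>
      [/\ rok e1 s, rok e2 s &
       match o with RDiv => reval e2 s != 0 | _ => True end]
  | RM _ e => iok e s /\ (2 * ieval e s + 2 <= W)%N
  end.

Definition qok (q : cond) (s : store) : Prop :=
  match q with
  | LtI e1 e2 => iok e1 s /\ iok e2 s
  | LtR e1 e2 => rok e1 s /\ rok e2 s
  end.

(** Every assignment and every test counts one unit, whatever the size of its expressions; the
    compiler correctness charges that size as a constant factor. *)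
Inductive exec : com -> store -> nat -> store -> Prop :=
  | ExSkip s : exec Skip s 0 s
  | ExSetI x e s : iok e s -> exec (SetI x e) s 1 (seti s x (ieval e s))
  | ExSetA a e1 e2 s : iok e1 s -> iok e2 s -> (8 * ieval e1 s + 8 <= W)%N ->
      exec (SetA a e1 e2) s 1 (seta s a (ieval e1 s) (ieval e2 s))
  | ExSetR c e r s : iok e s -> rok r s -> (2 * ieval e s + 2 <= W)%N ->
      exec (SetR c e r) s 1 (setr s c (ieval e s) (reval r s))
  | ExSeq c1 c2 s t1 s1 t2 s2 :
      exec c1 s t1 s1 -> exec c2 s1 t2 s2 -> exec (Seq c1 c2) s (t1 + t2) s2
  | ExIf q c1 c2 s t s' : qok q s ->
      exec (if qeval q s then c1 else c2) s t s' ->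
      exec (If q c1 c2) s t.+1 s'
  | ExWhileF q c s : qok q s -> qeval q s = false -> exec (While q c) s 1 s
  | ExWhileT q c s t1 s1 t2 s2 : qok q s -> qeval q s ->
      exec c s t1 s1 -> exec (While q c) s1 t2 s2 ->
      exec (While q c) s (t1 + t2).+1 s2.

(* Variables live in the even integer registers, the odd ones hold
   intermediate results; entry i of array a is cell 8 i + acode a. *)
Definition vreg x := (vcode x).*2.
Definition treg d := d.*2.+1.

Definition const_op o d k := [:: IConst (treg d.+1) k;
                                 IOp o (treg d) (treg d) (treg d.+1)].

Definition addr k c d := const_op IMul d k ++ const_op IAdd d c.

(** The temporaries from depth [d] on serve as evaluation stack. A variable is copied by adding 0,
    as the machine has no move instruction. *)
Fixpoint icomp (e : iexp) (d : nat) : seq instr :=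
  match e with
  | IV x => [:: IConst (treg d) 0; IOp IAdd (treg d) (vreg x) (treg d)]
  | IC c => [:: IConst (treg d) c]
  | IB o e1 e2 =>
      icomp e1 d ++ (icomp e2 d.+1 ++ [:: IOp o (treg d) (treg d) (treg d.+1)])
  | IG a e =>
      icomp e d ++ (addr 8 (acode a) d ++ [:: ILoad (treg d) (treg d)])
  end.

(** Real operands are stacked in the real registers from [d] on. Addresses are computed at depth 1,
    since depth 0 may hold the target address of the enclosing assignment. *)
Fixpoint rcomp (e : rexp) (d : nat) : seq instr :=
  match e with
  | RC c => [:: RConst d c]
  | RB o e1 e2 => rcomp e1 d ++ (rcomp e2 d.+1 ++ [:: ROp o d d d.+1])
  | RM c e => icomp e 1 ++ (addr 2 c 1 ++ [:: RLoad d (treg 1)])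
  end.

Definition qcomp (q : cond) (l : nat) : seq instr :=
  match q with
  | LtI e1 e2 => icomp e1 0 ++ (icomp e2 1 ++ [:: JumpILt (treg 0) (treg 1) l])
  | LtR e1 e2 => rcomp e1 0 ++ (rcomp e2 1 ++ [:: JumpRLt 0 1 l])
  end.

Fixpoint csize (c : com) : nat :=
  match c with
  | Skip => 0
  | SetI x e => (size (icomp e 1)).+2
  | SetA a e1 e2 => size (icomp e1 0) + 4 + size (icomp e2 1) + 1
  | SetR _ e r => size (icomp e 0) + 4 + size (rcomp r 0) + 1
  | Seq c1 c2 => csize c1 + csize c2
  | If q c1 c2 => size (qcomp q 0) + (csize c2 + (1 + csize c1))
  | While q c => size (qcomp q 0) + (1 + (csize c + 1))
  end%N.

(** Jumps are absolute, hence the start address [p]. The conditional jump is taken when the test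
    holds, so the else branch, or the jump out of a loop, comes first. *)
Fixpoint compile (c : com) (p : nat) : seq instr :=
  match c with
  | Skip => [::]
  | SetI x e => icomp e 1 ++ [:: IConst (treg 0) 0;
                                 IOp IAdd (vreg x) (treg 1) (treg 0)]
  | SetA a e1 e2 =>
      icomp e1 0 ++ (addr 8 (acode a) 0 ++
        (icomp e2 1 ++ [:: IStore (treg 0) (treg 1)]))
  | SetR c e r =>
      icomp e 0 ++ (addr 2 c 0 ++ (rcomp r 0 ++ [:: RStore (treg 0) 0]))
  | Seq c1 c2 => compile c1 p ++ compile c2 (p + csize c1)
  | If q c1 c2 =>
      let l := (p + size (qcomp q 0) + csize c2 + 1)%N in
      qcomp q l ++ (compile c2 (p + size (qcomp q 0)) ++
        (Jump (l + csize c1) :: compile c1 l))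
  | While q c =>
      let l := (p + size (qcomp q 0) + 1)%N in
      qcomp q l ++ (Jump (l + csize c + 1) :: (compile c l ++ [:: Jump p]))
  end.

Lemma size_qcomp q l : size (qcomp q l) = size (qcomp q 0).
Proof. by case: q => e1 e2 /=; rewrite !size_cat. Qed.

Lemma size_compile c p : size (compile c p) = csize c.
Proof.
elim: c p => //= [x e|a e1 e2|d e r|c1 h1 c2 h2|q c1 h1 c2 h2|q c h] p;
  rewrite ?size_cat /= ?size_cat /= ?size_cat /= ?h1 ?h2 ?h ?size_qcomp; lia.
Qed.

(** * Correctness of the compiler *)

Section Simulation.
Variable prog : program.
Hypothesis W_gt8 : (8 < W)%N.

Local Notation run t m m' :=
  (iter t (obind (@step R W prog)) (Some m) = Some m').

Lemma run_cat t1 t2 m m1 m2 : run t1 m m1 -> run t2 m1 m2 -> run (t1 + t2) m m2.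
Proof. by move=> h1 h2; rewrite addnC iterD h1. Qed.

Definition code_at p (l : seq instr) :=
  forall i, (i < size l)%N -> onth prog (p + i) = onth l i.

Lemma code_at_cat p l1 l2 :
  code_at p (l1 ++ l2) -> code_at p l1 /\ code_at (p + size l1) l2.
Proof.
move=> h; split=> i hi.
  by rewrite h ?size_cat ?ltn_addr// !onthE map_cat nth_cat size_map hi.
rewrite -addnA h ?size_cat ?ltn_add2l// !onthE map_cat nth_cat size_map.
by rewrite ltnNge leq_addr /= addKn.
Qed.

Lemma code_at_cons p i l :
  code_at p (i :: l) -> onth prog p = Some i /\ code_at p.+1 l.
Proof.
move=> h; split=> [|j hj]; first by rewrite -[p]addn0 h.
by rewrite addSnnS h.
Qed.

Lemma run1 m i m' :
  onth prog (pc m) = Some i -> exec_instr W i m = Some m' -> run 1 m m'.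
Proof. by move=> h1 h2; rewrite /= /step h1 /= h2. Qed.

(** The word bounds belong to the invariant because copying a variable or loading a cell checks the
    range again. *)
Definition represents (s : store) (m : state R) : Prop :=
  [/\ forall x, ireg m (vreg x) = iv s x /\ (iv s x < W)%N,
      forall a i, imem m (8 * i + acode a) = ar s a i /\ (ar s a i < W)%N &
      forall (c : bool) i, rmem m (2 * i + c) = pxy s c i].

(** The even registers are the variables, which evaluating an expression never changes. The program
    counter and the real registers are tracked separately. *)
Definition same_below d (m m' : state R) : Prop :=
  [/\ forall r, ~~ odd r || (r < treg d)%N -> ireg m' r = ireg m r,
      imem m' = imem m & rmem m' = rmem m].

Lemma same_below_le d d' m1 m2 : (d <= d')%N ->
  same_below d' m1 m2 -> same_below d m1 m2.
Proof.
move=> dd' [h1 h2 h3]; split=> // r hr; rewrite h1//.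
by case/orP: hr => [->//|hr]; apply/orP; right; move: hr; rewrite /treg; lia.
Qed.

Lemma same_below_trans d d' m1 m2 m3 : (d <= d')%N ->
  same_below d m1 m2 -> same_below d' m2 m3 -> same_below d m1 m3.
Proof.
move=> dd' [h1 h2 h3] /(same_below_le dd')[k1 k2 k3].
by split; rewrite ?k2 ?k3 // => r hr; rewrite k1 ?h1.
Qed.

Lemma represents_same d s m m' :
  same_below d m m' -> represents s m -> represents s m'.
Proof.
move=> [h1 h2 h3] [k1 k2 k3]; split=> [x|a i|c i]; rewrite ?h2 ?h3//.
by rewrite h1 ?k1// /vreg odd_double.
Qed.

Lemma set_same_below d v (m : state R) :
  same_below d m
    (State (pc m).+1 [eta ireg m with treg d |-> v] (rreg m) (imem m) (rmem m)).
Proof.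
split=> //= r hr; case: eqP => // er; move: hr.
by rewrite er /treg /= odd_double ltnn.
Qed.

Lemma ieval_lt e s m : represents s m -> iok e s -> (ieval e s < W)%N.
Proof.
move=> [h1 h2 _]; elim: e => [x|c|op e1 i1 e2 i2|a e i] //=.
- by case: (h1 x).
- case=> /i1 l1 /i2 l2; case: op => //= _; first lia.
  by apply: leq_ltn_trans (leq_div _ _) l1.
- by move=> _; case: (h2 a (ieval e s)).
Qed.

Lemma const_opP o d k v v' m : (k < W)%N -> (v' < W)%N ->
  eval_int_op o v k = Some v' ->
  ireg m (treg d) = v -> code_at (pc m) (const_op o d k) ->
  exists m', [/\ run 2 m m', pc m' = (pc m + 2)%N, ireg m' (treg d) = v',
    same_below d m m' & rreg m' = rreg m].
Proof.
move=> kW vW ev mv /code_at_cons[c1] /code_at_cons[c2 _].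
pose m1 := State (pc m).+1 [eta ireg m with treg d.+1 |-> k]
    (rreg m) (imem m) (rmem m).
pose m2 := State (pc m1).+1 [eta ireg m1 with treg d |-> v']
    (rreg m1) (imem m1) (rmem m1).
have nd : (treg d == treg d.+1) = false by rewrite /treg; lia.
exists m2; split.
- apply: (run_cat (t1 := 1) (t2 := 1) (m1 := m1)).
    by apply: run1 c1 _; rewrite /= /set_ireg kW.
  by apply: (run1 (m := m1) c2); rewrite /= nd eqxx mv ev /= /set_ireg vW.
- by rewrite /=; lia.
- by rewrite /= eqxx.
- apply: (same_below_trans (leqnn d) _ (set_same_below d v' m1)).
  exact: (same_below_le (leqnSn d) (set_same_below d.+1 k m)).
- by [].
Qed.

Lemma addrP k c d v m : (k < W)%N -> (c < W)%N -> (k * v + c < W)%N ->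
  ireg m (treg d) = v -> code_at (pc m) (addr k c d) ->
  exists m', [/\ run 4 m m', pc m' = (pc m + 4)%N,
    ireg m' (treg d) = (k * v + c)%N, same_below d m m' & rreg m' = rreg m].
Proof.
move=> kW cW vW mv /code_at_cat[c1 c2].
have [||m1 [r1 p1 v1 s1 t1]] := const_opP (v' := (k * v)%N) kW _ _ mv c1.
- lia.
- by rewrite /= mulnC.
rewrite -p1 in c2.
have [|m2 [r2 p2 v2 s2 t2]] := const_opP cW vW _ v1 c2; first by [].
exists m2; split => //.
- exact: run_cat r1 r2.
- by rewrite p2 p1; lia.
- exact: (same_below_trans (leqnn d) s1 s2).
- by rewrite t2.
Qed.

Lemma icompP e d s m : represents s m -> iok e s ->
  code_at (pc m) (icomp e d) ->
  exists m', [/\ run (size (icomp e d)) m m',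
    pc m' = (pc m + size (icomp e d))%N, ireg m' (treg d) = ieval e s,
    same_below d m m' & rreg m' = rreg m].
Proof.
elim: e d m => [x|c|op e1 h1 e2 h2|a e h] d m rep.
- move=> _ /code_at_cons[c1 /code_at_cons[c2 _]].
  have [hx hW] : ireg m (vreg x) = iv s x /\ (iv s x < W)%N by case: rep.
  set m1 := State (pc m).+1 [eta ireg m with treg d |-> 0%N] (rreg m) (imem m)
    (rmem m).
  have r1 : run 1 m m1 by apply: run1 c1 _; rewrite /= /set_ireg ifT//; lia.
  have s1 : same_below d m m1 by exact: set_same_below.
  set m2 := State (pc m1).+1 [eta ireg m1 with treg d |-> iv s x] (rreg m)
    (imem m) (rmem m).
  have s2 : same_below d m1 m2 by exact: set_same_below.
  exists m2; split.
  + apply: (run_cat (t1 := 1) (t2 := 1) r1); apply: (run1 (m := m1) c2).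
    have nd : (vreg x == treg d) = false by rewrite /vreg /treg; lia.
    by rewrite /= eqxx nd addn0 /set_ireg hx hW.
  + by rewrite /=; lia.
  + by rewrite /= eqxx.
  + exact: same_below_trans s1 s2.
  + by [].
- move=> /= cW /code_at_cons[c1 _].
  set m1 := State (pc m).+1 [eta ireg m with treg d |-> c] (rreg m) (imem m)
    (rmem m).
  exists m1; split.
  + by apply: run1 c1 _; rewrite /= /set_ireg cW.
  + by rewrite /=; lia.
  + by rewrite /= eqxx.
  + exact: set_same_below.
  + by [].
- move=> ok; have lW := ieval_lt rep ok; case: ok => ok1 ok2 oko.
  move=> /code_at_cat[c1 /code_at_cat[c2 /code_at_cons[c3 _]]].
  have [m1 [r1 p1 v1 s1 t1]] := h1 _ _ rep ok1 c1.
  rewrite -p1 in c2 c3.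
  have [m2 [r2 p2 v2 s2 t2]] := h2 _ _ (represents_same s1 rep) ok2 c2.
  rewrite -p2 in c3.
  set m3 := State (pc m2).+1 [eta ireg m2 with treg d |-> ieval (IB op e1 e2) s]
    (rreg m2) (imem m2) (rmem m2).
  have s3 : same_below d m2 m3 by exact: set_same_below.
  exists m3; split => /=.
  + rewrite !size_cat /=; apply: (run_cat r1); apply: run_cat r2 _.
    apply: run1 c3 _; rewrite /= v2.
    have -> : ireg m2 (treg d) = ieval e1 s.
      by rewrite -v1; case: s2 => -> //; apply/orP; right; rewrite /treg; lia.
    rewrite /m3 /set_ireg; move: lW oko => /=.
    case: op {c2 c1 m3 s3} => /= lW oko; rewrite ?lW//=.
    by rewrite eqn0Ngt oko /= lW.
  + by rewrite !size_cat /= p2 p1; lia.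
  + by rewrite eqxx.
  + apply: (same_below_trans (leqnn d) s1).
    exact: (same_below_trans (leqnn d) (same_below_le (leqnSn d) s2) s3).
  + by rewrite t2.
- move=> ok; have lW := ieval_lt rep ok; case: ok => ok1 oka.
  move=> /code_at_cat[c1 /code_at_cat[c2 /code_at_cons[c3 _]]].
  have [m1 [r1 p1 v1 s1 t1]] := h _ _ rep ok1 c1.
  rewrite -p1 in c2 c3; have aW := acode_lt a.
  have [|||m2 [r2 p2 v2 s2 t2]] := addrP _ _ _ v1 c2; [lia|lia|lia|].
  rewrite -p2 in c3.
  have s12 := same_below_trans (leqnn d) s1 s2.
  have [_ /(_ a (ieval e s))[ha hl] _] := represents_same s12 rep.
  set m3 := State (pc m2).+1 [eta ireg m2 with treg d |-> ar s a (ieval e s)]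
    (rreg m2) (imem m2) (rmem m2).
  exists m3; split.
  + rewrite size_cat; apply: (run_cat r1); apply: (run_cat (t2 := 1) r2).
    by apply: (run1 c3); rewrite /= v2 ha /set_ireg hl.
  + by rewrite /= size_cat /= p2 p1; lia.
  + by rewrite /= eqxx.
  + exact: (same_below_trans (leqnn d) s12 (set_same_below _ _ _)).
  + by rewrite /= t2.
Qed.

Lemma rcompP e d s m : represents s m -> rok e s ->
  code_at (pc m) (rcomp e d) ->
  exists m', [/\ run (size (rcomp e d)) m m',
    pc m' = (pc m + size (rcomp e d))%N, rreg m' d = reval e s,
    same_below 1 m m' & forall r, (r < d)%N -> rreg m' r = rreg m r].
Proof.
elim: e d m => [c|op e1 h1 e2 h2|c e] d m rep.
- move=> _ /code_at_cons[c1 _]; exists (set_rreg m d c%:R); split.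
  + exact: run1 c1 _.
  + by rewrite /=; lia.
  + by rewrite /= eqxx.
  + by split.
  + by move=> r hr /=; rewrite ltn_eqF.
- move=> /= [ok1 ok2 oko].
  move=> /code_at_cat[c1 /code_at_cat[c2 /code_at_cons[c3 _]]].
  have [m1 [r1 p1 v1 s1 t1]] := h1 _ _ rep ok1 c1.
  rewrite -p1 in c2 c3.
  have [m2 [r2 p2 v2 s2 t2]] := h2 _ _ (represents_same s1 rep) ok2 c2.
  rewrite -p2 in c3.
  exists (set_rreg m2 d (rop op (reval e1 s) (reval e2 s))); split.
  + rewrite !size_cat /=; apply: (run_cat r1); apply: run_cat r2 _.
    apply: (run1 c3); rewrite /= v2 t2 // v1.
    by case: op oko {c1 c2 c3} => //= oko; rewrite (negbTE oko).
  + by rewrite !size_cat /= p2 p1; lia.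
  + by rewrite /= eqxx.
  + exact: (same_below_trans (leqnn 1) s1 s2).
  + by move=> r hr /=; rewrite ltn_eqF // t2 ?t1 //; lia.
- move=> [ok1 oke] /code_at_cat[c1 /code_at_cat[c2 /code_at_cons[c3 _]]].
  have [m1 [r1 p1 v1 s1 t1]] := icompP rep ok1 c1.
  rewrite -p1 in c2 c3; have cW : (c < 2)%N by case: (c).
  have [|||m2 [r2 p2 v2 s2 t2]] := addrP _ _ _ v1 c2; [lia|lia|lia|].
  rewrite -p2 in c3.
  have s12 := same_below_trans (leqnn 1) s1 s2.
  have [_ _ rx] := represents_same s12 rep.
  exists (set_rreg m2 d (pxy s c (ieval e s))); split.
  + rewrite size_cat /=; apply: (run_cat r1); apply: (run_cat (t2 := 1) r2).
    by apply: (run1 c3); rewrite /= v2 rx.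
  + by rewrite !size_cat /= p2 p1; lia.
  + by rewrite /= eqxx.
  + exact: s12.
  + by move=> r hr /=; rewrite ltn_eqF // t2 t1.
Qed.

Lemma qcompP q l s m : represents s m -> qok q s ->
  code_at (pc m) (qcomp q l) ->
  exists m', [/\ run (size (qcomp q 0)) m m',
    pc m' = (if qeval q s then l else pc m + size (qcomp q 0))%N &
    represents s m'].
Proof.
rewrite -(size_qcomp q l).
case: q => e1 e2 rep /= [ok1 ok2];
  move=> /code_at_cat[c1 /code_at_cat[c2 /code_at_cons[c3 _]]].
  have [m1 [r1 p1 v1 s1 t1]] := icompP rep ok1 c1.
  rewrite -p1 in c2 c3.
  have [m2 [r2 p2 v2 s2 t2]] := icompP (represents_same s1 rep) ok2 c2.
  rewrite -p2 in c3.
  have w1 : ireg m2 (treg 0) = ieval e1 s by rewrite -v1; case: s2 => ->.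
  exists (goto m2 (if (ieval e1 s < ieval e2 s)%N then l else (pc m2).+1));
    split.
  - rewrite !size_cat /=; apply: (run_cat r1); apply: (run_cat (t2 := 1) r2).
    by apply: (run1 c3); rewrite /= v2 w1.
  - by rewrite /=; case: ifP => // _; rewrite !size_cat /= p2 p1; lia.
  - exact: represents_same s2 (represents_same s1 rep).
have [m1 [r1 p1 v1 s1 t1]] := rcompP rep ok1 c1.
rewrite -p1 in c2 c3.
have [m2 [r2 p2 v2 s2 t2]] := rcompP (represents_same s1 rep) ok2 c2.
rewrite -p2 in c3.
have w1 : rreg m2 0 = reval e1 s by rewrite t2.
exists (goto m2 (if reval e1 s < reval e2 s then l else (pc m2).+1)); split.
- rewrite !size_cat /=; apply: (run_cat r1); apply: (run_cat (t2 := 1) r2).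
  by apply: (run1 c3); rewrite /= v2 w1.
- by rewrite /=; case: ifP => // _; rewrite !size_cat /= p2 p1; lia.
- exact: represents_same s2 (represents_same s1 rep).
Qed.

(** Each charged unit pays for a stretch of code without loops, at most [kappa] instructions long.
    Quantifying over every [kappa] above the code size lets sub-commands and the remaining
    iterations of a loop share the bound of the whole program. *)
Lemma compileP c s t s' : exec c s t s' ->
  forall kappa m, (csize c <= kappa)%N -> represents s m ->
  code_at (pc m) (compile c (pc m)) ->
  exists t' m', [/\ (t' <= kappa * t)%N, run t' m m',
    pc m' = (pc m + csize c)%N & represents s' m'].
Proof.
elim=> {c s t s'} [s|x e s ok|a e1 e2 s ok1 ok2 okW|c e r s ok1 ok2 okW
  |c1 c2 s t1 s1 t2 s2 _ h1 _ h2|q c1 c2 s t s' ok ex h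
  |q c s ok qF|q c s t1 s1 t2 s2 ok qT _ h1 _ h2] kappa m.
- by move=> _ rep _; exists 0%N, m; rewrite muln0 addn0.
- move=> /= hk rep /code_at_cat[c1 /code_at_cons[c2 /code_at_cons[c3 _]]].
  have eW := ieval_lt rep ok.
  have [m1 [r1 p1 v1 s1 t1]] := icompP rep ok c1; rewrite -p1 in c2 c3.
  pose m2 := State (pc m1).+1 [eta ireg m1 with treg 0 |-> 0%N]
    (rreg m1) (imem m1) (rmem m1).
  pose m3 := State (pc m2).+1 [eta ireg m2 with vreg x |-> ieval e s]
    (rreg m2) (imem m2) (rmem m2).
  exists (size (icomp e 1)).+2, m3; split.
  + by rewrite muln1.
  + rewrite -addn2; apply: (run_cat r1).
    apply: (run_cat (t1 := 1) (t2 := 1) (m1 := m2)).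
      by apply: (run1 c2); rewrite /= /set_ireg ifT //; lia.
    apply: (run1 (m := m2) c3).
    by rewrite /= v1 addn0 /set_ireg eW.
  + by rewrite /= p1; lia.
  + have [k1 k2 k3] := represents_same (same_below_trans (leqnn 0)
      (same_below_le (leq0n 1) s1) (set_same_below 0 0 m1)) rep.
    split=> // y; rewrite /=; have [hy1 hy2] := k1 y.
    case: veqP => [->|nxy]; first by rewrite eqxx.
    rewrite ifF //; apply/negP => /eqP /double_inj.
    by move=> /(can_inj vcodeK) /nxy.
- move=> hk rep /code_at_cat[c1 /code_at_cat[c2]].
  move=> /code_at_cat[c3 /code_at_cons[c4 _]].
  have eW := ieval_lt rep ok2; have aW := acode_lt a.
  have [m1 [r1 p1 v1 s1 t1]] := icompP rep ok1 c1; rewrite -p1 in c2 c3 c4.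
  have [|||m2 [r2 p2 v2 s2 t2]] := addrP _ _ _ v1 c2; [lia|lia|lia|].
  rewrite -p2 in c3 c4.
  have rep2 := represents_same (same_below_trans (leqnn 0) s1 s2) rep.
  have [m3 [r3 p3 v3 s3 t3]] := icompP rep2 ok2 c3; rewrite -p3 in c4.
  have w3 : ireg m3 (treg 0) = (8 * ieval e1 s + acode a)%N.
    by rewrite -v2; case: s3 => ->.
  exists (size (icomp e1 0) + 4 + size (icomp e2 1) + 1)%N; eexists; split.
  + by rewrite muln1.
  + rewrite -!addnA; apply: (run_cat r1); apply: (run_cat r2 (run_cat r3 _)).
    exact: (run1 c4).
  + by rewrite /= p3 p2 p1; lia.
  + have [k1 k2 k3] := represents_same s3 rep2.
    split=> //= b i; rewrite w3 v3; have [hb1 hb2] := k2 b i.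
    case: aeqP hb1 hb2 => [->|nab] hb1 hb2.
      by rewrite eqn_add2r eqn_pmul2l //; case: eqP.
    rewrite ifF //; apply/eqP => E; apply: nab; apply: (can_inj acodeK).
    by have := acode_lt b; lia.
- move=> hk rep /code_at_cat[c1 /code_at_cat[c2]].
  move=> /code_at_cat[c3 /code_at_cons[c4 _]].
  have [m1 [r1 p1 v1 s1 t1]] := icompP rep ok1 c1; rewrite -p1 in c2 c3 c4.
  have cW : (c < 2)%N by case: (c).
  have [|||m2 [r2 p2 v2 s2 t2]] := addrP _ _ _ v1 c2; [lia|lia|lia|].
  rewrite -p2 in c3 c4.
  have rep2 := represents_same (same_below_trans (leqnn 0) s1 s2) rep.
  have [m3 [r3 p3 v3 s3 t3]] := rcompP rep2 ok2 c3; rewrite -p3 in c4.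
  have w3 : ireg m3 (treg 0) = (2 * ieval e s + c)%N by rewrite -v2;
    case: s3 => ->.
  exists (size (icomp e 0) + 4 + size (rcomp r 0) + 1)%N; eexists; split.
  + by rewrite muln1.
  + rewrite -!addnA; apply: (run_cat r1); apply: (run_cat r2 (run_cat r3 _)).
    exact: (run1 c4).
  + by rewrite /= p3 p2 p1; lia.
  + have [k1 k2 k3] := represents_same s3 rep2.
    case: c w3 {hk c2 cW v2} => w3; split=> //= -[] i; rewrite w3 v3 k3 /pxy /=;
      by [rewrite eqn_add2r eqn_pmul2l | rewrite ifF //; lia].
- move=> /= hk rep /code_at_cat[d1 d2]; rewrite size_compile in d2.
  have [|u1 [m1 [l1 r1 p1 rep1]]] := h1 kappa m _ rep d1; first lia.
  rewrite -p1 in d2.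
  have [|u2 [m2 [l2 r2 p2 rep2]]] := h2 kappa m1 _ rep1 d2; first lia.
  exists (u1 + u2)%N, m2; split=> //; first by rewrite mulnDr leq_add.
    exact: run_cat r1 r2.
  by rewrite p2 p1 addnA.
- rewrite [csize _]/= [compile _ _]/= => hk rep.
  move=> /code_at_cat[d1 /code_at_cat[d2 /code_at_cons[d3 d4]]].
  have [m1 [r1 p1 rep1]] := qcompP rep ok d1.
  rewrite size_qcomp size_compile in d2 d3 d4.
  move: h p1; case: (qeval q s) => h p1.
    have d4' : code_at (pc m1) (compile c1 (pc m1)) by move: d4;
      rewrite p1 !addn1.
    have [|u2 [m2 [l2 r2 p2 rep2]]] := h kappa m1 _ rep1 d4'; first lia.
    exists (size (qcomp q 0) + u2)%N, m2; split=> //.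
    + by rewrite mulnS leq_add //; lia.
    + exact: run_cat r1 r2.
    + by rewrite p2 p1; lia.
  rewrite -p1 in d2 d3.
  have [|u2 [m2 [l2 r2 p2 rep2]]] := h kappa m1 _ rep1 d2; first lia.
  rewrite -p2 in d3.
  exists (size (qcomp q 0) + (u2 + 1))%N; eexists; split=> //.
  + by rewrite mulnS; lia.
  + apply: (run_cat r1 (run_cat r2 _)); exact: (run1 d3).
  + by rewrite /=; lia.
  + exact: rep2.
- rewrite [csize _]/= [compile _ _]/= => hk rep.
  move=> /code_at_cat[d1 /code_at_cons[d2 _]].
  have [m1 [r1 p1 rep1]] := qcompP rep ok d1.
  rewrite size_qcomp in d2; rewrite qF in p1; rewrite -p1 in d2.
  exists (size (qcomp q 0) + 1)%N; eexists; split=> //.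
  + by rewrite muln1; lia.
  + apply: (run_cat r1); exact: (run1 d2).
  + by rewrite /=; lia.
  + exact: rep1.
- move=> hk rep cd; move: (cd) (hk).
  rewrite [csize _]/= [compile _ _]/= => + hk'.
  move=> /code_at_cat[d1 /code_at_cons[_ /code_at_cat[d2 /code_at_cons[d3 _]]]].
  have [m1 [r1 p1 rep1]] := qcompP rep ok d1.
  rewrite size_qcomp size_compile in d2 d3; rewrite qT in p1.
  have d2' : code_at (pc m1) (compile c (pc m1)) by move: d2; rewrite p1 !addn1.
  have [|u2 [m2 [l2 r2 p2 rep2]]] := h1 kappa m1 _ rep1 d2'; first lia.
  have d3' : onth prog (pc m2) = Some (Jump (pc m)).
    by move: d3; rewrite p2 p1 !addn1.
  have [u3 [m3 [l3 r3 p3 rep3]]] := h2 kappa (goto m2 (pc m)) hk rep2 cd.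
  exists (size (qcomp q 0) + (u2 + (1 + u3)))%N, m3; split=> //.
  + by rewrite mulnS mulnDr; lia.
  + apply: (run_cat r1 (run_cat r2 _)).
    apply: (run_cat (t1 := 1) (m1 := goto m2 (pc m))) r3; exact: (run1 d3').
Qed.

End Simulation.
End Exec.
End Language.

(** * Total correctness with time bounds *)

Fixpoint ivars (c : com) : seq var :=
  match c with
  | SetI x _ => [:: x]
  | Seq c1 c2 | If _ c1 c2 => ivars c1 ++ ivars c2
  | While _ c => ivars c
  | _ => [::]
  end.

Fixpoint arrs (c : com) : seq arr :=
  match c with
  | SetA a _ _ => [:: a]
  | Seq c1 c2 | If _ c1 c2 => arrs c1 ++ arrs c2
  | While _ c => arrs c
  | _ => [::]
  end.

Fixpoint setsxy (c : com) : bool :=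
  match c with
  | SetR _ _ _ => true
  | Seq c1 c2 | If _ c1 c2 => setsxy c1 || setsxy c2
  | While _ c => setsxy c
  | _ => false
  end.

Section Spec.
Variables (R : realFieldType) (W : nat).
Implicit Types (s : store R) (Q : store R -> Prop) (T : nat).

(** Read off the syntax, so that invariants need not carry along what a command cannot touch. The
    real memory is treated as all or nothing. *)
Definition framed c s s' : Prop :=
  [/\ forall x, ~~ has (veq x) (ivars c) -> iv s' x = iv s x,
      forall a, ~~ has (aeq a) (arrs c) -> ar s' a = ar s a &
      ~~ setsxy c -> px s' = px s /\ py s' = py s].

Lemma exec_framed c s t s' : exec W c s t s' -> framed c s s'.
Proof.
elim=> {c s t s'} [s|x e s _|a e1 e2 s _ _ _|c e r s _ _ _
  |c1 c2 s t1 s1 t2 s2 _ h1 _ h2|q c1 c2 s t s' _ _ h|q c s _ _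
  |q c s t1 s1 t2 s2 _ _ _ h1 _ h2].
- by split.
- by split=> // y; rewrite /= orbF => /negbTE ->.
- by split=> // b; rewrite /= orbF => /negbTE ->.
- by case: c.
- have [a1 a2 a3] := h1; have [b1 b2 b3] := h2; split=> /=.
  + by move=> x; rewrite has_cat negb_or => /andP[x1 x2]; rewrite b1 ?a1.
  + by move=> x; rewrite has_cat negb_or => /andP[x1 x2]; rewrite b2 ?a2.
  + by rewrite negb_or => /andP[/a3[<- <-] /b3[-> ->]].
- have [a1 a2 a3] := h; split=> /=.
  + move=> x; rewrite has_cat negb_or => /andP[x1 x2]; apply: a1.
    by case: (qeval q s).
  + move=> x; rewrite has_cat negb_or => /andP[x1 x2]; apply: a2.
    by case: (qeval q s).
  + rewrite negb_or => /andP[x1 x2]; apply: a3; by case: (qeval q s).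
- by split.
- have [a1 a2 a3] := h1; have [b1 b2 b3] := h2; split=> /=.
  + by move=> x hx; rewrite b1 ?a1.
  + by move=> x hx; rewrite b2 ?a2.
  + by move=> hx; have [-> ->] := b3 hx; have [-> ->] := a3 hx.
Qed.

Definition spec c s T Q := exists t s', [/\ exec W c s t s', (t <= T)%N & Q s'].

Lemma spec_frame c s T Q :
  spec c s T Q -> spec c s T (fun s' => Q s' /\ framed c s s').
Proof. by move=> [t [s' [h1 h2 h3]]]; exists t, s'; split=> //; split=> //;
  exact: exec_framed h1. Qed.

Lemma spec_weaken c s T T' Q Q' :
  spec c s T Q -> (T <= T')%N -> (forall s', Q s' -> Q' s') -> spec c s T' Q'.
Proof.
move=> [t [s' [h1 h2 h3]]] hT hQ; exists t, s'; split=> //; last exact: hQ.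
exact: leq_trans h2 hT.
Qed.

Lemma spec_skip s T Q : Q s -> spec Skip s T Q.
Proof. by exists 0%N, s; split=> //; constructor. Qed.

Lemma spec_seti x e s T Q : iok W e s -> (0 < T)%N ->
  Q (seti s x (ieval e s)) ->
  spec (SetI x e) s T Q.
Proof. by move=> h1 h2 h3; eexists _, _; split; [constructor| |exact: h3]. Qed.

Lemma spec_seta a e1 e2 s T Q : iok W e1 s -> iok W e2 s ->
  (8 * ieval e1 s + 8 <= W)%N -> (0 < T)%N ->
  Q (seta s a (ieval e1 s) (ieval e2 s)) -> spec (SetA a e1 e2) s T Q.
Proof. by move=> h1 h2 h3 h4 h5; eexists _, _; split;
  [constructor| |exact: h5]. Qed.

Lemma spec_setr c e r s T Q : iok W e s -> rok W r s ->
  (2 * ieval e s + 2 <= W)%N -> (0 < T)%N ->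
  Q (setr s c (ieval e s) (reval r s)) -> spec (SetR c e r) s T Q.
Proof. by move=> h1 h2 h3 h4 h5; eexists _, _; split;
  [constructor| |exact: h5]. Qed.

Lemma spec_seq T1 c1 c2 s T Q : (T1 <= T)%N ->
  spec c1 s T1 (fun s' => spec c2 s' (T - T1) Q) -> spec (Seq c1 c2) s T Q.
Proof.
move=> hT [t1 [s1 [h1 l1 [t2 [s2 [h2 l2 hQ]]]]]].
exists (t1 + t2)%N, s2; split=> //; first exact: ExSeq h1 h2.
by move: l1 l2 hT; lia.
Qed.

Lemma spec_if q c1 c2 s T Q : qok W q s -> (0 < T)%N ->
  (qeval q s -> spec c1 s T.-1 Q) -> (qeval q s = false -> spec c2 s T.-1 Q) ->
  spec (If q c1 c2) s T Q.
Proof.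
move=> ok hT h1 h2.
have [t [s' [h l hQ]]] : spec (if qeval q s then c1 else c2) s T.-1 Q.
  by case: (boolP (qeval q s)) => [/h1|/negbTE/h2].
by exists t.+1, s'; split=> //; [constructor|lia].
Qed.

(* [I a T s]: with ghost state a, the remaining iterations take at most T. *)
Lemma spec_while (A : Type) (I : A -> nat -> store R -> Prop) q c a s T Q :
  (forall a T s, I a T s -> qok W q s /\ (0 < T)%N) ->
  (forall a T s, I a T s -> qeval q s = false -> Q s) ->
  (forall a T s, I a T s -> qeval q s ->
     exists T', (T' < T)%N /\
       spec c s T' (fun s' => exists a', I a' (T - T'.+1)%N s')) ->
  I a T s -> spec (While q c) s T Q.
Proof.
move=> hok hF hT; elim/ltn_ind: T a s => T IH a s hI.
have [ok T0] := hok _ _ _ hI.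
case qE: (qeval q s); last first.
  by exists 1%N, s; split; [constructor| |exact: hF hI qE].
have [T' [lT [t1 [s1 [h1 l1 [a' hI']]]]]] := hT _ _ _ hI qE.
have [|t2 [s2 [h2 l2 hQ]]] := IH (T - T'.+1)%N _ _ _ hI'; first lia.
exists (t1 + t2).+1, s2; split=> //; last by move: l1 l2 lT; lia.
exact: ExWhileT qE h1 h2.
Qed.

(* For amortized bounds: Q is told how much of the budget T is left. *)
Definition specR c s T (Q : nat -> store R -> Prop) :=
  exists t s', [/\ exec W c s t s', (t <= T)%N & Q (T - t)%N s'].

Lemma specR_spec c s T (Q : store R -> Prop) : specR c s T (fun _ => Q) ->
  spec c s T Q.
Proof. by []. Qed.

Lemma spec_specR T1 c s T (Q : nat -> store R -> Prop) : (T1 <= T)%N ->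
  spec c s T1 (fun s' => forall T', (T - T1 <= T')%N -> Q T' s') ->
    specR c s T Q.
Proof.
move=> hT [t [s' [h1 h2 h3]]]; exists t, s'; split=> //;
  first exact: leq_trans hT.
by apply: h3; rewrite leq_sub2l.
Qed.

Lemma specR_seq c1 c2 s T (Q : nat -> store R -> Prop) :
  specR c1 s T (fun T' s' => specR c2 s' T' Q) -> specR (Seq c1 c2) s T Q.
Proof.
move=> [t1 [s1 [h1 l1 [t2 [s2 [h2 l2 hQ]]]]]].
exists (t1 + t2)%N, s2; split; [exact: ExSeq h1 h2|lia|by rewrite subnDA].
Qed.

Lemma specR_seti_seq x e c s T (Q : nat -> store R -> Prop) : iok W e s ->
  (0 < T)%N ->
  specR c (seti s x (ieval e s)) T.-1 Q -> specR (Seq (SetI x e) c) s T Q.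
Proof.
move=> h1 h2 h3; apply: specR_seq; exists 1%N; eexists; split=> //.
  exact: ExSetI.
by rewrite subn1.
Qed.

Lemma specR_while (A : Type) (I : A -> nat -> store R -> Prop) q c a s T
    (Q : nat -> store R -> Prop) :
  (forall a T s, I a T s -> qok W q s /\ (0 < T)%N) ->
  (forall a T s, I a T s -> qeval q s = false -> Q T.-1 s) ->
  (forall a T s, I a T s -> qeval q s ->
     specR c s T.-1 (fun T' s' => exists a', I a' T' s')) ->
  I a T s -> specR (While q c) s T Q.
Proof.
move=> hok hF hT; elim/ltn_ind: T a s => T IH a s hI.
have [ok T0] := hok _ _ _ hI.
case qE: (qeval q s); last first.
  exists 1%N, s; split; [by constructor|by []|rewrite subn1; exact: hF hI qE].
have [t1 [s1 [h1 l1 [a' hI']]]] := hT _ _ _ hI qE.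
have [|t2 [s2 [h2 l2 hQ]]] := IH _ _ _ _ hI'; first lia.
exists (t1 + t2).+1, s2; split; [exact: ExWhileT qE h1 h2|lia|].
by rewrite (_ : T - (t1 + t2).+1 = T.-1 - t1 - t2)%N //; lia.
Qed.

End Spec.
Notation "c1 ;; c2" := (Seq c1 c2) (at level 100, right associativity).

(** * Extreme points in the plane *)

Section Geometry.
Variable R : realFieldType.
Variables x y : nat -> R.
Implicit Types (i j k p q t e lo hi : nat) (c : nat -> nat).

Definition dot (ux uy : R) i := ux * x i + uy * y i.

(* Outer normals of upper hulls, up to a positive factor. *)
Definition upward (ux uy : R) := 0 <= uy /\ (uy = 0 -> ux != 0).

(* In direction (ux, uy) point i is extreme compared to j, with ties resolved
   in favour of the left point, as if the direction were turned slightly to the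
   left. *)
Definition beats ux uy i j :=
  (dot ux uy j < dot ux uy i) || (dot ux uy j == dot ux uy i) && (x i <= x j).

(** Twice the signed area of the triangle; negative exactly for a right turn, as along an upper
    hull. *)
Definition cross i j k := (x j - x i) * (y k - y i) - (y j - y i) * (x k - x i).

Lemma beats_refl ux uy i : beats ux uy i i.
Proof. by rewrite /beats eqxx lexx orbT. Qed.

Lemma beats_trans ux uy i j k :
  beats ux uy i j -> beats ux uy j k -> beats ux uy i k.
Proof.
rewrite /beats => /orP[h1|/andP[/eqP h1 h1']] /orP[h2|/andP[/eqP h2 h2']].
- by rewrite (lt_trans h2 h1).
- by rewrite h2 h1.
- by rewrite -h1 h2.
- by rewrite h2 h1 eqxx (le_trans h1' h2') orbT.
Qed.

Lemma beats_total ux uy i j : beats ux uy i j || beats ux uy j i.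
Proof. by rewrite /beats; case: (ltgtP (dot ux uy j)) => //= _;
  exact: le_total. Qed.

Lemma beats_dot ux uy i j : beats ux uy i j -> dot ux uy j <= dot ux uy i.
Proof. by case/orP => [/ltW//|/andP[/eqP->]]. Qed.

Lemma beats_anti ux uy i j : beats ux uy i j -> beats ux uy j i -> x i = x j.
Proof.
rewrite /beats => /orP[h1|/andP[/eqP h1 h1']] /orP[h2|/andP[/eqP h2 h2']].
- by have := lt_trans h1 h2; rewrite ltxx.
- by move: h1; rewrite h2 ltxx.
- by move: h2; rewrite h1 ltxx.
- by apply: le_anti; rewrite h1' h2'.
Qed.

(** Here [j] lies on or below the segment from [i] to [k]. If [j] is strictly further out than [i],
    then so is [k] compared to [j], because the slope from [i] to [k] is at least the slope from [i]
    to [j]. Otherwise [i] wins, if need be as the left point of a tie. *)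
Lemma beats_below ux uy i j k : upward ux uy -> x i < x j -> x j < x k ->
  0 <= cross i j k -> beats ux uy i j || beats ux uy k j.
Proof.
move=> [u0 _] ij jk; rewrite /cross /beats => c0.
case: (ltP (dot ux uy i) (dot ux uy j)) => [h|]; last first.
  rewrite le_eqVlt => /orP[->|->//]; by rewrite (ltW ij) orbT.
suff -> : dot ux uy j < dot ux uy k by rewrite orbT.
move: h; rewrite /dot => h.
have : 0 <= uy * ((x j - x i) * (y k - y i) - (y j - y i) * (x k - x i)).
  exact: mulr_ge0.
nra.
Qed.

Definition increasing c lo hi :=
  forall t, (lo <= t)%N -> (t.+1 < hi)%N -> x (c t) < x (c t.+1).

Definition concave c lo hi :=
  forall t, (lo <= t)%N -> (t.+2 < hi)%N -> cross (c t) (c t.+1) (c t.+2) < 0.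

(** Dual form of lying on or below the chain. Stated by directions it composes with [beats_trans]
    and requires no search for the edge above [p]. *)
Definition covered c lo hi p := forall ux uy, upward ux uy ->
  exists2 t, (lo <= t < hi)%N & beats ux uy (c t) p.

Lemma increasing_lt c lo hi t t' : increasing c lo hi ->
  (lo <= t)%N -> (t < t')%N -> (t' < hi)%N -> x (c t) < x (c t').
Proof.
move=> h lt; elim: t' => // t' IH; rewrite ltnS leq_eqVlt => /orP[/eqP<-|tt']
  th.
  exact: h.
by apply: lt_trans (IH tt' (ltnW th)) _; apply: h => //; lia.
Qed.

Lemma increasing_leq c lo hi t t' : increasing c lo hi ->
  (lo <= t')%N -> (t < hi)%N -> x (c t) <= x (c t') -> (t <= t')%N.
Proof.
move=> h lt th; rewrite leqNgt; apply: contraL => tt'.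
by rewrite -ltNge (increasing_lt h).
Qed.

Definition rises ux uy c t := dot ux uy (c t) < dot ux uy (c t.+1).

(** Concavity makes a linear functional unimodal along the chain: its increment per unit of abscissa
    does not grow from one edge to the next. *)
Lemma fall_next ux uy c lo hi t : upward ux uy -> increasing c lo hi ->
  concave c lo hi -> (lo <= t)%N -> (t.+2 < hi)%N ->
  ~~ rises ux uy c t -> ~~ rises ux uy c t.+1.
Proof.
move=> [u0 _] hi1 hc lt th; rewrite /rises -!leNgt /dot => h.
have x1 := hi1 _ lt (ltnW th); have x2 : x (c t.+1) < x (c t.+2) by apply: hi1;
  lia.
have := hc _ lt th; rewrite /cross => cr.
have h2 : uy * ((x (c t.+1) - x (c t)) * (y (c t.+2) - y (c t)) -
  (y (c t.+1) - y (c t)) * (x (c t.+2) - x (c t))) <= 0.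
  by rewrite mulr_ge0_le0 // ltW.
rewrite -subr_ge0 -(pmulr_rge0 _ (_ : 0 < x (c t.+1) - x (c t))) ?subr_gt0//.
have h3 : (x (c t.+2) - x (c t.+1)) *
  (ux * x (c t.+1) + uy * y (c t.+1) - (ux * x (c t) + uy * y (c t))) <= 0.
  by rewrite mulr_ge0_le0 ?subr_ge0 ?subr_le0 // ltW.
lra.
Qed.

Lemma fall_after ux uy c lo hi t t' : upward ux uy -> increasing c lo hi ->
  concave c lo hi -> (lo <= t <= t')%N -> (t'.+1 < hi)%N ->
  ~~ rises ux uy c t -> ~~ rises ux uy c t'.
Proof.
move=> hu hi1 hc /andP[lt]; elim: t' => [|t' IH] tt' th hr.
  by move: tt'; rewrite leqn0 => /eqP <-.
move: tt'; rewrite leq_eqVlt => /orP[/eqP<-//|tt'].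
by apply: (fall_next hu hi1 hc) => //; [lia|apply: IH => //; lia].
Qed.

Lemma rise_before ux uy c lo hi t t' : upward ux uy -> increasing c lo hi ->
  concave c lo hi -> (lo <= t <= t')%N -> (t'.+1 < hi)%N ->
  rises ux uy c t' -> rises ux uy c t.
Proof.
move=> hu hi1 hc tt' th; apply: contraTT => h; exact: fall_after hc tt' th h.
Qed.

(** The first maximum of a unimodal sequence, in terms of single edges that a binary search can
    establish. *)
Definition peak ux uy c lo hi e :=
  [/\ (lo <= e < hi)%N, forall t, (lo <= t < e)%N -> rises ux uy c t &
      (e.+1 < hi)%N -> ~~ rises ux uy c e].

Lemma peak_beats ux uy c lo hi e : upward ux uy -> increasing c lo hi ->
  concave c lo hi -> peak ux uy c lo hi e ->
  forall t, (lo <= t < hi)%N -> beats ux uy (c e) (c t).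
Proof.
move=> hu hi1 hc [/andP[le eh] h1 h2] t /andP[lt th].
have [te|et] := leqP t e.
  have H : forall m, (t <= m <= e)%N -> beats ux uy (c m) (c t).
    elim=> [|m IH]; first by rewrite leqn0 => /andP[/eqP-> _];
      exact: beats_refl.
    rewrite leq_eqVlt => /andP[/orP[/eqP<- _|tm me]]; first exact: beats_refl.
    apply: (beats_trans (j := c m)); last by apply: IH; lia.
    by have := h1 m; rewrite /rises /beats => -> //; lia.
  by apply: H; rewrite te leqnn.
have H : forall m, (e <= m < hi)%N -> beats ux uy (c e) (c m).
  elim=> [|m IH]; first by rewrite leqn0 => /andP[/eqP-> _]; exact: beats_refl.
  rewrite leq_eqVlt => /andP[/orP[/eqP<- _|em mh]]; first exact: beats_refl.
  apply: (beats_trans (j := c m)); first by apply: IH; lia.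
  have nr : ~~ rises ux uy c m.
    apply: (fall_after (t := e) hu hi1 hc); [lia|by []|by apply: h2; lia].
  move: nr; rewrite /rises /beats -leNgt le_eqVlt => /orP[->|->//].
  by rewrite ltW ?orbT //; apply: hi1; lia.
by apply: H; lia.
Qed.

(* Extreme points move to the right as the direction turns to the right. *)
Definition turns_right (u v : R * R) := forall dx dy, dx < 0 ->
  u.1 * dx + u.2 * dy < 0 -> v.1 * dx + v.2 * dy < 0.

(** If [q] were left of [p], then [p] would beat it in direction [u] strictly, since ties go left.
    The leftward vector from [p] to [q] would then lose in direction [v] as well, and [q] could not
    beat [p] there. *)
Lemma turns_right_le (u v : R * R) p q : turns_right u v ->
  beats u.1 u.2 p q -> beats v.1 v.2 q p -> x p <= x q.
Proof.
move=> tr b1 b2; rewrite leNgt; apply/negP => qp.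
have h : u.1 * (x q - x p) + u.2 * (y q - y p) < 0.
  case/orP: b1; rewrite /dot; last by rewrite leNgt qp andbF.
  by move=> h; lra.
have := tr _ _ _ h; rewrite subr_lt0 => /(_ qp).
by have := beats_dot b2; rewrite /dot; lra.
Qed.

(** Minus the slope: [(normal p q, 1)] is the upward normal of the edge, so a single number encodes
    its direction. *)
Definition normal p q := (y p - y q) / (x q - x p).

Lemma rises_normal ux c t : x (c t) < x (c t.+1) ->
  rises ux 1 c t = (normal (c t) (c t.+1) < ux).
Proof.
move=> h; rewrite /rises /dot /normal ltr_pdivrMr ?subr_gt0 //.
by apply/idP/idP; lra.
Qed.

Lemma normal_next c lo hi t : increasing c lo hi -> concave c lo hi ->
  (lo <= t)%N -> (t.+2 < hi)%N ->
  normal (c t) (c t.+1) < normal (c t.+1) (c t.+2).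
Proof.
move=> h1 h2 lt th; have := h2 _ lt th; rewrite /cross /normal => cr.
have x1 := h1 _ lt (ltnW th); have x2 : x (c t.+1) < x (c t.+2) by apply: h1;
  lia.
rewrite ltr_pdivrMr ?subr_gt0 // mulrAC ltr_pdivlMr ?subr_gt0 //.
lra.
Qed.

Lemma normal_lt c lo hi t t' : increasing c lo hi -> concave c lo hi ->
  (lo <= t)%N -> (t < t')%N -> (t'.+1 < hi)%N ->
  normal (c t) (c t.+1) < normal (c t') (c t'.+1).
Proof.
move=> h1 h2 lt; elim: t' => // t' IH; rewrite ltnS leq_eqVlt.
move=> /orP[/eqP<-|tt'] th; first exact: (normal_next h1 h2).
apply: lt_trans (IH tt' (ltnW th)) _; apply: (normal_next h1 h2) => //; lia.
Qed.

(** Both ends of the edge tie in the direction of its normal, and the tie goes to the left end. *)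
Lemma peak_normal c lo hi t : increasing c lo hi -> concave c lo hi ->
  (lo <= t)%N -> (t.+1 < hi)%N -> peak (normal (c t) (c t.+1)) 1 c lo hi t.
Proof.
move=> h1 h2 lt th; split=> [|s /andP[ls st]|_]; first lia.
  rewrite rises_normal; first by apply: (normal_lt h1 h2).
  by apply: h1 => //; lia.
by rewrite rises_normal ?ltxx //; apply: h1.
Qed.

Lemma upward1 ux : upward ux 1.
Proof. by split=> [|/eqP]; rewrite ?ler01 ?oner_eq0. Qed.

Definition best n ux uy p :=
  (p < n)%N /\ forall q, (q < n)%N -> beats ux uy p q.

Lemma best_exists n ux uy : (0 < n)%N -> exists p, best n ux uy p.
Proof.
case: n => // n _; elim: n => [|n [p [pn hp]]].
  by exists 0%N; split=> // q; rewrite ltnS leqn0 => /eqP->; exact: beats_refl.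
have /orP[h|h] := beats_total ux uy p n.+1.
  exists p; split; first exact: ltnW.
  by move=> q; rewrite ltnS leq_eqVlt => /orP[/eqP->//|]; exact: hp.
exists n.+1; split=> // q; rewrite ltnS leq_eqVlt => /orP[/eqP->|qn].
  exact: beats_refl.
exact: beats_trans h (hp _ qn).
Qed.

(* The vertices of the upper hull of points 0 .. n, from left to right. *)
Definition hull_of n c h :=
  [/\ (0 < h)%N, increasing c 0 h, concave c 0 h,
     forall t, (t < h)%N -> (c t < n)%N &
     forall p, (p < n)%N -> covered c 0 h p].

Lemma hull_of_peak n c h ux uy t : hull_of n c h -> upward ux uy ->
  peak ux uy c 0 h t -> best n ux uy (c t).
Proof.
move=> [h0 inc conc cn cov] hu hp; have [/andP[_ th] _ _] := hp.
split; first exact: cn.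
move=> q /cov /(_ _ _ hu) [t' t'h]; apply: beats_trans.
exact: peak_beats hp _ t'h.
Qed.

Lemma upward_left : upward (-1) 0.
Proof. by split=> // _; rewrite oppr_eq0 oner_eq0. Qed.

Lemma upward_right : upward 1 0.
Proof. by split=> // _; rewrite oner_eq0. Qed.

Lemma hull_of_first n c h : hull_of n c h -> best n (-1) 0 (c 0%N).
Proof.
move=> hh; have [h0 inc _ _ _] := hh; apply: (hull_of_peak hh upward_left).
split=> // h1; rewrite /rises /dot !mul0r !addr0 !mulN1r ltrN2 -leNgt ltW //.
exact: inc.
Qed.

Lemma hull_of_last n c h : hull_of n c h -> best n 1 0 (c h.-1).
Proof.
move=> hh; have [h0 inc _ _ _] := hh; apply: (hull_of_peak hh upward_right).
split; [lia| |by rewrite prednK // ltnn] => t ht.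
rewrite /rises /dot !mul0r !addr0 !mul1r; apply: inc => //; lia.
Qed.

(** A vertex with an edge to its right is extreme for the normal of that edge; the last vertex is
    extreme in the horizontal direction. *)
Lemma hull_of_best n c h t : hull_of n c h -> (t < h)%N ->
  exists ux uy, upward ux uy /\ best n ux uy (c t).
Proof.
move=> hh th; have [_ inc conc _ _] := hh; have [th1|th1] := ltnP t.+1 h.
  exists (normal (c t) (c t.+1)), 1; split; first exact: upward1.
  apply: (hull_of_peak hh (upward1 _)); exact: peak_normal.
have -> : t = h.-1 by lia.
by exists 1, 0; split; [exact: upward_right|exact: hull_of_last].
Qed.

End Geometry.

(** * Invariance under changes of the points from index n on, where directions will be stored *)

Section Agreement.
Variables (R : realFieldType) (x y x' y' : nat -> R) (n : nat).
Hypothesis xy : forall p, (p < n)%N -> x' p = x p /\ y' p = y p.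

Lemma beats_agree ux uy p q : (p < n)%N -> (q < n)%N ->
  beats x' y' ux uy p q = beats x y ux uy p q.
Proof. by move=> /xy[px py] /xy[qx qy]; rewrite /beats /dot px py qx qy. Qed.

Lemma best_agree ux uy p : best x' y' n ux uy p <-> best x y n ux uy p.
Proof.
split=> -[pn h]; split=> // q qn; first by rewrite -beats_agree ?h.
by rewrite beats_agree ?h.
Qed.

Lemma increasing_agree c lo hi : (forall t, (lo <= t < hi)%N -> (c t < n)%N) ->
  increasing x c lo hi -> increasing x' c lo hi.
Proof.
move=> cn h t lt th; have [|-> _] := @xy (c t); first by apply: cn; lia.
have [|-> _] := @xy (c t.+1); first by apply: cn; lia.
exact: h.
Qed.

Lemma concave_agree c lo hi : (forall t, (lo <= t < hi)%N -> (c t < n)%N) ->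
  concave x y c lo hi -> concave x' y' c lo hi.
Proof.
move=> cn h t lt th; have := h t lt th; rewrite /cross.
have [|-> ->] := @xy (c t); first by apply: cn; lia.
have [|-> ->] := @xy (c t.+1); first by apply: cn; lia.
by have [|-> ->] := @xy (c t.+2); first by apply: cn; lia.
Qed.

Lemma covered_agree c lo hi p : (forall t, (lo <= t < hi)%N -> (c t < n)%N) ->
  (p < n)%N -> covered x y c lo hi p -> covered x' y' c lo hi p.
Proof.
move=> cn pn h ux uy hu; have [t ht hb] := h ux uy hu.
by exists t => //; rewrite beats_agree // cn.
Qed.

Lemma hull_of_agree c h : hull_of x y n c h -> hull_of x' y' n c h.
Proof.
move=> [h1 h2 h3 h4 h5]; have cn t : (0 <= t < h)%N -> (c t < n)%N by exact: h4.
split=> //; first exact: increasing_agree h2.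
  exact: concave_agree h3.
by move=> p pn; apply: covered_agree (h5 p pn).
Qed.

End Agreement.

(** * Convex hulls *)

Section ConvexPlane.
Variable R : realType.
Implicit Types (A : set (plane R)) (a b p q : plane R).

Lemma convex_set_segment A :
  (forall a b (t : R), A a -> A b -> 0 < t < 1 -> A (t *: a + (1 - t) *: b)) ->
  @convex_set R (R^o * R^o)%type A.
Proof.
move=> h; apply/convex_setW => a b; rewrite !inE => Aa Ab k k0 k1.
rewrite inE; apply: (h a b k%:num Aa Ab); by rewrite k0 k1.
Qed.

Lemma convex_hull_sub A B :
  (forall a b (t : R), B a -> B b -> 0 < t < 1 -> B (t *: a + (1 - t) *: b)) ->
  A `<=` B -> convex_hull A `<=` B.
Proof. by move=> /convex_set_segment; exact: smallest_sub. Qed.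

Section Points.
Variables (n : nat) (P : 'I_n -> plane R) (x y : nat -> R).
Hypothesis n_gt0 : (0 < n)%N.
Hypothesis PE : forall i : 'I_n, P i = (x i, y i).
Hypothesis gp : general_position P.
Hypothesis promise : hull_promise P.

Local Notation pt i := ((x i, y i) : plane R).

Lemma x_inj i j : (i < n)%N -> (j < n)%N -> x i = x j -> i = j.
Proof.
move=> hi hj xij; have [hinj _] := gp.
have /(congr1 val) // : Ordinal hi = Ordinal hj.
by apply: hinj; rewrite !PE.
Qed.

Lemma rangeP A : (forall i, (i < n)%N -> A (pt i)) -> range P `<=` A.
Proof. by move=> h _ [i _ <-]; rewrite PE; exact: h. Qed.

Lemma pt_range i : (i < n)%N -> range P (pt i).
Proof. by move=> hi; exists (Ordinal hi) => //; rewrite PE. Qed.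

Definition worse ux uy i (q : plane R) : Prop :=
  ux * q.1 + uy * q.2 < dot x y ux uy i \/
  (ux * q.1 + uy * q.2 = dot x y ux uy i /\ x i < q.1).

Lemma worse_irr ux uy i : ~ worse ux uy i (pt i).
Proof. by rewrite /worse /dot /= => -[|[_]]; rewrite ltxx. Qed.

(** The points [worse] than [pt i] form an open half-plane together with an open ray of its boundary
    that starts at [pt i]. Adding [pt i] itself keeps this set convex, and a proper convex
    combination inside it equals [pt i] only if both ends do. *)
Lemma best_vertex ux uy i : upward ux uy -> best x y n ux uy i ->
  vertex (convex_hull (range P)) (pt i).
Proof.
move=> hu [hi hb].
have comb a b (t : R) : worse ux uy i a \/ a = pt i ->
    worse ux uy i b \/ b = pt i -> 0 < t < 1 ->
    worse ux uy i (t *: a + (1 - t) *: b) \/ (a = pt i /\ b = pt i).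
  move=> ha hb' /andP[t0 t1]; have t1' : 0 < 1 - t by rewrite subr_gt0.
  case: ha => [wa|->]; last case: hb' => [wb|->]; last by right.
    left; have {}hb' : ux * b.1 + uy * b.2 < dot x y ux uy i \/
      (ux * b.1 + uy * b.2 = dot x y ux uy i /\ x i <= b.1).
      case: hb' => [[?|[? ?]]|->]; [by left|by right; split=> //; exact: ltW|].
      by right.
    rewrite /worse /= /GRing.scale /=.
    case: wa => [a1|[a1 a2]]; case: hb' => [b1|[b1 b2]].
    - by left; nra.
    - by left; nra.
    - by left; nra.
    - by right; split; nra.
  left; rewrite /worse /= /GRing.scale /=.
  move: wb; rewrite /worse /dot => -[b1|[b1 b2]].
  - by left; nra.
  - by right; split; nra.
have sub : convex_hull (range P) `<=` [set q | worse ux uy i q \/ q = pt i].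
  apply: convex_hull_sub => [a b t ha hb' ht|] /=.
    case: (comb a b t ha hb' ht) => [|[-> ->]]; first by left.
    by right; rewrite -scalerDl addrC subrK scale1r.
  apply: rangeP => j hj /=; have [eij|nij] := eqVneq j i.
    by right; rewrite eij.
  left; have := hb j hj; rewrite /beats /worse /= -/(dot x y ux uy j).
  case/orP => [|/andP[/eqP e xij]]; first by left.
  right; split=> //; rewrite lt_neqAle xij andbT.
  by apply: contra nij => /eqP /x_inj ->.
split=> [|a b t Ha Hb ht E].
  by apply: sub_smallest (pt_range hi).
case: (comb a b t (sub _ Ha) (sub _ Hb) ht) => //.
by rewrite -E => /worse_irr.
Qed.

(** This is the form in which the promise enters everything that follows. For equal abscissas,
    general position gives the same point. *)
Lemma best_leq ux uy vx vy (p q : nat) : upward ux uy -> upward vx vy ->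
  best x y n ux uy p -> best x y n vx vy q -> x p <= x q -> (p <= q)%N.
Proof.
move=> hu hv bp bq; rewrite le_eqVlt => /orP[/eqP e|l].
  by rewrite (x_inj bp.1 bq.1 e).
have vp := best_vertex hu bp; have vq := best_vertex hv bq.
have [pn _] := bp; have [qn _] := bq.
apply: ltnW; have := promise (i := Ordinal pn) (j := Ordinal qn).
by rewrite !PE /=; case/(_ vp vq) => _; apply.
Qed.

Lemma upper_hullP c h : hull_of x y n c h ->
  upper_hull (range P) (mkseq (fun t => pt (c t)) h).
Proof.
move=> hh; have [h0 inc conc cn cov] := hh.
have bl := hull_of_first hh; have br := hull_of_last hh.
split.
- by rewrite -size_eq0 size_mkseq -lt0n.
- rewrite -nth0 nth_mkseq //; split; first exact: pt_range bl.1.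
  move=> _ [j _ <-]; rewrite PE /lex_le /=.
  have := beats_dot (bl.2 j (ltn_ord j));
    rewrite /dot !mul0r !addr0 !mulN1r lerN2.
  rewrite le_eqVlt => /orP[/eqP e|]; last by left.
  by right; rewrite (x_inj bl.1 (ltn_ord j) e).
- rewrite -nth_last size_mkseq nth_mkseq ?prednK //; split;
    first exact: pt_range br.1.
  move=> _ [j _ <-]; rewrite PE /lex_le /=.
  have := beats_dot (br.2 j (ltn_ord j)); rewrite /dot !mul0r !addr0 !mul1r.
  rewrite le_eqVlt => /orP[/eqP e|]; last by left.
  by right; rewrite (x_inj (ltn_ord j) br.1 e).
- apply/mkseq_uniqP => t t'; rewrite !inE => th th' [e _].
  apply/eqP; rewrite eqn_leq; apply/andP.
  by split; apply: (increasing_leq inc) => //; rewrite e.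
split=> [p /mapP[t]|k].
  rewrite mem_iota add0n => /andP[_ th] ->.
  by have [ux [uy [hu hb]]] := hull_of_best hh th; exact: best_vertex hb.
rewrite size_mkseq => kh q; rewrite !nth_mkseq ?(ltnW kh) // /on_or_right_of /=.
have pk := peak_normal inc conc (leq0n k) kh.
have [_ bk] := hull_of_peak hh (upward1 _) pk.
have xk := inc k (leq0n k) kh.
pose N := normal x y (c k) (c k.+1).
(* The orientation test is a half-plane in direction [(N, 1)], hence convex in [q'], so that
   checking the input points suffices. *)
have side q' : N * q'.1 + 1 * q'.2 <= dot x y N 1 (c k) <->
  (x (c k.+1) - x (c k)) * (q'.2 - y (c k)) -
  (y (c k.+1) - y (c k)) * (q'.1 - x (c k)) <= 0.
  have h1 : N * (x (c k.+1) - x (c k)) = y (c k) - y (c k.+1).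
    by rewrite /N /normal mulfVK // subr_eq0 gt_eqF.
  rewrite -(opprB (y (c k)) (y (c k.+1))) -h1 /dot.
  rewrite -[X in X <= 0]/(_ - _) (_ : _ - _ = (x (c k.+1) - x (c k)) *
    (N * q'.1 + 1 * q'.2 - (N * x (c k) + 1 * y (c k)))); last by ring.
  by rewrite pmulr_rle0 ?subr_gt0 // subr_le0.
move=> hq; apply/side; move: q hq; apply: convex_hull_sub => [a b t|].
  rewrite /= /GRing.scale /= => ha hb /andP[t0 t1]; nra.
by apply: rangeP => j hj /=; exact: beats_dot (bk j hj).
Qed.

End Points.
End ConvexPlane.

(** * Merge sort *)

Section Slices.
Variable T : Type.
Implicit Types f g : nat -> T.

Definition slice f i j := [seq f t | t <- iota i (j - i)].

Lemma size_slice f i j : size (slice f i j) = (j - i)%N.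
Proof. by rewrite size_map size_iota. Qed.

Lemma nth_slice z f i j t : (t < j - i)%N ->
  nth z (slice f i j) t = f (i + t)%N.
Proof. by move=> h; rewrite (nth_map 0%N) ?size_iota // nth_iota. Qed.

Lemma slice_nil f i j : (j <= i)%N -> slice f i j = [::].
Proof. by rewrite -subn_eq0 /slice => /eqP->. Qed.

Lemma slice_cons f i j : (i < j)%N -> slice f i j = f i :: slice f i.+1 j.
Proof. by move=> h; rewrite /slice -(subnSK h). Qed.

Lemma slice_rcons f i j : (i <= j)%N -> slice f i j.+1 = slice f i j ++ [:: f
  j].
Proof.
by move=> h; rewrite /slice subSn // -addn1 iotaD map_cat /= subnKC.
Qed.

Lemma slice_cat j f i k : (i <= j <= k)%N ->
  slice f i k = slice f i j ++ slice f j k.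
Proof.
move=> h; rewrite /slice -map_cat (_ : (k - i = (j - i) + (k - j))%N); last lia.
by rewrite iotaD subnKC //; lia.
Qed.

Lemma eq_slice f g i j : (forall t, (i <= t < j)%N -> f t = g t) ->
  slice f i j = slice g i j.
Proof.
move=> h; apply/eq_in_map => t; rewrite mem_iota => /andP[h1 h2]; apply: h; lia.
Qed.

End Slices.
Arguments slice_cat {T} j f {i k}.

Lemma mem_slice (T : eqType) (f : nat -> T) i j v :
  reflect (exists2 t, (i <= t < j)%N & v = f t) (v \in slice f i j).
Proof.
apply: (iffP mapP) => -[t h ->]; exists t => //; move: h; rewrite mem_iota; lia.
Qed.

(** * Rules for sequences of assignments *)

Section Rules.
Variables (R : realFieldType) (W : nat).
Implicit Types (s : store R) (Q : store R -> Prop) (T : nat).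

Lemma aeqxx a : aeq a a. Proof. exact/aeqP. Qed.

Lemma ar_seta s a i v :
  ar (seta s a i v) a = fun j => if j == i then v else ar s a j.
Proof. by rewrite /= aeqxx. Qed.

Lemma spec_seti_seq x e c s T Q : iok W e s -> (0 < T)%N ->
  spec W c (seti s x (ieval e s)) T.-1 Q -> spec W (SetI x e;; c) s T Q.
Proof.
move=> h1 h2 h3; apply: (spec_seq h2); apply: spec_seti => //.
by rewrite subn1.
Qed.

Lemma spec_seta_seq a e1 e2 c s T Q : iok W e1 s -> iok W e2 s ->
  (8 * ieval e1 s + 8 <= W)%N -> (0 < T)%N ->
  spec W c (seta s a (ieval e1 s) (ieval e2 s)) T.-1 Q ->
  spec W (SetA a e1 e2;; c) s T Q.
Proof.
move=> h1 h2 h3 h4 h5; apply: (spec_seq h4); apply: spec_seta => //.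
by rewrite subn1.
Qed.

Lemma spec_setr_seq d e r c s T Q : iok W e s -> rok W r s ->
  (2 * ieval e s + 2 <= W)%N -> (0 < T)%N ->
  spec W c (setr s d (ieval e s) (reval r s)) T.-1 Q ->
  spec W (SetR d e r;; c) s T Q.
Proof.
move=> h1 h2 h3 h4 h5; apply: (spec_seq h4); apply: spec_setr => //.
by rewrite subn1.
Qed.

Lemma framed_refl c s : framed c s s.
Proof. by split. Qed.

Lemma framed_seti c s s' x v :
  has (veq x) (ivars c) -> framed c s s' -> framed c s (seti s' x v).
Proof.
move=> hx [h1 h2 h3]; split=> // y ny /=.
have -> : veq y x = false by apply: contraNF ny => /veqP ->.
exact: h1.
Qed.

End Rules.

Ltac sidecond := rewrite /=; repeat split=> //; try lia.

Ltac assign :=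
  first [apply: spec_seti_seq | apply: spec_seti
        | apply: spec_seta_seq | apply: spec_seta]; [sidecond..|].

Coercion IV : var >-> iexp.
Coercion IC : nat >-> iexp.
Notation "x |+| y" := (IB IAdd x y) (at level 50, left associativity).
Notation "x |-| y" := (IB ISub x y) (at level 50, left associativity).
Notation "x |*| y" := (IB IMul x y) (at level 40, left associativity).
Notation "x |/| y" := (IB IDiv x y) (at level 40, left associativity).

Section MergeSort.
Variables (R : realFieldType) (W N : nat).
Hypothesis WN : (16 * N + 16 <= W)%N.
Implicit Types (s : store R).

Definition take_entry a v : com :=
  SetA aTmp vz (IG a (IV v));; SetI v (v |+| 1%N).

Definition merge_step a : com :=
  If (LtI vx vmd)
    (If (LtI vy ve)
      (If (LtR (RX (IG a vy)) (RX (IG a vx))) (take_entry a vy) (take_entry a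
        vx))
      (take_entry a vx))
    (take_entry a vy);;
  SetI vz (vz |+| 1%N).

(* Merges entries vp..vmd and vmd..ve of the array. *)
Definition merge_com a : com :=
  SetI vx vp;; SetI vy vmd;; SetI vz vp;;
  While (LtI vz ve) (merge_step a);;
  SetI vz vp;;
  While (LtI vz ve) (SetA a vz (IG aTmp vz);; SetI vz (vz |+| 1%N)).

Definition sort_com a : com :=
  SetI vw 1%N;;
  While (LtI vw (vhi |-| vlo))
    (SetI vp vlo;;
     While (LtI (vp |+| vw) vhi)
       (SetI vmd (vp |+| vw);; SetI ve (vp |+| vw |+| vw);;
        If (LtI vhi ve) (SetI ve vhi) Skip;;
        merge_com a;;
        SetI vp ve);;
     SetI vw (vw |+| vw)).

Definition below_x s i j := px s i <= px s j.

Lemma merge_cons (T : Type) (leT : rel T) a b (s1 s2 : seq T) :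
  merge leT (a :: s1) (b :: s2) =
  if leT a b then a :: merge leT s1 (b :: s2) else b :: merge leT (a :: s1) s2.
Proof. by []. Qed.

Lemma merge_nilr (T : Type) (leT : rel T) (s1 : seq T) : merge leT s1 [::] = s1.
Proof. by case: s1. Qed.

Definition merged_one a s s' : Prop :=
    [/\ px s' = px s, ar s' a = ar s a,
      iv s' vmd = iv s vmd /\ iv s' ve = iv s ve, iv s' vp = iv s vp &
      [/\ iv s' vz = (iv s vz).+1,
       (iv s' vx + iv s' vy = (iv s vx + iv s vy).+1)%N,
       (iv s vx <= iv s' vx <= iv s vmd)%N, (iv s vy <= iv s' vy <= iv s ve)%N &
      exists v, ar s' aTmp = (fun j => if j == iv s vz then v else ar s aTmp j)
        /\
        merge (below_x s) (slice (ar s a) (iv s vx) (iv s vmd))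
                          (slice (ar s a) (iv s vy) (iv s ve)) =
        v :: merge (below_x s) (slice (ar s a) (iv s' vx) (iv s vmd))
                          (slice (ar s a) (iv s' vy) (iv s ve))]].

Lemma merge_step_spec a s : aeq a aTmp = false ->
  (iv s vx <= iv s vmd)%N -> (iv s vy <= iv s ve)%N ->
  ((iv s vx < iv s vmd) || (iv s vy < iv s ve))%N ->
  (iv s vmd < N)%N -> (iv s ve < N)%N -> (iv s vz < N)%N ->
  (forall t, (iv s vx <= t < iv s vmd)%N -> (ar s a t < N)%N) ->
  (forall t, (iv s vy <= t < iv s ve)%N -> (ar s a t < N)%N) ->
  spec W (merge_step a) s 6 (merged_one a s).
Proof.
move=> na xm ye xy mN eN zN bx bys.
apply: (spec_seq (T1 := 5)) => //.
have take_x : (iv s vx < iv s vmd)%N ->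
  ((iv s vy < iv s ve)%N -> px s (ar s a (iv s vx)) <= px s (ar s a (iv s vy)))
    ->
  spec W (take_entry a vx) s 2 (fun s' => spec W (SetI vz (vz |+| 1%N)) s' 1
    (merged_one a s)).
  move=> h1 h2; assign.
  do 2!assign.
  rewrite /merged_one /= na; split=> //.
  split=> //; [lia|lia|lia|lia|].
  exists (ar s a (iv s vx)); split=> //.
  rewrite addn1 (slice_cons _ h1).
  have [h3|h3] := ltnP (iv s vy) (iv s ve); last first.
    by rewrite (slice_nil _ h3) !merge_nilr.
  by rewrite (slice_cons _ h3) merge_cons {1}/below_x h2.
have take_y : (iv s vy < iv s ve)%N ->
  ((iv s vx < iv s vmd)%N -> px s (ar s a (iv s vy)) < px s (ar s a (iv s vx)))
    ->
  spec W (take_entry a vy) s 2 (fun s' => spec W (SetI vz (vz |+| 1%N)) s' 1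
    (merged_one a s)).
  move=> h1 h2; assign.
  do 2!assign.
  rewrite /merged_one /= na; split=> //.
  split=> //; [lia|lia|lia|lia|].
  exists (ar s a (iv s vy)); split=> //.
  rewrite addn1 (slice_cons _ h1).
  have [h3|h3] := ltnP (iv s vx) (iv s vmd); last first.
    by rewrite (slice_nil _ h3).
  by rewrite (slice_cons _ h3) merge_cons {1}/below_x leNgt h2.
apply: spec_if => //= hx.
  apply: spec_if => //= hy.
    apply: spec_if => //=.
    - have b1 := bx (iv s vx); have b2 := bys (iv s vy).
      by sidecond.
    - by move=> h; apply: take_y.
    - by move=> /negbT; rewrite -leNgt => h; apply: take_x.
  apply: (spec_weaken (take_x hx _)) => //; by rewrite hy.
move: xy; rewrite hx => /= hy.
apply: (spec_weaken (take_y hy _)) => //; by rewrite hx.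
Qed.

Lemma merge_spec a s : aeq a aTmp = false ->
  (iv s vp <= iv s vmd <= iv s ve)%N -> (iv s ve < N)%N ->
  (forall t, (iv s vp <= t < iv s ve)%N -> (ar s a t < N)%N) ->
  spec W (merge_com a) s (10 * (iv s ve - iv s vp) + 6) (fun s' =>
    slice (ar s' a) (iv s vp) (iv s ve) =
      merge (below_x s) (slice (ar s a) (iv s vp) (iv s vmd))
                        (slice (ar s a) (iv s vmd) (iv s ve)) /\
    forall t, ~~ (iv s vp <= t < iv s ve)%N -> ar s' a t = ar s a t).
Proof.
move=> na /andP[pm me] eN bA.
set p := iv s vp in pm bA *; set m := iv s vmd in pm me *.
set e := iv s ve in me eN bA *; set A := ar s a in bA *.
set d := (e - p)%N.
do 3!assign.
(* Seven units per merged entry: one test and the 6 of [merge_step]. Copying back takes another 3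
   per entry. *)
apply: (spec_seq (T1 := (7 * d + 1)%N)); first by sidecond.
pose I1 (_ : unit) T (s1 : store R) :=
  [/\ px s1 = px s, ar s1 a = A, [/\ iv s1 vmd = m,
    iv s1 ve = e & iv s1 vp = p],
    [/\ (p <= iv s1 vx <= m)%N, (m <= iv s1 vy <= e)%N,
       (iv s1 vz + m = iv s1 vx + iv s1 vy)%N & (7 * (e - iv s1 vz) < T)%N] &
    slice (ar s1 aTmp) p (iv s1 vz) ++ merge (below_x s)
       (slice A (iv s1 vx) m) (slice A (iv s1 vy) e) =
    merge (below_x s) (slice A p m) (slice A m e)].
apply: (spec_while (I := I1) (a := tt)).
- by move=> _ T s1 [_ _ [E1 E2 E3] [h1 h2 h3 h4] _]; sidecond.
- move=> _ T s1 [E0 EA [E1 E2 E3] [h1 h2 h3 h4] Es] /= qF.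
  have xm : iv s1 vx = m by lia.
  have ye : iv s1 vy = e by lia.
  have ze : iv s1 vz = e by lia.
  move: Es; rewrite ze xm ye !(slice_nil _ (leqnn _)) /= cats0 => Es.
  assign.
  pose I2 (_ : unit) T (s2 : store R) :=
    [/\ (p <= iv s2 vz <= e)%N, iv s2 ve = e, ar s2 aTmp = ar s1 aTmp,
      (3 * (e - iv s2 vz) < T)%N & forall t, ar s2 a t =
        if (p <= t < iv s2 vz)%N then ar s1 aTmp t else A t].
  apply: (spec_while (I := I2) (a := tt)).
  + by move=> _ T2 s2 [h5 h6 h7 h8 h9]; sidecond.
  + move=> _ T2 s2 [h5 h6 h7 h8 h9] /= qF2.
    have z2 : iv s2 vz = e by lia.
    split; last by move=> t ht; rewrite h9 z2 (negbTE ht).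
    rewrite -Es; apply: eq_slice => t ht; by rewrite h9 z2 ht.
  + move=> _ T2 s2 [h5 h6 h7 h8 h9] /= qT2; exists 2%N; split; first lia.
    do 2!assign.
    exists tt; split; [sidecond..|] => [|t].
      by rewrite (_ : aeq aTmp a = false) //; apply/negP => /aeqP E; move: na;
        rewrite -E aeqxx.
    rewrite /= aeqxx h7; case: eqP => [->|nt]; last first.
      rewrite h9; congr (if _ then _ else _); lia.
    by rewrite ifT //; lia.
  + split; rewrite /=; try lia; try by [].
    by move=> t; rewrite ifF ?EA //; lia.
- move=> _ T s1 [E0 EA [E1 E2 E3] [h1 h2 h3 h4] Es] /= qT; exists 6%N; split;
    first lia.
  have [||||||||t1 [s2 [x2 l2 [F0 FA [F1 F1'] F2 [F3 F4 F5 F6 [v [F7 F8]]]]]]]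
    := @merge_step_spec a s1 na.
  1-6: lia.
  1-2: by move=> t ht; rewrite EA; apply: bA; lia.
  exists t1, s2; split=> //; exists tt; split.
  + by rewrite F0.
  + by rewrite FA.
  + by rewrite F1 F1' F2.
  + by split; lia.
  + rewrite F3 slice_rcons; last lia.
    have -> : slice (ar s2 aTmp) p (iv s1 vz) = slice (ar s1 aTmp) p (iv s1 vz).
      by apply: eq_slice => t ht; rewrite F7 ifF //; lia.
    rewrite F7 eqxx -catA /= -Es; congr (_ ++ _).
    by move: F8; rewrite EA E1 E2 /below_x E0 => <-.
- split; rewrite /=; try by [].
    by split; lia.
  by rewrite slice_nil.
Qed.

Lemma slice_perm_mem (f g : nat -> nat) lo hi t :
  perm_eq (slice f lo hi) (slice g lo hi) -> (lo <= t < hi)%N ->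
  exists2 t', (lo <= t' < hi)%N & f t = g t'.
Proof.
move=> /perm_mem E ht; have : f t \in slice f lo hi by apply/mem_slice;
  exists t.
by rewrite E => /mem_slice.
Qed.

Lemma slice_sorted (le : rel nat) (f : nat -> nat) lo hi :
  sorted le (slice f lo hi) <->
  forall t, (lo <= t)%N -> (t.+1 < hi)%N -> le (f t) (f t.+1).
Proof.
split=> [/(sortedP 0%N) h t lt th|h].
  have := h (t - lo)%N; rewrite size_slice !nth_slice; [|lia..].
  by rewrite addnS subnKC //; apply; lia.
apply/(sortedP 0%N) => t; rewrite size_slice => ht.
by rewrite !nth_slice ?addnS; [apply: h; lia|lia..].
Qed.

(** There are at most [k] rounds, as each doubles the length of the runs. A merge joins at least two
    entries, so its constant overhead is absorbed in 20 units per entry. *)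
Lemma sort_spec a k s : aeq a aTmp = false ->
  (iv s vhi - iv s vlo <= 2 ^ k)%N -> (iv s vlo <= iv s vhi < N)%N ->
  (forall t, (iv s vlo <= t < iv s vhi)%N -> (ar s a t < N)%N) ->
  spec W (sort_com a) s ((20 * (iv s vhi - iv s vlo) + 4) * k + 2) (fun s' =>
    [/\ perm_eq (slice (ar s' a) (iv s vlo) (iv s vhi))
                (slice (ar s a) (iv s vlo) (iv s vhi)),
      forall t, (iv s vlo <= t)%N -> (t.+1 < iv s vhi)%N ->
        px s (ar s' a t) <= px s (ar s' a t.+1) &
      forall t, ~~ (iv s vlo <= t < iv s vhi)%N -> ar s' a t = ar s a t]).
Proof.
move=> na; set lo := iv s vlo; set hi := iv s vhi; set A := ar s a.
move=> hk lohi bA; set d := (hi - lo)%N.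
assign.
(* A concatenation of sorted runs of length [w], aligned at [lo]: order may fail only across
   multiples of [w]. *)
pose runs (w : nat) (B : nat -> nat) (i j : nat) := forall t, (i <= t)%N ->
  (t.+1 < j)%N -> ~~ (w %| t.+1 - lo)%N -> px s (B t) <= px s (B t.+1).
pose base (s1 : store R) := [/\ px s1 = px s, iv s1 vlo = lo, iv s1 vhi = hi,
  perm_eq (slice (ar s1 a) lo hi) (slice A lo hi) &
  forall t, ~~ (lo <= t < hi)%N -> ar s1 a t = A t].
pose I1 (j : nat) T (s1 : store R) := [/\ base s1, (0 < iv s1 vw)%N,
  (iv s1 vw <= 2 * d + 1)%N, (d <= iv s1 vw * 2 ^ j)%N &
  runs (iv s1 vw) (ar s1 a) lo hi /\ ((20 * d + 4) * j < T)%N].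
apply: (spec_while (I := I1) (a := k)); last first.
- split; rewrite /= ?mul1n //; last by split=> [t|]; rewrite ?dvd1n //; lia.
  lia.
- move=> j T s1 [[E0 E1 E2 E3 E4] w0 wd dj [hr hT]] /=; rewrite E1 E2 => qT.
  have j0 : (0 < j)%N.
    by case: j dj hT => // dj hT; move: dj; rewrite expn0 muln1 /d; lia.
  exists (20 * d + 3)%N; split; first by move: hT; case: (j) j0 => // j';
    rewrite mulnS; lia.
  assign.
  set w := iv s1 vw in w0 wd dj hr qT.
  apply: (spec_seq (T1 := (20 * d + 1)%N)); first by sidecond.
  pose I2 (_ : unit) T2 (s2 : store R) := [/\ base s2, iv s2 vw = w,
    (lo <= iv s2 vp <= hi)%N, (20 * (hi - iv s2 vp) < T2)%N &
    [/\ (exists z, iv s2 vp - lo = z * (2 * w))%N \/ iv s2 vp = hi,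
     runs w (ar s2 a) (iv s2 vp) hi & runs (2 * w)%N (ar s2 a) lo (iv s2 vp)]].
  apply: (spec_while (I := I2) (a := tt)); last first.
  + rewrite /I2 /base /= E1 E2; split => //; try lia.
    split=> //; first by left; exists 0%N; rewrite subnn.
    by move=> t; lia.
  + move=> _ T2 s2 [[F0 F1 F2 F3 F4] F5 F6 F7 [F8 F9 F10]] /= q2T.
    rewrite F2 F5 in q2T; set p := iv s2 vp in F6 F7 F8 F9 F10 q2T.
    have {}F8 : exists z, (p - lo = z * (2 * w))%N.
      by case: F8 => // E; exfalso; move: q2T; rewrite E; clear; lia.
    clear hk dj hT hr wd.
    have [e Ee] : exists e, e = minn hi (p + w + w) by eexists.
    have [ep e2] : (p + w < e <= hi)%N /\ (e <= p + w + w)%N by lia.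
    exists (10 * (e - p) + 6 + 5)%N; split; first by clear Ee; lia.
    do 2!assign.
    apply: (spec_seq (T1 := 2)) => //; first by lia.
    have mrg s3 : iv s3 vp = p -> iv s3 vmd = (p + w)%N -> iv s3 ve = e ->
        framed (SetI vmd 0%N;; SetI ve 0%N) s2 s3 ->
      spec W (merge_com a;; SetI vp ve) s3 (10 * (e - p) + 6 + 1)
        (fun s' => exists a' : unit, I2 a' (T2 - (10 * (e - p) + 6 + 5).+1)%N
          s').
      move=> G1 G2 G3 [Gi Ga Gx]; have [Gx0 Gy0] := Gx isT.
      have ga : ar s3 a = ar s2 a by exact: Ga.
      have bB t : (lo <= t < hi)%N -> (ar s2 a t < N)%N.
        by case/(slice_perm_mem F3) => t' ht' ->; exact: bA.
      apply: (spec_seq (T1 := (10 * (e - p) + 6)%N)); first by lia.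
      have := @merge_spec a s3 na; rewrite G1 G2 G3 ga => /(_ _ _ _)/spec_frame
        H.
      apply: (spec_weaken (H _ _ _)) => //; [lia|lia| |].
        by move=> t ht; apply: bB; lia.
      move=> s4 [[H1 H2] [Hi Ha Hx]]; have [Hx0 _] := Hx isT.
      assign.
      exists tt.
      have ve4 : iv s4 ve = e by rewrite Hi.
      have lx : below_x s3 = below_x s by rewrite /below_x Gx0 F0.
      have srt : sorted (below_x s) (slice (ar s4 a) p e).
        rewrite H1 lx; apply: merge_sorted; first by move=> t t';
          exact: le_total.
          apply/slice_sorted => t pt tp; apply: F9 => //; first lia.
          (* [w] divides [p - lo], whereas [t.+1 - p] lies strictly between 0 and [w], so there is
             no run boundary here. *)
          have -> : (t.+1 - lo = (p - lo) + (t.+1 - p))%N by lia.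
          have [z ->] := F8.
          rewrite mulnA dvdn_addr ?dvdn_mull //; apply/negP => /dvdn_leq; lia.
        apply/slice_sorted => t pt tp; apply: F9 => //; [lia|lia|].
        have -> : (t.+1 - lo = (p - lo) + w + (t.+1 - (p + w)))%N by lia.
        have [z ->] := F8.
        rewrite mulnA -mulSnr dvdn_addr ?dvdn_mull //;
          apply/negP => /dvdn_leq; lia.
      have prm : perm_eq (slice (ar s4 a) lo hi) (slice (ar s2 a) lo hi).
        rewrite (slice_cat p _ (i := lo)); last lia.
        rewrite (slice_cat e _ (i := p)); last lia.
        rewrite [X in perm_eq _ X](slice_cat p _ (i := lo)); last lia.
        rewrite [X in perm_eq _ (_ ++ X)](slice_cat e _ (i := p)); last lia.
        rewrite (eq_slice (f := ar s4 a) (g := ar s2 a) (i := lo) (j := p));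
          last first.
          by move=> t ht; apply: H2; lia.
        rewrite (eq_slice (f := ar s4 a) (g := ar s2 a) (i := e) (j := hi));
          last first.
          by move=> t ht; apply: H2; lia.
        rewrite perm_cat2l perm_cat2r H1 perm_merge //.
        by rewrite -slice_cat //; lia.
      split.
      * rewrite /base /= Hx0 Gx0 !Hi // !Gi //; split=> //.
          exact: perm_trans prm F3.
        by move=> t ht; rewrite H2; [exact: F4|lia].
      * by rewrite /= Hi // Gi.
      * by rewrite /= ve4; lia.
      * by rewrite /= ve4; lia.
      * rewrite /= ve4; split.
        - have [ehi|ehi] := leqP hi (p + w + w); [right|left]; first lia.
          rewrite Ee (minn_idPr _); last lia.
          have -> : (p + w + w - lo = (p - lo) + 2 * w)%N by lia.
          by have [z E] := F8; exists z.+1; rewrite E -mulSnr.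
        - move=> t et th nt; rewrite !H2; [|lia..].
          by apply: F9 => //; lia.
        - move=> t lt te nt; have [tp|pt] := ltnP t p; last first.
            exact: (iffLR (slice_sorted (below_x s) _ p e) srt t pt te).
          have [tp'|tp'] := eqVneq t.+1 p; first by move: nt;
            have [z E] := F8; rewrite tp' E dvdn_mull.
          by rewrite !H2; [apply: F10 => //; lia|lia..].
    apply: spec_if => //=; rewrite -/p F2 F5 => q3.
      assign.
      apply: (spec_weaken (mrg _ _ _ _ _)) => //; rewrite /= ?F2 ?F5 //.
      - lia.
      - by do 3!apply: framed_seti => //; exact: framed_refl.
      - lia.
    apply: spec_skip; apply: (spec_weaken (mrg _ _ _ _ _)) => //;
      rewrite /= ?F2 ?F5 //.
    + lia.
    + by do 2!apply: framed_seti => //; exact: framed_refl.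
    + lia.
  + move=> _ T2 s2 [[F0 F1 F2 F3 F4] F5 F6 F7 [F8 F9 F10]] /= q2F.
    rewrite F2 F5 in q2F; set p := iv s2 vp in F6 F7 F8 F9 F10 q2F.
    assign; try lia.
    exists j.-1; split; rewrite /base /= ?F5.
    * by [].
    * lia.
    * lia.
    * by move: dj; case: (j) j0 => // j' _; rewrite expnS /=; lia.
    split; last by move: hT; case: (j) j0 => // j' _; rewrite mulnS /=; lia.
    move=> t lt th; rewrite addnn -mul2n => nt.
    have [tp|pt] := ltnP t.+1 p; first exact: F10.
    have [tp'|tp'] := eqVneq t.+1 p.
      case: F8 => [[z E]|]; last lia.
      by move: nt; rewrite tp' E dvdn_mull.
    (* From [p] on at most one run is left, so no boundary separates [t] and [t.+1]. *)
    apply: F9 => //; first lia.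
    have {}F8 : exists z, (p - lo = z * (2 * w))%N by case: F8 => //; lia.
    have -> : (t.+1 - lo = (p - lo) + (t.+1 - p))%N by lia.
    have [z ->] := F8.
    rewrite mulnA dvdn_addr ?dvdn_mull //; apply/negP => /dvdn_leq; lia.
  + by move=> _ T2 s2 [[F0 F1 F2 F3 F4] F5 F6 F7 [F8 F9 F10]]; sidecond.
- move=> j T s1 [[E0 E1 E2 E3 E4] w0 wd dj [hr hT]] /=; rewrite E1 E2 => qF.
  split=> // t lt th; apply: hr => //; apply/negP => /dvdn_leq;
    rewrite /d in qF *; lia.
- by move=> j T s1 [[E0 E1 E2 E3 E4] w0 wd dj [hr hT]]; sidecond.
Qed.

End MergeSort.

(** * Graham scan *)

Section Graham.
Variables (R : realFieldType) (W N : nat).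
Hypothesis WN : (16 * N + 16 <= W)%N.
Implicit Types (s : store R).

Definition cross_exp (i j k : iexp) : rexp :=
  RB RSub (RB RMul (RB RSub (RX j) (RX i)) (RB RSub (RY k) (RY i)))
          (RB RMul (RB RSub (RY j) (RY i)) (RB RSub (RX k) (RX i))).

Definition pop_step dst : com :=
  If (LtI (vlo |+| 1%N) vtop)
    (If (LtR (cross_exp (IG dst (vtop |-| 2%N)) (IG dst (vtop |-| 1%N)) vq) (RC
      0))
      (SetI vgo 0%N)
      (SetI vtop (vtop |-| 1%N)))
    (SetI vgo 0%N).

(* Replaces entries vlo..vhi of src, which are sorted by abscissa, by the
   vertices of their upper hull, stored in entries vlo..vtop of dst. *)
Definition graham_com src dst : com :=
  SetI vtop vlo;; SetI vx vlo;;
  While (LtI vx vhi)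
    (SetI vq (IG src vx);; SetI vgo 1%N;;
     While (LtI 0%N vgo) (pop_step dst);;
     SetA dst vtop vq;; SetI vtop (vtop |+| 1%N);; SetI vx (vx |+| 1%N)).

(** A popped vertex lies on or below the segment from its predecessor to the new point, so by
    [beats_below] one of these two beats it in any given direction, and covering survives every pop.
    The cost is amortized against the height of the stack. *)
Lemma graham_spec src dst s : aeq src dst = false ->
  (iv s vlo < iv s vhi < N)%N ->
  (forall t, (iv s vlo <= t < iv s vhi)%N -> (ar s src t < N)%N) ->
  increasing (px s) (ar s src) (iv s vlo) (iv s vhi) ->
  spec W (graham_com src dst) s (15 * (iv s vhi - iv s vlo) + 3) (fun s' =>
    [/\ (iv s vlo < iv s' vtop <= iv s vhi)%N,
      increasing (px s) (ar s' dst) (iv s vlo) (iv s' vtop) /\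
      concave (px s) (py s) (ar s' dst) (iv s vlo) (iv s' vtop),
      forall t, (iv s vlo <= t < iv s' vtop)%N ->
        exists2 t', (iv s vlo <= t' < iv s vhi)%N & ar s' dst t = ar s src t',
      forall t, (iv s vlo <= t < iv s vhi)%N ->
        covered (px s) (py s) (ar s' dst) (iv s vlo) (iv s' vtop) (ar s src t) &
      forall t, ~~ (iv s vlo <= t < iv s vhi)%N -> ar s' dst t = ar s dst t]).
Proof.
move=> nsd; set lo := iv s vlo; set hi := iv s vhi; set A := ar s src.
set x := px s; set y := py s => /andP[lohi hiN] bA incA.
do 2!assign.
pose base (s1 : store R) := [/\ px s1 = x, py s1 = y, iv s1 vlo = lo,
  iv s1 vhi = hi & ar s1 src = A /\
  (forall t, ~~ (lo <= t < hi)%N -> ar s1 dst t = ar s dst t)].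
pose hull i (s1 : store R) := let c := ar s1 dst in let top := iv s1 vtop in
  [/\ (lo <= top <= i)%N, ((lo < i) ==> (lo < top))%N, increasing x c lo top,
   concave x y c lo top &
   forall t, (lo <= t < top)%N -> exists2 t', (lo <= t' < i)%N & c t = A t'].
pose I1 (_ : unit) T s1 := let i := iv s1 vx in
  [/\ base s1, hull i s1, (lo <= i <= hi)%N,
   (15 * (hi - i) + 4 * (iv s1 vtop - lo) < T)%N &
   forall t, (lo <= t < i)%N -> covered x y (ar s1 dst) lo (iv s1 vtop) (A t)].
apply: specR_spec; apply: (specR_while (I := I1) (a := tt)).
- by move=> _ T s1 [[E0 E1 E2 E3 [E4 E5]] [h1 h2 h3 h4 h5] h6 h7 h8]; sidecond.
- move=> _ T s1 [[E0 E1 E2 E3 [E4 E5]] [h1 h2 h3 h4 h5] h6 h7 h8].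
  rewrite /= E3 => qF; have xhi : iv s1 vx = hi by lia.
  rewrite xhi in h1 h2 h5 h8; split=> //.
  by move: h1 h2; rewrite lohi /=; lia.
- move=> _ T s1 [[E0 E1 E2 E3 [E4 E5]] [h1 h2 h3 h4 h5] h6 h7 h8].
  rewrite /= E3 => qT; set i := iv s1 vx in h1 h2 h5 h6 h7 h8 qT.
  set q := A i.
  do 2!(apply: specR_seti_seq; [sidecond..|]).
  apply: specR_seq.
  (* The 15 units of an entry are 3 for the outer test and the two assignments, 4 for the round that
     stops popping, 4 for the last test and the push, and 4 kept as potential of the new stack
     entry, which pay for its removal. The offset 7 balances the first two items, which are spent
     already or held in [vgo]. *)
  pose I2 (_ : unit) T2 s2 :=
    [/\ base s2, hull i s2, [/\ iv s2 vx = i, iv s2 vq = q,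
        (iv s2 vtop <= iv s1 vtop)%N & (iv s2 vgo <= 1)%N],
      (15 * (hi - i) + 4 * (iv s2 vtop - lo) + 4 * iv s2 vgo < T2 + 7)%N &
      (forall t ux uy, (lo <= t < i)%N -> upward ux uy ->
       (exists2 t', (lo <= t' < iv s2 vtop)%N & beats x y ux uy (ar s2 dst t')
         (A t))
       \/ beats x y ux uy q (A t)) /\
      (iv s2 vgo = 0%N -> (lo.+1 < iv s2 vtop)%N ->
        cross x y (ar s2 dst (iv s2 vtop - 2)) (ar s2 dst (iv s2 vtop - 1)) q <
          0)].
  have xq s2 t : hull i s2 -> (lo <= t < iv s2 vtop)%N -> x (ar s2 dst t) < x q.
    move=> [_ _ _ _ k5] /k5 [t' ht' ->]; apply: (increasing_lt incA); lia.
  have cN s2 t : hull i s2 -> (lo <= t < iv s2 vtop)%N -> (ar s2 dst t < N)%N.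
    move=> [_ _ _ _ k5] /k5 [t' ht' ->]; apply: bA; lia.
  have qN : (q < N)%N by apply: bA; lia.
  apply: (specR_while (I := I2) (a := tt)).
  + by move=> _ T2 s2 [_ _ [k1 k2 k3 k4] k5 _]; sidecond.
  + move=> _ T2 s2 [[F0 F1 F2 F3 [F4 F5]] H [k1 k2 k3 k4] k5 [k6 k7]] /= qF.
    have [g1 g2 g3 g4 g5] := H.
    have {}k7 := k7 _.
    have go0 : iv s2 vgo = 0%N by lia.
    have {}k7 := k7 go0.
    apply: (spec_specR (T1 := 3)); first lia.
    do 3!assign.
    move=> T' hT'.
    have nsd' : aeq src dst = false by [].
    exists tt; split; rewrite /base /hull /= ?aeqxx ?nsd' ?k1 ?k2 ?addn1.
    * split=> //; split=> // t ht; rewrite ifF ?F5 //; lia.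
    * split=> //; [lia|by apply/implyP; lia| | |].
      - move=> t lt tt'; have [e|tt''] := eqVneq t.+1 (iv s2 vtop).
          by rewrite /= ifF; [apply: xq => //; lia|lia].
        by rewrite /= !ifF; [apply: g3 => //; lia|lia..].
      - move=> t lt tt'; have [e|tt''] := eqVneq t.+2 (iv s2 vtop).
          rewrite /= !ifF; [|lia..].
          have := k7; rewrite -e !subSS !subn0; apply; lia.
        by rewrite /= !ifF; [apply: g4 => //; lia|lia..].
      - move=> t ht; case: eqP => [_|nt]; first by exists i => //; lia.
        have [|t' ht' ->] := g5 t; first lia.
        by exists t' => //; lia.
    * lia.
    * lia.
    * move=> t ht ux uy hu; have [ti|ti] := eqVneq t i.
        exists (iv s2 vtop); first lia.
        by rewrite eqxx ti; exact: beats_refl.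
      have [||[t' ht' hb]|hb] := k6 t ux uy; [lia|by []| |].
        exists t'; first lia.
        by rewrite ifF //; lia.
      by exists (iv s2 vtop); [lia|rewrite eqxx].
  + move=> _ T2 s2 [[F0 F1 F2 F3 [F4 F5]] H [k1 k2 k3 k4] k5 [k6 k7]] /= qT2.
    have [g1 g2 g3 g4 g5] := H.
    apply: (spec_specR (T1 := 3)); first lia.
    apply: spec_if; [sidecond|by []| |] => /=; rewrite ?F2 addn1 => q3.
      apply: spec_if => //=.
      * have b1 := cN s2 (iv s2 vtop - 2)%N H;
          have b2 := cN s2 (iv s2 vtop - 1)%N H.
        rewrite ?k2; repeat split => //; lia.
      * rewrite F0 F1 k2 => cr; assign.
        move=> T' hT'; by exists tt; split; rewrite /base /hull /=; [| | |lia|].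
      * rewrite F0 F1 k2 => /negbT; rewrite -leNgt => cr; assign.
        move=> T' hT'; exists tt; split; rewrite /base /hull /=.
        - by [].
        - split=> //; [lia|by apply/implyP; lia| | |].
          + by move=> t lt tt'; apply: g3; lia.
          + by move=> t lt tt'; apply: g4; lia.
          + by move=> t ht; apply: g5; lia.
        - by split=> //; lia.
        - lia.
        - split=> [t ux uy ht hu|]; last by lia.
          have [[t' ht' hb]|hb] := k6 t ux uy ht hu; last by right.
          have [e|nt'] := eqVneq t' (iv s2 vtop - 1)%N; last first.
            by left; exists t' => //; lia.
          have x1 : x (ar s2 dst (iv s2 vtop - 2)) < x (ar s2 dst (iv s2 vtop -
            1)).
            have -> : (iv s2 vtop - 1 = (iv s2 vtop - 2).+1)%N by lia.
            by apply: g3; lia.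
          have x2 : x (ar s2 dst (iv s2 vtop - 1)) < x q by apply: xq => //;
            lia.
          have /orP[b1|b1] := beats_below hu x1 x2 cr.
            left; exists (iv s2 vtop - 2)%N; first lia.
            by apply: beats_trans b1 _; rewrite -e.
          by right; apply: beats_trans b1 _; rewrite -e.
    assign.
    move=> T' hT'; exists tt; split; rewrite /base /hull /=;
      [by []|by []|by []|lia|].
    by split=> //; lia.
  + split; rewrite /base /hull /= ?E4 //; last first.
      by split=> // t ux uy ht hu; left; exact: h8.
    lia.
- split; rewrite /base /hull /=.
  + by [].
  + split; [lia|by apply/implyP; lia| | |] => t; lia.
  + lia.
  + lia.
  + by move=> t; lia.
Qed.

End Graham.

(** * Extreme points of blocks *)

Section Blocks.
Variables (R : realFieldType) (X Y : nat -> R) (n b : nat).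

(* Entries k b .. E k of C are the upper hull of points k b .. (k + 1) b. *)
Definition chain_ok (C E : nat -> nat) k : Prop :=
  [/\ (k * b < E k <= minn (k * b + b) n)%N,
    increasing X C (k * b) (E k), concave X Y C (k * b) (E k),
    forall t, (k * b <= t < E k)%N -> (k * b <= C t < minn (k * b + b) n)%N &
    forall p, (k * b <= p < minn (k * b + b) n)%N ->
      covered X Y C (k * b) (E k) p].

End Blocks.

Definition dot_exp (i : iexp) : rexp :=
  RB RAdd (RB RMul (RX vu) (RX i)) (RB RMul (RY vu) (RY i)).

(* The best vertex of block vk in direction vu is entry ve of its chain. *)
Definition ext_com : com :=
  SetI ve (vk |*| vblk);; SetI vf (IG aEnd vk |-| 1%N);;
  While (LtI ve vf)
    (SetI vm ((ve |+| vf) |/| 2%N);;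
     If (LtR (dot_exp (IG aChain vm)) (dot_exp (IG aChain (vm |+| 1%N))))
       (SetI ve (vm |+| 1%N)) (SetI vf vm)).

(** The machine compares strictly only: when both comparisons fail the dot products are equal, and
    the left point is preferred as in [beats]. *)
Definition better_com : com :=
  If (LtR (dot_exp vbest) (dot_exp vq)) (SetI vbest vq)
    (If (LtR (dot_exp vq) (dot_exp vbest)) Skip
      (If (LtR (RX vq) (RX vbest)) (SetI vbest vq) Skip)).

Definition scan_com : com :=
  ext_com;; SetI vbest (IG aChain ve);; SetI vk (vk |+| 1%N);;
  While (LtI vk (vkh |+| 1%N))
    (ext_com;; SetI vq (IG aChain ve);; better_com;; SetI vk (vk |+| 1%N)).

Section Rows.
Variables (R : realFieldType) (W N : nat).
Hypothesis WN : (16 * N + 16 <= W)%N.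
Variables (X Y : nat -> R) (C E : nat -> nat) (n b M lam : nat).
Hypothesis b_gt0 : (0 < b)%N.
Hypothesis nN : (n + b < N)%N.
Hypothesis lamP : (b <= 2 ^ lam)%N.
Hypothesis ME : forall k, (k < M)%N = (k * b < n)%N.
Hypothesis chains : forall k, (k < M)%N -> chain_ok X Y n b C E k.
Implicit Types (s : store R).

Definition context s : Prop :=
  [/\ px s = X, py s = Y, iv s vblk = b & ar s aChain = C /\ ar s aEnd = E].

Lemma context_framed c s s' : framed c s s' -> ~~ setsxy c ->
  ~~ has (veq vblk) (ivars c) -> ~~ has (aeq aChain) (arrs c) ->
  ~~ has (aeq aEnd) (arrs c) -> context s -> context s'.
Proof.
move=> [h1 h2 h3] c1 c2 c3 c4 [k1 k2 k3 [k4 k5]].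
have [x1 x2] := h3 c1.
by split; rewrite ?x1 ?x2 ?h1 ?h2 //; split; rewrite ?h2.
Qed.

Lemma M_le : (M <= n)%N.
Proof.
rewrite leqNgt; apply/negP => nM; move: (ME n); rewrite nM => /esym.
by rewrite ltnNge leq_pmulr.
Qed.

(** The rising edges form an initial segment of the chain, so bisection finds the peak. A round
    takes 4 units and halves the range. *)
Lemma ext_spec s : context s -> (iv s vk < M)%N -> (iv s vu < N)%N ->
  upward (X (iv s vu)) (Y (iv s vu)) ->
  spec W ext_com s (4 * lam + 3) (fun s' =>
    peak X Y (X (iv s vu)) (Y (iv s vu)) C (iv s vk * b) (E (iv s vk)) (iv s'
      ve)).
Proof.
move=> ctx; have [E0 E1 E2 [E3 E4]] := ctx.
set k := iv s vk; set u := iv s vu => kM uN hu.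
have [Ek inc con CN _] := chains kM; have ML := M_le.
set lo := (k * b)%N in Ek inc con CN *; set hi := E k in Ek inc con CN *.
have hin : (hi <= n)%N by lia.
do 2!assign.
pose I (j : nat) T s1 := [/\ context s1, iv s1 vu = u,
  (lo <= iv s1 ve <= iv s1 vf)%N /\ (iv s1 vf < hi)%N,
  (iv s1 vf - iv s1 ve < 2 ^ j)%N /\ (4 * j < T)%N &
  (forall t, (lo <= t < iv s1 ve)%N -> rises X Y (X u) (Y u) C t) /\
  ((iv s1 vf).+1 < hi -> ~~ rises X Y (X u) (Y u) C (iv s1 vf))%N].
apply: (spec_while (I := I) (a := lam)).
- by move=> j T s1 [_ _ [h1 h2] [h3 h4] [h5 h6]]; sidecond.
- move=> j T s1 [_ _ [h1 h2] [h3 h4] [h5 h6]] /= qF.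
  have ef : iv s1 ve = iv s1 vf by lia.
  by split; [lia|exact: h5|rewrite ef].
- move=> j T s1 [[F0 F1 F2 [F3 F4]] F5 [h1 h2] [h3 h4] [h5 h6]] /= qT.
  set e := iv s1 ve in h1 h3 h5 qT; set f := iv s1 vf in h1 h2 h3 h6 qT.
  have j0 : (0 < j)%N by case: j h3 {h4} => //; rewrite expn0; lia.
  exists 3%N; split; first lia.
  assign.
  pose m := ((e + f) %/ 2)%N.
  have em : (e <= m < f)%N by rewrite /m; lia.
  have C1 := CN m; have C2 := CN m.+1.
  have hj : (f - e < 2 * 2 ^ j.-1)%N by rewrite -expnS prednK.
  apply: spec_if => //; rewrite /= -/e -/f -/m ?F0 ?F1 ?F3 ?F5 ?addn1.
  + by repeat split => //; lia.
  + move=> hr; assign.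
    exists j.-1; split; rewrite /context /= -/e -/f -/m ?addn1 //.
    * lia.
    * by split; [rewrite /m; lia|lia].
    * split=> // t ht; apply: (rise_before (t' := m) hu inc con) => //; lia.
  + move=> hr; assign.
    exists j.-1; split; rewrite /context /= -/e -/f -/m ?addn1 //.
    * lia.
    * by split; [rewrite /m; lia|lia].
    * by split=> // _; rewrite /rises hr.
- split; rewrite /context /= ?E4 ?E2 -/k -/lo -/hi //.
  + lia.
  + by split; lia.
  + by split=> [t|]; lia.
Qed.

Lemma better_spec s : context s -> (iv s vu < N)%N -> (iv s vbest < N)%N ->
  (iv s vq < N)%N -> let u := iv s vu in
  spec W better_com s 4 (fun s' =>
    [/\ iv s' vbest = iv s vbest \/ iv s' vbest = iv s vq,
      beats X Y (X u) (Y u) (iv s' vbest) (iv s vbest) &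
      beats X Y (X u) (Y u) (iv s' vbest) (iv s vq)]).
Proof.
move=> [E0 E1 E2 [E3 E4]] uN bN qN /=; set u := iv s vu.
apply: spec_if => //; rewrite /= ?E0 ?E1 -/u; first by repeat split=> //; lia.
  move=> h; apply: spec_seti => //=; split; first by right.
    by rewrite /beats /dot h.
  exact: beats_refl.
move=> h1; apply: spec_if => //; rewrite /= ?E0 ?E1 -/u;
  first by repeat split=> //; lia.
  move=> h; apply: spec_skip; split; [by left|exact: beats_refl|].
  by rewrite /beats /dot h.
move=> h2; have e : dot X Y (X u) (Y u) (iv s vq) = dot X Y (X u) (Y u) (iv s
  vbest).
  by apply/eqP; rewrite eq_le /dot leNgt h1 leNgt h2.
apply: spec_if => //; rewrite /= ?E0; first by repeat split=> //; lia.
  move=> h; apply: spec_seti => //=; split; first by right.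
    by rewrite /beats e ltxx eqxx /= ltW.
  exact: beats_refl.
move=> h; apply: spec_skip; split; [by left|exact: beats_refl|].
by rewrite /beats e ltxx eqxx /= leNgt h.
Qed.

Lemma scan_spec s : context s -> (iv s vk <= iv s vkh < M)%N ->
  (iv s vu < N)%N -> upward (X (iv s vu)) (Y (iv s vu)) ->
  spec W scan_com s ((4 * lam + 10) * (iv s vkh - iv s vk).+1) (fun s' =>
    (iv s' vbest < n)%N /\
    forall p, (p < n)%N -> (iv s vk <= p %/ b <= iv s vkh)%N ->
      beats X Y (X (iv s vu)) (Y (iv s vu)) (iv s' vbest) p).
Proof.
move=> ctx; set k := iv s vk; set kh := iv s vkh; set u := iv s vu.
move=> kkh uN hu; have ML := M_le; have [K EK] : exists K,
  K = (4 * lam + 10)%N by eexists.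
rewrite -EK.
(* The chain covers its block and its peak beats the whole chain, so one search per block accounts
   for all its points. *)
have blockP j e : (j < M)%N -> peak X Y (X u) (Y u) C (j * b) (E j) e ->
    (e < n)%N /\ (C e < n)%N /\ forall p, (p < n)%N -> (p %/ b)%N = j ->
      beats X Y (X u) (Y u) (C e) p.
  move=> jM pk; have [Ej inc con CN cov] := chains jM.
  have [eE _ _] := pk; split; first by lia.
  split; first by have := CN e eE; lia.
  move=> p pn pj; have [|t ht hb] := cov p _ _ _ hu.
    by have := divn_eq p b; have := ltn_pmod p b_gt0; rewrite pj; lia.
  exact: beats_trans (peak_beats hu inc con pk ht) hb.
rewrite /scan_com mulnS.
have [D ED] : exists D, D = (K * (kh - k))%N by eexists.
rewrite -ED.
apply: (spec_seq (T1 := 4 * lam + 3)); first by lia.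
have kM : (k < M)%N by lia.
apply: (spec_weaken (spec_frame (ext_spec ctx kM uN hu))) => // s1 [pk fr].
have [F1 F2 F3] := fr; have ctx1 := context_framed fr isT isT isT isT ctx.
have [en [Cn Cb]] := blockP _ _ kM pk.
have [_ _ _ [EC _]] := ctx1.
have F1k : iv s1 vk = k by exact: F1.
do 2!assign.
pose I (_ : unit) T s2 := [/\ context s2, iv s2 vu = u, iv s2 vkh = kh,
  [/\ (k < iv s2 vk <= kh.+1)%N, (iv s2 vbest < n)%N &
      (K * (kh.+1 - iv s2 vk) < T)%N] &
  forall p, (p < n)%N -> (k <= p %/ b < iv s2 vk)%N ->
      beats X Y (X u) (Y u) (iv s2 vbest) p].
apply: (spec_while (I := I) (a := tt)).
- move=> _ T s2 [_ _ e1 [e2 e3 e4] e5].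
  by split; [sidecond|exact: leq_ltn_trans (leq0n _) e4].
- move=> _ T s2 [_ _ e1 [e2 e3 e4] e5] /= qF; split=> // p pn hp;
    apply: e5 => //.
  lia.
- move=> _ T s2 [ctx2 e0 e1 [e2 e3 e4] e5] /=; rewrite e1 => qT.
  have k2M : (iv s2 vk < M)%N by lia.
  have [D2 ED2] : exists D2, D2 = (K * (kh.+1 - (iv s2 vk).+1))%N by eexists.
  have hT : (D2 + K < T)%N.
    by rewrite ED2 -mulnSr; apply: leq_ltn_trans e4; rewrite leq_mul2l; lia.
  exists K.-1; split; first lia.
  apply: (spec_seq (T1 := 4 * lam + 3)); first by lia.
  have := @ext_spec s2 ctx2 k2M; rewrite e0 => /(_ uN hu)/spec_frame H.
  apply: (spec_weaken H) => // s3 [pk3 fr3].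
  have [G1 G2 G3] := fr3; have ctx3 := context_framed fr3 isT isT isT isT ctx2.
  have [en3 [Cn3 Cb3]] := blockP _ _ k2M pk3.
  have [_ _ _ [EC3 _]] := ctx3.
  have G1k : iv s3 vk = iv s2 vk by exact: G1.
  assign.
  apply: (spec_seq (T1 := 4)); first by lia.
  rewrite /= EC3.
  set s4 := seti _ _ _.
  have ctx4 : context s4 by [].
  have G1u : iv s3 vu = u by rewrite G1.
  have G1b : iv s3 vbest = iv s2 vbest by exact: G1.
  have s4u : iv s4 vu = u by rewrite -G1u.
  have s4q : iv s4 vq = C (iv s3 ve) by [].
  have s4b : iv s4 vbest = iv s2 vbest by rewrite -G1b.
  have s4k : iv s4 vk = iv s2 vk by rewrite -G1k.
  have s4kh : iv s4 vkh = kh by rewrite -e1 -G1.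
  clearbody s4.
  have := @better_spec s4 ctx4; rewrite /= s4u s4q s4b.
  move=> /(_ _ _ _)/spec_frame H4; apply: (spec_weaken (H4 _ _ _)) => //;
    try lia.
  move=> s5 [[B1 B2 B3] fr5]; have [J1 J2 J3] := fr5.
  have ctx5 := context_framed fr5 isT isT isT isT ctx4.
  have J1k : iv s5 vk = iv s2 vk by rewrite J1.
  assign.
  have J1u : iv s5 vu = u by rewrite J1.
  have J1kh : iv s5 vkh = kh by rewrite J1.
  exists tt; split; rewrite /= ?J1u ?J1kh ?J1k ?addn1 //.
  + split=> //; [lia| |].
      by case: B1 => ->; rewrite ?s4b.
    by rewrite -ED2; lia.
  + move=> p pn /andP[kp]; rewrite ltnS leq_eqVlt => /orP[/eqP pk2|pk2].
      by apply: beats_trans B3 (Cb3 _ pn pk2).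
    by apply: beats_trans B2 _; apply: e5 => //; rewrite kp.
- have F1u : iv s1 vu = u by exact: F1.
  have F1kh : iv s1 vkh = kh by exact: F1.
  split; rewrite /= ?F1k ?F1u ?F1kh ?addn1 //.
  + split; [lia|by rewrite EC|].
    by rewrite subSS -ED; lia.
  + by move=> p pn hp; rewrite EC; apply: Cb => //; lia.
Qed.

End Rows.

(** * Extreme points in many directions *)

(** The first row of a level has index [vw], and its left neighbour is the sentinel 0 in entry 0 of
    [aVtx], which lies in block 0. A missing right neighbour is replaced by the last block. *)
Definition row_com : com :=
  SetI vk (IG aVtx (vi |-| vw) |/| vblk);;
  If (LtI (vi |+| vw) (vR |+| 1%N))
    (SetI vkh (IG aVtx (vi |+| vw) |/| vblk)) (SetI vkh (vM |-| 1%N));;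
  SetI vu (IG aDir vi);;
  scan_com;;
  SetA aVtx vi vbest;;
  SetI vi (vi |+| vw |+| vw).

(* Row i is the search for the best point in direction aDir i.  The rows that
   are odd multiples of vw are searched in the blocks between the results of
   the two neighbouring multiples of 2 vw. *)
Definition rows_com : com :=
  SetI vw 1%N;; While (LtI vw (vR |+| 1%N)) (SetI vw (vw |+| vw));;
  SetA aVtx 0%N 0%N;;
  While (LtI 1%N vw)
    (SetI vw (vw |/| 2%N);; SetI vi vw;;
     While (LtI vi (vR |+| 1%N)) row_com).

Section RowMaxima.
Variables (R : realFieldType) (W N : nat).
Hypothesis WN : (16 * N + 16 <= W)%N.
Variables (X Y : nat -> R) (C E : nat -> nat) (n b M lam : nat).
Hypothesis n_gt0 : (0 < n)%N.
Hypothesis b_gt0 : (0 < b)%N.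
Hypothesis nN : (n + b < N)%N.
Hypothesis lamP : (b <= 2 ^ lam)%N.
Hypothesis ME : forall k, (k < M)%N = (k * b < n)%N.
Hypothesis chains : forall k, (k < M)%N -> chain_ok X Y n b C E k.
Hypothesis Xinj : forall p q, (p < n)%N -> (q < n)%N -> X p = X q -> p = q.
Hypothesis promise : forall ux uy vx vy p q, upward ux uy -> upward vx vy ->
  best X Y n ux uy p -> best X Y n vx vy q -> X p <= X q -> (p <= q)%N.
Variables (D : nat -> nat) (r : nat).
Hypothesis rN : (r + 2 < N)%N.
Hypothesis D_upward : forall i, (0 < i <= r)%N ->
  (D i < N)%N /\ upward (X (D i)) (Y (D i)).
Hypothesis D_turns : forall i j, (0 < i)%N -> (i <= j <= r)%N ->
  turns_right (X (D i), Y (D i)) (X (D j), Y (D j)).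
Implicit Types (s : store R).

Definition row_ok (V : nat -> nat) i := best X Y n (X (D i)) (Y (D i)) (V i).

Lemma row_ok_le V i j : (0 < i)%N -> (i <= j <= r)%N ->
  row_ok V i -> row_ok V j -> X (V i) <= X (V j).
Proof.
move=> i0 ij bi bj; have := turns_right_le (D_turns i0 ij).
by apply; [apply: bi.2; exact: bj.1|apply: bj.2; exact: bi.1].
Qed.

(** Monotonicity of the row maxima: turning right moves the extreme point to the right, and the
    promise converts abscissas into indices. *)
Lemma row_ok_leq V i j : (0 < i)%N -> (i <= j <= r)%N ->
  row_ok V i -> row_ok V j -> (V i <= V j)%N.
Proof.
move=> i0 ij bi bj; apply: promise bi bj (row_ok_le i0 ij bi bj).
  by apply: (D_upward _).2; clear -i0 ij; lia.
by apply: (D_upward _).2; clear -i0 ij; lia.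
Qed.

Lemma block_lt p : (p < n)%N -> (p %/ b < M)%N.
Proof. by move=> pn; rewrite ME; have h := divn_eq p b; clear -h pn; lia. Qed.

Definition rows_context s :=
  [/\ context X Y C E b s, iv s vR = r, iv s vM = M & ar s aDir = D].

Lemma row_spec s w i : rows_context s -> iv s vw = w -> iv s vi = i ->
  (0 < w <= i)%N -> (i <= r)%N -> (w <= 2 * r)%N ->
  let V := ar s aVtx in
  let kl := (V (i - w) %/ b)%N in
  let kh := (if i + w <= r then V (i + w) %/ b else M.-1)%N in
  V 0%N = 0%N -> ((w < i)%N -> row_ok V (i - w)) ->
  ((i + w <= r)%N -> row_ok V (i + w)) ->
  spec W row_com s ((4 * lam + 10) * (kh - kl).+1 + 6) (fun s' =>
    [/\ rows_context s', iv s' vw = w, iv s' vi = (i + w + w)%N &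
      (kl <= kh < M)%N /\ exists2 v, best X Y n (X (D i)) (Y (D i)) v &
       ar s' aVtx = (fun j => if j == i then v else V j)]).
Proof.
move=> [ctx E1 E2 E3] E4 E5 wi ir w2r V kl kh V0 Vl Vh.
have [E6 E7 E8 [E9 E10]] := ctx.
have ML := M_le b_gt0 ME.
have M0 : (0 < M)%N by rewrite ME mul0n.
have [Di Dup] : (D i < N)%N /\ upward (X (D i)) (Y (D i)) by apply: D_upward;
  lia.
have [p bp] := best_exists X Y (X (D i)) (Y (D i)) n_gt0.
(* The true answer is placed in row [i], so that monotonicity compares its block with those of the
   neighbouring rows. *)
pose V' j := if j == i then p else V j.
have Vi : row_ok V' i by rewrite /row_ok /V' eqxx.
have klp : (kl <= p %/ b)%N.
  rewrite /kl; have [wi'|wi'] := ltnP w i; last first.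
    have -> : (i - w = 0)%N by lia.
    by rewrite V0 div0n.
  have := @row_ok_leq V' (i - w) i; rewrite /V' eqxx ifF; last by lia.
  move=> h; apply: leq_div2r; apply: h => //; [lia|lia|].
  by have := Vl wi'; rewrite /row_ok /V' ifF //; lia.
have pkh : (p %/ b <= kh)%N.
  rewrite /kh; case: ifP => iwr.
    have := @row_ok_leq V' i (i + w); rewrite /V' eqxx ifF; last by lia.
    move=> h; apply: leq_div2r; apply: h => //; [lia|lia|].
    by have := Vh iwr; rewrite /row_ok /V' ifF //; lia.
  by have := block_lt bp.1; lia.
have khM : (kh < M)%N.
  by rewrite /kh; case: ifP => [/Vh[vn _]|_]; [exact: block_lt|lia].
have [Z EZ] : exists Z, Z = ((4 * lam + 10) * (kh - kl).+1)%N by eexists.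
rewrite -EZ; assign.
rewrite /= E4 E5 E8 -/V -/kl.
set s1 := seti _ _ _.
have Vkh : (i + w <= r)%N -> (V (i + w) < n)%N by case/Vh.
apply: (spec_seq (T1 := 2)); first by lia.
have step s2 : rows_context s2 -> iv s2 vw = w -> iv s2 vi = i ->
  ar s2 aVtx = V ->
    iv s2 vk = kl -> iv s2 vkh = kh ->
    spec W (SetI vu (IG aDir vi);; scan_com;; SetA aVtx vi vbest;;
        SetI vi (vi |+| vw |+| vw)) s2 (Z + 3)
    (fun s' =>
    [/\ rows_context s', iv s' vw = w, iv s' vi = (i + w + w)%N &
      (kl <= kh < M)%N /\ exists2 v, best X Y n (X (D i)) (Y (D i)) v &
       ar s' aVtx = (fun j => if j == i then v else V j)]).
  move=> [ctx2 F1 F2 F3] F4 F5 F6 F7 F8.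
  assign.
  rewrite /= F3 F5; set s3 := seti _ _ _.
  have ctx3 : context X Y C E b s3 by [].
  apply: (spec_seq (T1 := Z)); first by lia.
  have s3k : iv s3 vk = kl by rewrite -F7.
  have s3kh : iv s3 vkh = kh by rewrite -F8.
  have s3u : iv s3 vu = D i by [].
  have s3i : iv s3 vi = i by rewrite -F5.
  have s3w : iv s3 vw = w by rewrite -F4.
  have s3R : iv s3 vR = r by rewrite -F1.
  have s3M : iv s3 vM = M by rewrite -F2.
  have s3D : ar s3 aDir = D by rewrite -F3.
  have s3V : ar s3 aVtx = V by rewrite -F6.
  clearbody s3.
  have := scan_spec WN b_gt0 nN lamP ME chains ctx3.
  rewrite s3k s3kh s3u -EZ => /(_ _ _ _)/spec_frame H.
  apply: (spec_weaken (H _ _ _)) => //; first by lia.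
  move=> s4 [[vn vb] fr]; have [G1 G2 G3] := fr.
  have ctx4 := context_framed fr isT isT isT isT ctx3.
  have s4i : iv s4 vi = i by rewrite G1.
  have s4w : iv s4 vw = w by rewrite G1.
  do 2!assign.
  split; rewrite /= ?s4i ?s4w //.
    by split; [exact: ctx4|rewrite /= G1|rewrite /= G1|rewrite /= G2].
  split; first by lia.
  exists (iv s4 vbest); last by rewrite G2 // s3V.
  (* The scanned blocks include the block of the true extreme point [p], and whatever beats [p]
     beats every point. *)
  split=> // q qn; apply: beats_trans (bp.2 _ qn).
  by apply: vb; [exact: bp.1|rewrite klp pkh].
apply: spec_if; [by sidecond|by []| |]; rewrite /= E1 E4 E5 addn1 ltnS => q.
  have kE : kh = (V (i + w) %/ b)%N by rewrite /kh q.
  have vw' := Vkh q.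
  apply: spec_seti => //; first by sidecond.
  rewrite /= E4 E5 E8 -/V -kE.
  by apply: (spec_weaken (step _ _ _ _ _ _ _)) => //; lia.
have kE : kh = (M - 1)%N by rewrite /kh q subn1.
assign.
rewrite /= E2 -kE.
by apply: (spec_weaken (step _ _ _ _ _ _ _)) => //; lia.
Qed.

(** On each level the block ranges of successive rows share only end blocks, so their lengths
    telescope to [M] plus the number of rows. There are at most [rho] levels, as [vw] starts from
    the first power of two above [r]. *)
Lemma rows_spec s rho : rows_context s -> (r < 2 ^ rho)%N -> (0 < r)%N ->
  spec W rows_com s (((4 * lam + 18) * (M + r.+1) + 6) * rho + 4) (fun s' =>
    forall i, (0 < i <= r)%N -> row_ok (ar s' aVtx) i).
Proof.
move=> rc hrho r0; have [K EK] : exists K, K = (4 * lam + 18)%N by eexists.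
rewrite -EK; have [L EL] : exists L, L = (K * (M + r.+1))%N by eexists.
rewrite -EL.
have ML := M_le b_gt0 ME.
assign.
apply: (spec_seq (T1 := (2 * rho + 1)%N)); first by lia.
pose I1 (j : nat) T s1 := [/\ rows_context s1, iv s1 vw = (2 ^ j)%N,
  (j <= rho)%N,
  (2 ^ j <= 2 * r)%N & (2 * (rho - j) < T)%N].
apply: (spec_while (I := I1) (a := 0%N)); last first.
- by split=> //; rewrite /= ?expn0; lia.
- move=> j T s1 [rc1 e1 e2 e3 e4] /= qT; have [ctx1 F1 F2 F3] := rc1.
  have jr : (j < rho)%N.
    rewrite ltn_neqAle e2 andbT; apply: contraL hrho => /eqP <-; lia.
  exists 1%N; split; first by lia.
  assign.
  exists j.+1; split; rewrite /= ?e1 ?expnS //; lia.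
- move=> j T s1 [rc1 e1 e2 e3 e4] /= qF; have [ctx1 F1 F2 F3] := rc1.
  have rj : (r < 2 ^ j)%N by lia.
  assign.
  pose rows_at (w : nat) s2 := [/\ rows_context s2, iv s2 vw = w,
    ar s2 aVtx 0%N = 0%N &
    forall i, (0 < i <= r)%N -> (w %| i)%N -> row_ok (ar s2 aVtx) i].
  pose I2 (j : nat) T s2 := [/\ rows_at (2 ^ j)%N s2, (2 ^ j <= 2 * r)%N &
    ((L + 4) * j < T)%N].
  apply: (spec_while (I := I2) (a := j)).
  + by move=> j2 T2 s2 [[rc2 e5 e6 e7] e8 e9]; split;
      [sidecond|exact: leq_ltn_trans e9].
  + move=> j2 T2 s2 [[rc2 e5 e6 e7] e8 e9] /= qF2 i hi; apply: e7 => //.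
    have j0 : j2 = 0%N.
      apply/eqP; apply: contraFT qF2; rewrite -lt0n e5 => j0.
      by rewrite -{1}(expn0 2) ltn_exp2l.
    by rewrite j0 dvd1n.
  + move=> j2 T2 s2 [[rc2 e5 e6 e7] e8 e9] /= qT2; have [ctx2 H1 H2 H3] := rc2.
    have j0 : (0 < j2)%N by move: qT2; rewrite e5; case: (j2).
    pose w := (2 ^ j2.-1)%N; have ew : (2 ^ j2 = 2 * w)%N by rewrite -expnS
      prednK.
    have w0 : (0 < w)%N by rewrite expn_gt0.
    exists (L + 3)%N; split.
      by apply: leq_ltn_trans e9; case: (j2) j0 => // j3 _; rewrite mulnS; lia.
    do 2!assign.
    have ew2 : (iv s2 vw %/ 2)%N = w by rewrite e5 ew mulKn.
    rewrite /= ew2.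
    (* The remaining time is measured by the blocks from that of row [i - w] on and by the remaining
       rows. Beyond row [r] only the final test has to be paid. *)
    pose I3 (_ : unit) T3 s3 := let i := iv s3 vi in
     [/\ rows_context s3, iv s3 vw = w, ar s3 aVtx 0%N = 0%N,
        [/\ (2 * w %| i + w)%N, (w <= i)%N, (0 < T3)%N & (i <= r)%N ->
            (K * (M - ar s3 aVtx (i - w) %/ b + (r.+1 - i)) < T3)%N] &
      forall j, (0 < j <= r)%N -> (2 * w %| j)%N || (w %| j)%N && (j < i)%N ->
        row_ok (ar s3 aVtx) j].
    apply: (spec_while (I := I3) (a := tt)).
    * move=> _ T3 s3 [rc3 f1 f2 [_ f4 f5 _] f7]; have [_ G1 _ _] := rc3.
      by sidecond.
    * move=> _ T3 s3 [rc3 f1 f2 [_ _ _ _] f7] /=; have [_ G1 _ _] := rc3.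
      rewrite G1 => qF3; exists j2.-1; split; last 2 first.
      - by rewrite -/w; clear -e8 ew; lia.
      - by move: e9; case: (j2) j0 => // j3 _; rewrite mulnS /=; clear; lia.
      split=> // i hi wi; apply: f7 => //; rewrite wi /=; apply/orP; right.
      by clear -qF3 hi; lia.
    * move=> _ T3 s3 [rc3 f1 f2 [f3 f4 f5 f6] f7] /=; have [_ G1 G2 _] := rc3.
      rewrite G1 addn1 ltnS => ir; set i := iv s3 vi in f3 f4 f6 f7 ir.
      have {}f6 := f6 ir; set V := ar s3 aVtx in f2 f6 f7.
      have d1 : (2 * w %| i - w)%N.
        by rewrite (_ : (i - w = (i + w) - 2 * w)%N) ?dvdn_sub //;
          clear -f4 w0; lia.
      have lw : (2 * w <= 2 * r)%N by rewrite -ew.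
      have wi0 : (0 < w <= i)%N by rewrite w0.
      have wr : (w <= 2 * r)%N by clear -lw; lia.
      have Vl : (w < i)%N -> row_ok V (i - w).
        by move=> wi; apply: f7; [clear -wi ir; lia|rewrite d1].
      have Vh : (i + w <= r)%N -> row_ok V (i + w).
        by move=> iw; apply: f7; [clear -iw w0; lia|rewrite f3].
      have := @row_spec s3 w i rc3 f1 (erefl _) wi0 ir wr f2 Vl Vh.
      case=> t4 [s4 [x4 l4 [rc4 g1 g2 [g3 [v bv g4]]]]].
      set kl := (ar s3 aVtx (i - w) %/ b)%N in l4 g3.
      set kh := (if _ then _ else _) in l4 g3.
      have hK : (K * (M - kh + (r.+1 - (i + w + w))) + K * (kh - kl).+1 <=
         K * (M - kl + (r.+1 - i)))%N.
        by rewrite -mulnDr leq_mul2l; clear -g3 ir w0; lia.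
      have hK2 : ((4 * lam + 10) * (kh - kl).+1 + 8 <= K * (kh - kl).+1)%N.
        rewrite EK (_ : 4 * lam + 18 = 4 * lam + 10 + 8)%N;
          last by rewrite -addnA.
        by rewrite [X in (_ <= X)%N]mulnDl leq_add2l leq_pmulr.
      rewrite -/V -/kl in f6.
      exists ((4 * lam + 10) * (kh - kl).+1 + 6)%N; split.
        by clear -f6 hK hK2; lia.
      exists t4, s4; split=> //; exists tt; split=> //.
      - by rewrite g4 ifF //; clear -f4 w0; lia.
      - rewrite g2; split.
        + by rewrite -(addnA (i + w) w w) dvdn_addr // addnn -mul2n dvdnn.
        + by clear; lia.
        + by clear -f6 hK hK2; lia.
        move=> iwr; rewrite g4 ifF; last by clear -w0; lia.
        have -> : (i + w + w - w = i + w)%N by rewrite addnK.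
        have iwr' : (i + w <= r)%N by clear -iwr; lia.
        have khE : (ar s3 aVtx (i + w) %/ b)%N = kh by rewrite /kh iwr'.
        by rewrite khE; clear -f6 hK hK2; lia.
      - move=> j3 hj3 hd; rewrite /row_ok g4; case: eqP => [->//|nj].
        apply: f7 => //; case: (boolP (2 * w %| j3)%N) hd => //= nd.
        rewrite g2 => /andP[wj jl]; rewrite wj /=.
        rewrite ltn_neqAle (introN eqP nj) /= leqNgt; apply/negP => ij.
        (* The only multiple of [w] strictly between [i] and [i + 2 * w] is [i + w], which is
           divisible by [2 * w], contrary to the choice of [j3]. *)
        have /dvdnP[z1 z1E] := f3; have /dvdnP[z2 z2E] := wj.
        have z2e : (z2 = 2 * z1)%N.
          have h1 : ((2 * z1).-1 * w < z2 * w)%N.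
            by rewrite -z2E -subn1 mulnBl mul1n (mulnC 2) -mulnA -z1E addnK.
          have h2 : (z2 * w < (2 * z1).+1 * w)%N.
            by rewrite -z2E mulSn (mulnC 2) -mulnA -z1E; clear -jl; lia.
          by move: h1 h2; rewrite !ltn_pmul2r //; clear; lia.
        have /negP[] := nd.
        by rewrite z2E z2e -mulnA mulnCA dvdn_mull.
    * split; rewrite /= ?subnn ?e6 //.
      - split=> //.
        + by rewrite addnn -mul2n.
        + by lia.
        + by move=> _; rewrite div0n subn0; nia.
      - move=> j3 hj3 /orP[hd|/andP[/dvdn_leq]]; last by lia.
        by apply: e7 => //; rewrite ew.
  + split=> //.
    * split; rewrite ?ar_seta //= => i hi; first by move=> /dvdn_leq; lia.
    * by move: e4; nia.
- by move=> j T s1 [rc1 e1 e2 e3 e4]; have [ctx1 F1 F2 F3] := rc1; sidecond.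
Qed.

End RowMaxima.

(** * Candidates between consecutive directions *)

(** The interval of abscissas is half-open, so the candidates of successive gaps are disjoint and
    sorting each gap by itself sorts them all. *)
Definition push_com : com :=
  SetI vq (IG aChain vt);;
  If (LtR (RX vq) (RX (IG aVtx vj))) Skip
    (If (LtR (RX vq) (RX (IG aVtx (vj |+| 1%N))))
      (SetA aCand vcnt vq;; SetI vcnt (vcnt |+| 1%N)) Skip);;
  SetI vt (vt |+| 1%N).

Definition gap_block_com : com :=
  SetI vu (IG aDir vj);; ext_com;; SetI vt ve;;
  SetI vu (IG aDir (vj |+| 1%N));; ext_com;;
  While (LtI vt (ve |+| 1%N)) push_com.

(* Collects, in the order of abscissas, candidates for the vertices of the
   upper hull: for each pair of consecutive directions the vertices of the
   block chains that are extreme in between. *)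
Definition gaps_com : com :=
  SetI vcnt 0%N;; SetI vj 1%N;;
  While (LtI vj vR)
    (SetI vst vcnt;; SetI vk (IG aVtx vj |/| vblk);;
     SetI vkh (IG aVtx (vj |+| 1%N) |/| vblk);;
     While (LtI vk (vkh |+| 1%N)) (gap_block_com;; SetI vk (vk |+| 1%N));;
     (SetI vlo vst;; SetI vhi vcnt;; sort_com aCand);; SetI vj (vj |+| 1%N));;
  SetA aCand vcnt (IG aVtx vR);; SetI vcnt (vcnt |+| 1%N).

Section Gaps.
Variables (R : realFieldType) (W N : nat).
Hypothesis WN : (16 * N + 16 <= W)%N.
Variables (X Y : nat -> R) (C E : nat -> nat) (n b M lam : nat).
Hypothesis b_gt0 : (0 < b)%N.
Hypothesis nN : (n + b < N)%N.
Hypothesis lamP : (b <= 2 ^ lam)%N.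
Hypothesis ME : forall k, (k < M)%N = (k * b < n)%N.
Hypothesis chains : forall k, (k < M)%N -> chain_ok X Y n b C E k.
Hypothesis Xinj : forall p q, (p < n)%N -> (q < n)%N -> X p = X q -> p = q.
Hypothesis promise : forall ux uy vx vy p q, upward ux uy -> upward vx vy ->
  best X Y n ux uy p -> best X Y n vx vy q -> X p <= X q -> (p <= q)%N.
Variables (D V : nat -> nat) (r : nat).
Hypothesis rN : (r + 2 < N)%N.
Hypothesis D_upward : forall i, (0 < i <= r)%N ->
  (D i < N)%N /\ upward (X (D i)) (Y (D i)).
Hypothesis D_turns : forall i j, (0 < i)%N -> (i <= j <= r)%N ->
  turns_right (X (D i), Y (D i)) (X (D j), Y (D j)).
Hypothesis D_total : forall i ux uy, (0 < i <= r)%N -> upward ux uy ->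
  turns_right (X (D i), Y (D i)) (ux, uy) \/
  turns_right (ux, uy) (X (D i), Y (D i)).
Hypothesis V_ok : forall i, (0 < i <= r)%N -> row_ok X Y n D V i.
Variable G : nat.
Hypothesis G_peak : forall j k e1 e2, (0 < j < r)%N -> (k < M)%N ->
  peak X Y (X (D j)) (Y (D j)) C (k * b) (E k) e1 ->
  peak X Y (X (D j.+1)) (Y (D j.+1)) C (k * b) (E k) e2 -> (e2 < e1 + G)%N.
Implicit Types (s : store R).

Definition wanted j k p := [/\ (p %/ b)%N = k, X (V j) <= X p < X (V j.+1) &
  exists ux uy, upward ux uy /\ best X Y n ux uy p].

Definition gaps_context s := rows_context X Y C E b M D r s /\ ar s aVtx = V.

Lemma gaps_context_framed c s s' : framed c s s' -> ~~ setsxy c ->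
  ~~ has (fun x => has (veq x) (ivars c)) [:: vblk; vR; vM] ->
  ~~ has (fun a => has (aeq a) (arrs c)) [:: aChain; aEnd; aDir; aVtx] ->
  gaps_context s -> gaps_context s'.
Proof.
move=> fr c1 /=; rewrite !orbF !negb_or => /and3P[v1 v2 v3] /and4P[a1 a2 a3 a4].
move=> [[h1 h2 h3 h4] h5]; have [f1 f2 _] := fr.
split; last by rewrite f2.
by split; [exact: context_framed fr _ _ _ _ h1|rewrite f1|rewrite f1|rewrite
  f2].
Qed.

(** A hull vertex is extreme in some direction, hence also on the chain of its block. Comparing that
    direction with the two consecutive ones places the vertex between the two peaks. *)
Lemma wanted_peaks j k e1 e2 p : (0 < j < r)%N -> (k < M)%N ->
  peak X Y (X (D j)) (Y (D j)) C (k * b) (E k) e1 ->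
  peak X Y (X (D j.+1)) (Y (D j.+1)) C (k * b) (E k) e2 ->
  wanted j k p -> exists2 t, (e1 <= t <= e2)%N & C t = p.
Proof.
move=> jr kM pk1 pk2 [pk /andP[Vp pV] [ux [uy [hu [pn bp]]]]].
have [Ek inc con CN cov] := chains kM.
have pb : (k * b <= p < minn (k * b + b) n)%N.
  by have := divn_eq p b; have := ltn_pmod p b_gt0; rewrite pk; lia.
have [t ht hb] := cov p pb _ _ hu.
have Cn i : (k * b <= i < E k)%N -> (C i < n)%N by move=> /CN; lia.
have Ct : C t = p.
  by apply: Xinj; [exact: Cn|by []|exact: beats_anti hb (bp _ (Cn _ ht))].
have [he1 _ _] := pk1; have [he2 _ _] := pk2.
have [Dj1 Du1] : (D j < N)%N /\ upward (X (D j)) (Y (D j)) by apply: D_upward;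
  lia.
have [Dj2 Du2] : (D j.+1 < N)%N /\ upward (X (D j.+1)) (Y (D j.+1)).
  by apply: D_upward; lia.
have [Vn1 Vb1] : row_ok X Y n D V j by apply: V_ok; lia.
have [Vn2 Vb2] : row_ok X Y n D V j.+1 by apply: V_ok; lia.
have b1 : beats X Y (X (D j)) (Y (D j)) (C e1) p.
  by rewrite -Ct; exact: peak_beats pk1 _ ht.
have b2 : beats X Y (X (D j.+1)) (Y (D j.+1)) (C e2) p.
  by rewrite -Ct; exact: peak_beats pk2 _ ht.
exists t => //; apply/andP; split.
  apply: (increasing_leq inc); [lia|lia|rewrite Ct].
  have [tr|tr] : turns_right (X (D j), Y (D j)) (ux, uy) \/
      turns_right (ux, uy) (X (D j), Y (D j)) by apply: D_total => //; lia.
    exact: turns_right_le tr b1 (bp _ (Cn _ he1)).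
  (* The direction of [p] precedes [D j] although [p] is not left of [V j]. Then [p] is [V j], the
     overall winner in direction [D j], and so it is also the peak of its block. *)
  have pVj : p = V j.
    apply: Xinj => //; apply: le_anti; rewrite Vp andbT.
    exact: turns_right_le tr (bp _ Vn1) (Vb1 _ pn).
  rewrite le_eqVlt; apply/orP; left; apply/eqP; apply: beats_anti b1 _.
  by rewrite pVj; exact: Vb1 _ (Cn _ he1).
apply: (increasing_leq inc); [lia|lia|rewrite Ct].
have [tr|tr] : turns_right (X (D j.+1), Y (D j.+1)) (ux, uy) \/
    turns_right (ux, uy) (X (D j.+1), Y (D j.+1)) by apply: D_total => //; lia.
  have := turns_right_le tr (Vb2 _ pn) (bp _ Vn2).
  by rewrite leNgt pV.
exact: turns_right_le tr (bp _ (Cn _ he2)) b2.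
Qed.

Lemma gap_block_spec s j k : gaps_context s -> iv s vj = j -> iv s vk = k ->
  (0 < j < r)%N -> (k < M)%N -> (iv s vcnt + G < N)%N ->
  spec W gap_block_com s (8 * lam + 10 + 7 * G) (fun s' => let A := ar s' aCand
    in
    [/\ (iv s vcnt <= iv s' vcnt <= iv s vcnt + G)%N,
      forall t, (t < iv s vcnt)%N -> A t = ar s aCand t,
      forall t, (iv s vcnt <= t < iv s' vcnt)%N ->
        (k * b <= A t < minn (k * b + b) n)%N && (X (V j) <= X (A t) < X (V
          j.+1)),
      uniq (slice A (iv s vcnt) (iv s' vcnt)) &
      forall p, wanted j k p ->
        exists2 t, (iv s vcnt <= t < iv s' vcnt)%N & A t = p]).
Proof.
move=> gc; set cnt0 := iv s vcnt => Ej Ek jr kM cN.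
have [[ctx E1 E2 E3] E4] := gc; have [E5 E6 E7 [E8 E9]] := ctx.
have ML := M_le b_gt0 ME.
have [Dj1 Du1] : (D j < N)%N /\ upward (X (D j)) (Y (D j)) by apply: D_upward;
  lia.
have [Dj2 Du2] : (D j.+1 < N)%N /\ upward (X (D j.+1)) (Y (D j.+1)).
  by apply: D_upward; lia.
have [Vn1 Vb1] : row_ok X Y n D V j by apply: V_ok; lia.
have [Vn2 Vb2] : row_ok X Y n D V j.+1 by apply: V_ok; lia.
assign.
rewrite /= E3 Ej; set s1 := seti _ _ _.
have gc1 : gaps_context s1 by exact: gc.
have s1k : iv s1 vk = k by rewrite -Ek.
have s1j : iv s1 vj = j by rewrite -Ej.
have s1c : iv s1 vcnt = cnt0 by [].
have s1u : iv s1 vu = D j by [].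
have s1A : ar s1 aCand = ar s aCand by [].
clearbody s1.
have [Eb inc con CN cov] := chains kM.
have ext s2 u : gaps_context s2 -> iv s2 vk = k -> iv s2 vu = u -> (u < N)%N ->
    upward (X u) (Y u) -> spec W ext_com s2 (4 * lam + 3) (fun s' =>
      [/\ peak X Y (X u) (Y u) C (k * b) (E k) (iv s' ve), gaps_context s' &
        framed ext_com s2 s']).
  move=> gc2 s2k s2u uN uu.
  have [[ctx2 _ _ _] _] := gc2.
  have := ext_spec WN b_gt0 nN lamP ME chains ctx2.
  rewrite s2k s2u => /(_ kM uN uu)/spec_frame H;
    apply: (spec_weaken H) => // s3 [pk fr].
  by split=> //; exact: gaps_context_framed fr isT isT isT gc2.
apply: (spec_seq (T1 := (4 * lam + 3)%N)); first by lia.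
apply: (spec_weaken (ext _ _ gc1 s1k s1u Dj1 Du1)) => // s2 [pk1 gc2 [f1 f2 _]].
have s2k : iv s2 vk = k by rewrite f1.
have s2j : iv s2 vj = j by rewrite f1.
have s2c : iv s2 vcnt = cnt0 by rewrite f1.
have s2A : ar s2 aCand = ar s aCand by rewrite f2.
have [_ s2D] : True /\ ar s2 aDir = D by case: gc2 => -[].
clear f1 f2; set e1 := iv s2 ve in pk1.
do 2!assign.
rewrite /= s2D s2j addn1 -/e1; set s3 := seti _ _ _.
have gc3 : gaps_context s3 by exact: gc2.
have s3k : iv s3 vk = k by rewrite -s2k.
have s3j : iv s3 vj = j by rewrite -s2j.
have s3c : iv s3 vcnt = cnt0 by rewrite -s2c.
have s3u : iv s3 vu = D j.+1 by [].
have s3t : iv s3 vt = e1 by [].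
have s3A : ar s3 aCand = ar s aCand by rewrite -s2A.
clearbody s3.
apply: (spec_seq (T1 := (4 * lam + 3)%N)); first by lia.
apply: (spec_weaken (ext _ _ gc3 s3k s3u Dj2 Du2)) => // s4 [pk2 gc4 [f1 f2 _]].
have s4k : iv s4 vk = k by rewrite f1.
have s4j : iv s4 vj = j by rewrite f1.
have s4c : iv s4 vcnt = cnt0 by rewrite f1.
have s4t : iv s4 vt = e1 by rewrite f1.
have s4A : ar s4 aCand = ar s aCand by rewrite f2.
clear f1 f2; set e2 := iv s4 ve in pk2.
have e12 := G_peak jr kM pk1 pk2.
have [e1E _ _] := pk1; have [e2E _ _] := pk2.
have en : (E k <= n)%N by clear -Eb; lia.
pose I (_ : unit) T s5 := let A := ar s5 aCand in let cnt := iv s5 vcnt in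
  [/\ gaps_context s5, [/\ iv s5 vj = j, iv s5 ve = e2, (e1 <= iv s5 vt)%N,
       (iv s5 vt <= maxn e1 e2.+1)%N & (7 * (e2.+1 - iv s5 vt) < T)%N],
    (cnt0 <= cnt <= cnt0 + (iv s5 vt - e1))%N /\
    (forall t, (t < cnt0)%N -> A t = ar s aCand t),
    uniq (slice A cnt0 cnt) /\ (forall t, (cnt0 <= t < cnt)%N ->
      (X (V j) <= X (A t) < X (V j.+1)) /\
      exists2 i, (e1 <= i < iv s5 vt)%N & A t = C i) &
    forall i, (e1 <= i < iv s5 vt)%N -> X (V j) <= X (C i) < X (V j.+1) ->
      exists2 t, (cnt0 <= t < cnt)%N & A t = C i].
apply: (spec_while (I := I) (a := tt)); last first.
- split=> //.
  + by split=> //; [rewrite s4t|rewrite s4t leq_maxl|rewrite s4t; clear -e12;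
      lia].
  + by split=> [|t tc]; [rewrite s4c s4t; clear; lia|rewrite s4A].
  + split=> [|t]; first by rewrite s4c slice_nil.
    by rewrite s4c; clear; lia.
  + by move=> i; rewrite s4t; clear; lia.
- move=> _ T s5 [gc5 [h1 h2 h3 h4 h5] [h6 h7] [h8 h9] h10] /=.
  rewrite h2 addn1 => qT; set t := iv s5 vt in h3 h4 h5 h6 h9 h10 qT.
  set cnt := iv s5 vcnt in h6 h8 h9 h10; set A := ar s5 aCand in h7 h8 h9 h10.
  have [[[F5 F6 F7 [F8 F9]] F1 F2 F3] F4] := gc5.
  have tE : (k * b <= t < E k)%N by clear -qT h3 e1E e2E; lia.
  have Ct : (k * b <= C t < n)%N by move: (CN _ tE); clear; lia.
  have cntN : (cnt < N)%N by clear -h6 qT h3 e12 cN; lia.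
  exists 6%N; split; first by clear -h5 qT; lia.
  have skip s6 : gaps_context s6 -> iv s6 vj = j -> iv s6 ve = e2 ->
    iv s6 vt = t ->
      iv s6 vcnt = cnt -> ar s6 aCand = A ->
      ~~ (X (V j) <= X (C t) < X (V j.+1)) ->
      spec W (SetI vt (vt |+| 1%N)) s6 1 (fun s' => exists a' : unit,
        I a' (T - 7)%N s').
    move=> gc6 g1 g2 g3 g4 g5 g6; assign.
    exists tt; split; rewrite /= ?g1 ?g2 ?g3 ?g4 ?g5 ?addn1 //.
    + by split=> //; clear -h3 qT h5; lia.
    + by split=> //; clear -h6 h3; lia.
    + split=> // i /h9[k1 [i' hi' k2]]; split=> //; exists i' => //;
        clear -hi'; lia.
    + move=> i hi hX; apply: h10 => //.
      have [et|nt] := eqVneq i t; first by move: g6; rewrite -et hX.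
      by clear -nt hi; lia.
  assign.
  rewrite /= F8 -/t; set s6 := seti _ _ _.
  have gc6 : gaps_context s6 by exact: gc5.
  have s6j : iv s6 vj = j by rewrite -h1.
  have s6e : iv s6 ve = e2 by rewrite -h2.
  have s6t : iv s6 vt = t by [].
  have s6c : iv s6 vcnt = cnt by [].
  have s6q : iv s6 vq = C t by [].
  have s6A : ar s6 aCand = A by [].
  have [[[K5 _ _ _] _ _ _] K4] := gc6.
  clearbody s6.
  apply: (spec_seq (T1 := 4)) => //.
  apply: spec_if => //; rewrite /= ?K4 ?K5 ?s6q ?s6j.
  + by repeat split=> //; clear -WN Ct nN jr rN Vn1; lia.
  + by move=> q1; apply: spec_skip; apply: skip => //; rewrite leNgt q1.
  move=> q1; apply: spec_if => //; rewrite /= ?K4 ?K5 ?s6q ?s6j addn1.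
  + by repeat split=> //; clear -WN Ct nN jr rN Vn2; lia.
  + move=> q2.
    have xV : X (V j) <= X (C t) < X (V j.+1) by rewrite leNgt q1 q2.
    do 3!assign.
    exists tt; split; rewrite /= ?s6t ?s6c ?s6q ?s6A ?s6j ?addn1 //.
    * by split=> //; clear -h3 qT h5; lia.
    * split; first by clear -h6 h3; lia.
      by move=> i hi; rewrite ifF ?h7 //; clear -hi h6; lia.
    * split.
        rewrite slice_rcons; last by clear -h6; lia.
        rewrite (eq_slice (g := A)); last first.
          by move=> i hi; rewrite ifF //; clear -hi; lia.
        rewrite eqxx cats1 rcons_uniq h8 andbT; apply/mem_slice => -[i hi].
        have [_ [i' hi' ->]] := h9 i hi => /(congr1 X) eX.
        have : X (C i') < X (C t).
          by apply: (increasing_lt inc); clear -hi' tE e1E; lia.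
        by rewrite eX ltxx.
      move=> i hi; case: eqP => [_|ni].
        by split=> //; exists t => //; clear -h3; lia.
      have [|k1 [i' hi' k2]] := h9 i; first by clear -hi ni; lia.
      by split=> //; exists i' => //; clear -hi'; lia.
    * move=> i hi hX; have [et|nt] := eqVneq i t.
        by exists cnt; [clear -h6; lia|rewrite eqxx et].
      have [|i' hi' k2] := h10 i _ hX; first by clear -hi nt; lia.
      by exists i'; [clear -hi'; lia|rewrite ifF //; clear -hi'; lia].
  + by move=> q2; apply: spec_skip; apply: skip => //; rewrite q2 andbF.
- move=> _ T s5 [gc5 [h1 h2 h3 h4 h5] [h6 h7] [h8 h9] h10] /=.
  rewrite h2 addn1 => qF; split=> //.
  + by clear -h6 h4 e12; lia.
  + move=> t /h9[-> [i hi ->]]; rewrite andbT; apply: CN.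
    by clear -hi h4 e1E e2E; lia.
  + move=> p wp; have [i hi Cp] := wanted_peaks jr kM pk1 pk2 wp.
    have [_ Vp _] := wp; rewrite -Cp in Vp *; apply: h10 => //.
    by clear -hi qF; lia.
- move=> _ T s5 [gc5 [h1 h2 h3 h4 h5] [h6 h7] [h8 h9] h10].
  by clear -WN nN h5 h2 e2E en; sidecond.
Qed.

Lemma slice_uniq_neq (f : nat -> nat) i j t t' :
  uniq (slice f i j) -> (i <= t < t')%N -> (t' < j)%N -> f t != f t'.
Proof.
move=> h tt' tj.
have := nth_uniq 0%N (i := t - i) (j := t' - i) _ _ h.
rewrite !size_slice !nth_slice; [|by clear -tt' tj; lia..].
rewrite !subnKC; [|by clear -tt'; lia..].
by move=> ->; clear -tt' tj; lia.
Qed.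

Hypothesis V_min : forall p, (p < n)%N -> X (V 1%N) <= X p.
Hypothesis V_max : forall p, (p < n)%N -> X p <= X (V r).
Variables (gam mu : nat).
Hypothesis G_gt0 : (0 < G)%N.
Hypothesis Ggam : (G <= 2 ^ gam)%N.
Hypothesis Mmu : (M <= 2 ^ mu)%N.
Hypothesis GN : ((M + r) * G + 1 < N)%N.
Hypothesis r_gt0 : (0 < r)%N.

Definition candidate p := exists ux uy, upward ux uy /\ best X Y n ux uy p.

Lemma gap_blocks_spec s j : let kl := (V j %/ b)%N in
  let kh := (V j.+1 %/ b)%N in let st := iv s vcnt in
  gaps_context s -> iv s vj = j -> iv s vk = kl -> iv s vkh = kh ->
    (0 < j < r)%N ->
  (kl <= kh < M)%N -> (st + (kh - kl).+1 * G < N)%N ->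
  spec W (While (LtI vk (vkh |+| 1%N)) (gap_block_com;; SetI vk (vk |+| 1%N))) s
   ((8 * lam + 12 + 7 * G) * (kh - kl).+1 + 1) (fun s' => let A := ar s' aCand
     in
    [/\ gaps_context s', (st <= iv s' vcnt <= st + (kh - kl).+1 * G)%N,
      (forall t, (t < st)%N -> A t = ar s aCand t) /\
      (forall t, (st <= t < iv s' vcnt)%N ->
        (A t < n)%N && (X (V j) <= X (A t) < X (V j.+1))),
      uniq (slice A st (iv s' vcnt)) &
      forall p, X (V j) <= X p < X (V j.+1) -> candidate p ->
        exists2 t, (st <= t < iv s' vcnt)%N & A t = p]).
Proof.
move=> kl kh st gc Ej Ek Ekh jr klkh sN.
have ML := M_le b_gt0 ME.
have [B EB] : exists B, B = (8 * lam + 12 + 7 * G)%N by eexists.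
rewrite -EB.
have Vn1 : row_ok X Y n D V j by apply: V_ok; clear -jr; lia.
have Vn2 : row_ok X Y n D V j.+1 by apply: V_ok; clear -jr; lia.
have [_ Du1] : (D j < N)%N /\ upward (X (D j)) (Y (D j)).
  by apply: D_upward; clear -jr; lia.
have [_ Du2] : (D j.+1 < N)%N /\ upward (X (D j.+1)) (Y (D j.+1)).
  by apply: D_upward; clear -jr; lia.
pose I (_ : unit) T s5 := let A := ar s5 aCand in let cnt := iv s5 vcnt in
  let k := iv s5 vk in
  [/\ gaps_context s5, [/\ iv s5 vj = j, iv s5 vkh = kh, (kl <= k <= kh.+1)%N &
       (B * (kh.+1 - k) < T)%N],
    (st <= cnt <= st + (k - kl) * G)%N /\
    (forall t, (t < st)%N -> A t = ar s aCand t),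
    uniq (slice A st cnt) /\ (forall t, (st <= t < cnt)%N ->
      [/\ (A t < n)%N, (A t < k * b)%N & X (V j) <= X (A t) < X (V j.+1)]) &
    forall p, (kl <= p %/ b < k)%N -> X (V j) <= X p < X (V j.+1) ->
      candidate p ->
      exists2 t, (st <= t < cnt)%N & A t = p].
apply: (spec_while (I := I) (a := tt)); last first.
- split; rewrite ?Ek ?Ekh //.
  + split=> //; first by clear -klkh; lia.
    by rewrite subSn ?addn1 //; clear -klkh; lia.
  + by rewrite subnn addn0 leqnn.
  + by rewrite slice_nil; last exact: leqnn; split=> // t; rewrite -/st;
      clear; lia.
  + by move=> p; clear; lia.
- move=> _ T s5 [gc5 [h1 h2 h3 h4] [h5 h6] [h7 h8] h9] /=.
  set k := iv s5 vk in h3 h4 h5 h8 h9 *; set cnt := iv s5 vcnt in h5 h7 h8 h9 *.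
  rewrite h2 addn1 ltnS => kkh.
  have kM : (k < M)%N by clear -kkh klkh; lia.
  have cN : (cnt + G < N)%N.
    have h : ((k - kl) * G + G <= (kh - kl).+1 * G)%N.
      by rewrite -mulSnr leq_mul2r; clear -h3 kkh; lia.
    by clear -h h5 sN; lia.
  have hB : (B * (kh.+1 - k.+1) + B <= B * (kh.+1 - k))%N.
    by rewrite -mulnSr leq_mul2l; clear -kkh; lia.
  have [z1 Ez1] : exists z1, z1 = (B * (kh.+1 - k.+1))%N by eexists.
  have [z2 Ez2] : exists z2, z2 = (B * (kh.+1 - k))%N by eexists.
  rewrite -Ez1 -Ez2 in hB; rewrite -Ez2 in h4.
  exists B.-1; split; first by clear -hB h4 EB; lia.
  have hB2 : (B * (kh.+1 - k.+1) < T - B.-1.+1)%N by rewrite -Ez1;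
    clear -hB h4 EB; lia.
  apply: (spec_seq (T1 := (8 * lam + 10 + 7 * G)%N)); first by clear -EB; lia.
  have H := spec_frame (gap_block_spec gc5 h1 (erefl _) jr kM cN).
  apply: (spec_weaken H) => // s6 [[g1 g2 g3 g4 g5] fr].
  have gc6 := gaps_context_framed fr isT isT isT gc5.
  have [f1 f2 _] := fr.
  have s6k : iv s6 vk = k by rewrite f1.
  have s6j : iv s6 vj = j by rewrite f1.
  have s6kh : iv s6 vkh = kh by rewrite f1.
  rewrite -/k -/cnt in g1 g2 g3 g4 g5; clear H fr f1 f2.
  apply: spec_seti; first by rewrite /= s6k; repeat split=> //;
    clear -WN nN ML kM; lia.
    by clear -EB; lia.
  exists tt; split; rewrite /= ?s6k ?s6j ?s6kh ?addn1 //.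
  + by split=> //; clear -h3 kkh; lia.
  + split; first by rewrite subSn ?mulSn; clear -h3 h5 g1; lia.
    by move=> t ht; rewrite g2 ?h6 //; clear -ht h5; lia.
  + split.
      rewrite (slice_cat cnt); last by clear -h5 g1; lia.
      rewrite (eq_slice (g := ar s5 aCand)); last first.
        by move=> t ht; apply: g2; clear -ht; lia.
      (* Earlier candidates have indices below [k * b], the new ones do not. *)
      rewrite cat_uniq h7 g4 andbT /=; apply/hasPn => p /mem_slice[t ht ->].
      apply/mem_slice => -[t' /h8[_ a1 _] e].
      by have /andP[] := g3 _ ht; rewrite e; clear -a1; lia.
    move=> t ht; have [tc|ct] := ltnP t cnt.
      rewrite g2 //; have [|a1 a2 a3] := h8 t; first by clear -ht tc; lia.
      by split=> //; rewrite mulSn; clear -a2; lia.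
    have /andP[a1 a2] : (k * b <= ar s6 aCand t < minn (k * b + b) n)%N &&
        (X (V j) <= X (ar s6 aCand t) < X (V j.+1)).
      by apply: g3; clear -ht ct; lia.
    by split=> //; rewrite ?mulSn; clear -a1; lia.
  + move=> p hp Vp cp; have [pk|pk] := eqVneq (p %/ b)%N k.
      have [|t ht <-] := g5 p; first by split.
      by exists t => //; clear -ht h5; lia.
    have [|t ht Ep] := h9 p _ Vp cp; first by clear -hp pk; lia.
    exists t; first by clear -ht g1; lia.
    by rewrite g2 //; clear -ht; lia.
- move=> _ T s5 [gc5 [h1 h2 h3 h4] [h5 h6] [h7 h8] h9] /=.
  rewrite h2 addn1 => qF.
  have kE : iv s5 vk = kh.+1 by clear -qF h3; lia.
  rewrite kE in h5 h8 h9; rewrite subSn in h5; last by clear -klkh; lia.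
  split=> //.
    by split=> // t /h8[-> _ ->].
  move=> p Vp cp; apply: h9 => //; rewrite ltnS.
  (* By the promise the index of a candidate lies between those of [V j] and [V j.+1], so no block
     outside the scanned range can contain one. *)
  have [ux [uy [hu bp]]] := cp.
  have /andP[a1 /ltW a2] := Vp.
  apply/andP; split; apply: leq_div2r.
    exact: (promise Du1 hu Vn1 bp a1).
  exact: (promise hu Du2 bp Vn2 a2).
- move=> _ T s5 [gc5 [h1 h2 h3 h4] _ _ _].
  split; last exact: leq_ltn_trans (leq0n _) h4.
  by rewrite /= h2; repeat split => //; clear -WN nN ML klkh; lia.
Qed.

(** A gap within one block has at most [G] candidates and needs [gam] rounds. With [c > 1] blocks up
    to [mu] further rounds are needed; as [c <= 2 * (c - 1)], they can be charged to [c - 1], which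
    vanishes for a single block. *)
Lemma sort_candidates_spec s st cnt c : iv s vst = st -> iv s vcnt = cnt ->
  gaps_context s -> (0 < c <= M)%N -> (st <= cnt <= st + c * G)%N ->
    (cnt < N)%N ->
  (forall t, (st <= t < cnt)%N -> (ar s aCand t < n)%N) ->
  uniq (slice (ar s aCand) st cnt) ->
  let H := (20 * G + 4)%N in
  spec W (SetI vlo vst;; SetI vhi vcnt;; sort_com aCand) s
   (c * (H * gam) + (c - 1) * (2 * H * mu) + 4) (fun s' => let A := ar s' aCand
     in
    [/\ gaps_context s', iv s' vcnt = cnt, iv s' vj = iv s vj,
      perm_eq (slice A st cnt) (slice (ar s aCand) st cnt) &
      increasing X A st cnt /\
      forall t, ~~ (st <= t < cnt)%N -> A t = ar s aCand t]).
Proof.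
move=> Est Ecnt gc cM scnt cN An un H.
do 2!(apply: spec_seti_seq; [by []|by rewrite addn4|]).
rewrite /= Est Ecnt; set s1 := seti _ _ _.
have gc1 : gaps_context s1 by exact: gc.
have s1lo : iv s1 vlo = st by [].
have s1hi : iv s1 vhi = cnt by [].
have s1c : iv s1 vcnt = cnt by rewrite -Ecnt.
have s1j : iv s1 vj = iv s vj by [].
have s1A : ar s1 aCand = ar s aCand by [].
clearbody s1; rewrite -s1A in An un *.
pose kap := if (c == 1)%N then gam else (gam + mu)%N.
have kapP : (cnt - st <= 2 ^ kap)%N.
  rewrite /kap; have [c1|c1] := eqVneq c 1%N.
    apply: leq_trans Ggam; by rewrite c1 mul1n in scnt; clear -scnt; lia.
  apply: (leq_trans (n := c * G)); first by clear -scnt; lia.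
  rewrite expnD mulnC; apply: leq_mul => //.
  by apply: leq_trans Mmu; clear -cM; lia.
have cost : ((20 * (cnt - st) + 4) * kap <=
    c * (H * gam) + (c - 1) * (2 * H * mu))%N.
  have h1 : (20 * (cnt - st) + 4 <= c * H)%N.
    have : (cnt - st <= c * G)%N by clear -scnt; lia.
    by rewrite /H mulnDr mulnCA; clear -cM; lia.
  apply: (leq_trans (leq_mul h1 (leqnn kap))).
  rewrite -mulnA /kap; case: eqVneq => c1; first by rewrite leq_addr.
  rewrite mulnDr mulnDr leq_add2l mulnA mulnA mulnA leq_mul2r; apply/orP; right.
  rewrite leq_mul2r; apply/orP; right; clear -cM c1; lia.
have [[[E5 E6 E7 [E8 E9]] E1 E2 E3] E4] := gc1.
have Hs := @sort_spec _ _ _ WN aCand kap s1 (erefl _).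
rewrite s1lo s1hi in Hs.
have h2 : (st <= cnt < N)%N by clear -scnt cN; lia.
have h3 t : (st <= t < cnt)%N -> (ar s1 aCand t < N)%N.
  by move=> /An; clear -nN; lia.
apply: (spec_weaken (spec_frame (Hs kapP h2 h3))) => [|s2 [[p1 p2 p3] fr]].
  by move: cost; move: (_ * kap)%N (c * _)%N ((c - 1) * _)%N; clear; lia.
have gc2 := gaps_context_framed fr isT isT isT gc1.
have [f1 _ _] := fr.
split=> //; [by rewrite f1|by rewrite f1|split=> // t st_t tc].
have un2 : uniq (slice (ar s2 aCand) st cnt) by rewrite (perm_uniq p1).
have A2n i : (st <= i < cnt)%N -> (ar s2 aCand i < n)%N.
  by case/(slice_perm_mem p1) => i' hi' ->; exact: An.
rewrite lt_neqAle -E5 p2 // andbT E5.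
have := slice_uniq_neq un2 (t := t) (t' := t.+1);
  rewrite st_t leqnn => /(_ isT tc).
apply: contra => /eqP /Xinj -> //; apply: A2n; clear -st_t tc; lia.
Qed.

(** Successive gaps share at most one block. Over all gaps the numbers [c] of blocks therefore sum
    to at most [M + r] and the numbers [c - 1] to at most [M]. Accordingly [P] is paid for every
    block visited and [Q], with its logarithmic factor [mu], only for the further blocks of a
    gap. *)
Lemma gaps_spec s : gaps_context s ->
  let P := (8 * lam + 23 + 7 * G + (20 * G + 4) * gam)%N in
  let Q := (2 * (20 * G + 4) * mu)%N in
  spec W gaps_com s (M * (P + Q) + r * P + 6) (fun s' => let A := ar s' aCand in
    [/\ (0 < iv s' vcnt <= (M + r) * G + 1)%N, increasing X A 0 (iv s' vcnt),
      forall t, (t < iv s' vcnt)%N -> (A t < n)%N &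
      forall p, candidate p -> exists2 t, (t < iv s' vcnt)%N & A t = p]).
Proof.
move=> gc P0 Q0.
have [P EP] : exists P, P = P0 by eexists.
have [Q EQ] : exists Q, Q = Q0 by eexists.
rewrite -EP -EQ.
have ML := M_le b_gt0 ME.
have [Z EZ] : exists Z, Z = (M * (P + Q) + r * P)%N by eexists.
rewrite -EZ.
do 2!assign.
apply: (spec_seq (T1 := (Z + 1)%N)); first by clear; lia.
pose I (_ : unit) T s5 := let A := ar s5 aCand in let cnt := iv s5 vcnt in
  let j := iv s5 vj in let kl := (V j %/ b)%N in
  [/\ gaps_context s5, (0 < j <= r)%N, (cnt + (M - kl + (r - j)) * G <= (M + r)
    * G)%N /\
      ((M - kl) * (P + Q) + (r - j) * P < T)%N,
    increasing X A 0 cnt /\ (forall t, (t < cnt)%N ->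
      (A t < n)%N && (X (A t) < X (V j))) &
    forall p, X p < X (V j) -> candidate p -> exists2 t, (t < cnt)%N & A t = p].
apply: (spec_while (I := I) (a := tt)); last first.
- split; rewrite /=.
  + exact: gc.
  + by rewrite r_gt0.
  + split; first by rewrite add0n leq_mul2r; apply/orP; right; apply: leq_add;
      exact: leq_subr.
    rewrite EZ addn1 ltnS; apply: leq_add; rewrite leq_mul2r; apply/orP; right.
      exact: leq_subr.
    exact: leq_subr.
  + by [].
  + by move=> p Vp [ux [uy [_ [/V_min]]]]; rewrite leNgt Vp.
- move=> _ T s5 [gc5 h1 [h2 h3] [h4 h5] h6] /=.
  have [[[E5 E6 E7 [E8 E9]] E1 E2 E3] E4] := gc5.
  rewrite E1; set j := iv s5 vj in h1 h2 h3 h5 h6 *;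
    set cnt := iv s5 vcnt in h2 h4 h5 h6 *.
  set kl := (V j %/ b)%N in h2 h3 *; move=> jr.
  have jr' : (0 < j < r)%N by clear -h1 jr; lia.
  set kh := (V j.+1 %/ b)%N.
  have Vn1 : row_ok X Y n D V j by apply: V_ok; clear -jr'; lia.
  have Vn2 : row_ok X Y n D V j.+1 by apply: V_ok; clear -jr'; lia.
  have VV : (V j <= V j.+1)%N.
    by apply: (row_ok_leq promise D_upward D_turns _ _ Vn1 Vn2); clear -jr';
      lia.
  have xVV : X (V j) <= X (V j.+1).
    by apply: (row_ok_le D_turns _ _ Vn1 Vn2); clear -jr'; lia.
  have klh : (kl <= kh < M)%N.
    by rewrite leq_div2r //=; apply: (block_lt ME Vn2.1).
  pose c := (kh - kl).+1.
  have cM : (0 < c <= M)%N by rewrite /c; clear -klh; lia.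
  have hG : ((M - kh + (r - j.+1)) * G + c * G <= (M - kl + (r - j)) * G)%N.
    by rewrite -mulnDl leq_mul2r; apply/orP; right; rewrite /c;
      clear -klh jr'; lia.
  have hP : ((M - kh) * (P + Q) + (r - j.+1) * P + (c * P + (c - 1) * Q) <=
      (M - kl) * (P + Q) + (r - j) * P)%N.
    have -> : (M - kl = (M - kh) + (c - 1))%N by rewrite /c; clear -klh; lia.
    have -> : (r - j = (r - j.+1) + 1)%N by clear -jr; lia.
    have -> : (c * P = (c - 1) * P + P)%N by rewrite /c subn1 /= mulSn addnC.
    by rewrite !mulnDl !mulnDr mul1n; clear; lia.
  have costP : ((8 * lam + 12 + 7 * G) * c + 1 + (c * ((20 * G + 4) * gam) +
      (c - 1) * (2 * (20 * G + 4) * mu) + 4) + 5 <= c * P + (c - 1) * Q)%N.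
    have -> : (c * P = (8 * lam + 12 + 7 * G) * c + 11 * c + c * ((20 * G + 4)
      * gam))%N.
      by rewrite EP /P0; clear; ring.
    rewrite EQ /Q0; move: (_ * c)%N (c * _)%N ((c - 1) * _)%N => z1 z2 z3.
    by move: cM; clear; lia.
  have cntN : (cnt + c * G < N)%N.
    by move: hG h2 GN; do 4!move: (_ * G)%N => ?; clear; lia.
  move: hG hP costP cntN h2 h3.
  set mG := (_ * G)%N; set c1 := ((8 * lam + _ + _) * c + 1)%N.
  set c2 := (_ + 4)%N; set c3 := (c * P + _)%N.
  set mP := ((M - kl) * _ + _)%N; set nP := ((M - kh) * _ + _)%N.
  move=> hG hP costP cntN h2 h3.
  exists (3 + c1 + c2 + 1)%N; split.
    by clear -costP hP h3; clearbody c1 c2 c3 mP nP; lia.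
  have rbd : (j.+1 < N)%N by clear -jr rN; lia.
  assign.
  do 2!(apply: spec_seti_seq; [rewrite /= E7 -/j|by []|];
    first by repeat split=> //; clear -WN rbd; lia).
  rewrite /= E4 E7 -/j -/cnt addn1 -/kl -/kh.
  set s6 := seti _ _ _.
  have gc6 : gaps_context s6 by exact: gc5.
  have s6j : iv s6 vj = j by [].
  have s6k : iv s6 vk = kl by [].
  have s6kh : iv s6 vkh = kh by [].
  have s6st : iv s6 vst = cnt by [].
  have s6c : iv s6 vcnt = cnt by [].
  have s6A : ar s6 aCand = ar s5 aCand by [].
  clearbody s6.
  apply: (spec_seq (T1 := c1)); first by clear; lia.
  have Hb := @gap_blocks_spec s6 j gc6 s6j s6k s6kh jr' klh.
  rewrite s6c in Hb; move: (spec_frame (Hb cntN)); clear Hb => Hb.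
  apply: (spec_weaken Hb) => // s7 [[gc7 k1 [k2 k3] k4 k5] [f1 _ _]]; clear Hb.
  have s7j : iv s7 vj = j by rewrite f1.
  have s7st : iv s7 vst = cnt by rewrite f1.
  clear f1; rewrite s6A in k2.
  have cnt7N : (iv s7 vcnt < N)%N by clear -k1 cntN; lia.
  have A7n t : (cnt <= t < iv s7 vcnt)%N ->
    (ar s7 aCand t < n)%N by case/k3/andP.
  have := sort_candidates_spec s7st (erefl _) gc7 cM k1 cnt7N A7n k4.
  set cnt' := iv s7 vcnt in k1 k3 k4 k5 cnt7N A7n *.
  rewrite /= -/c2 => Hs.
  apply: (spec_seq (T1 := c2)); first by clear; lia.
  apply: (spec_weaken Hs) => // s8 [gc8 l1 l2 l3 [l4 l5]]; clear Hs.
  have s8j : iv s8 vj = j by rewrite l2.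
  apply: spec_seti; [rewrite /= s8j|by clear; lia|].
    by repeat split=> //; clear -WN rbd; lia.
  have A8 t : (t < cnt)%N -> ar s8 aCand t = ar s5 aCand t.
    by move=> tc; rewrite l5 ?k2 //; clear -tc; lia.
  have A8new t : (cnt <= t < cnt')%N ->
      (ar s8 aCand t < n)%N && (X (V j) <= X (ar s8 aCand t) < X (V j.+1)).
    by case/(slice_perm_mem l3) => i hi ->; exact: k3.
  exists tt; split; rewrite /= ?s8j ?l1 ?addn1 //.
  + rewrite -/kh; split.
      rewrite -/c in k1; move: hG h2 k1; rewrite /mG.
      by do 4!move: (_ * G)%N => ?; clear; lia.
    by rewrite -/nP; clear -hP h3 costP cM; clearbody c1 c2 c3 mP nP; lia.
  + split.
      move=> t _ tc; have [t1|t1] := ltnP t.+1 cnt.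
        by rewrite !A8 //; [exact: h4|clear -t1; lia].
      have [t2|t2] := ltnP t cnt; last by apply: l4.
      have /andP[_ a1] : (ar s5 aCand t < n)%N && (X (ar s5 aCand t) < X (V j))
        by exact: h5.
      have /andP[_ /andP[a2 _]] : (ar s8 aCand t.+1 < n)%N &&
         (X (V j) <= X (ar s8 aCand t.+1) < X (V j.+1)).
        by apply: A8new; clear -t1 t2 tc; lia.
      by rewrite A8 // (lt_le_trans a1).
    move=> t tc; have [t2|t2] := ltnP t cnt.
      have /andP[a1 a2] := h5 _ t2.
      by rewrite A8 // a1 (lt_le_trans a2).
    have ht : (cnt <= t < cnt')%N by clear -t2 tc; lia.
    by have /and3P[-> _ ->] := A8new t ht.
  + move=> p pV cp; have [pj|jp] := ltP (X p) (X (V j)).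
      have [t tc <-] := h6 p pj cp.
      by exists t; [clear -tc k1; lia|rewrite A8].
    have [|t tc Ap] := k5 p _ cp; first by rewrite jp pV.
    have : p \in slice (ar s8 aCand) cnt cnt'.
      by rewrite (perm_mem l3); apply/mem_slice; exists t.
    by case/mem_slice => t' ht' ->; exists t' => //; clear -ht'; lia.
- move=> _ T s5 [gc5 h1 [h2 h3] [h4 h5] h6].
  have [[[E5 E6 E7 [E8 E9]] E1 E2 E3] E4] := gc5.
  rewrite /= E1 => qF; have jE : iv s5 vj = r by clear -h1 qF; lia.
  rewrite jE in h2 h5 h6; set cnt := iv s5 vcnt in h2 h4 h5 h6 *.
  (* The half-open gaps leave out the rightmost point [V r], which is appended at the end. *)
  have Vr : row_ok X Y n D V r by apply: V_ok; rewrite r_gt0 leqnn.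
  have cN : (cnt + 1 < N)%N.
    by move: h2 GN; do 2!move: (_ * G)%N => ?; clear; lia.
  do 2!assign.
  rewrite /= E1 E4 -/cnt addn1.
  split=> //.
  + by move: h2; do 2!move: (_ * G)%N => ?; clear; lia.
  + move=> t _ tc; have tc' : (t < cnt)%N by clear -tc; lia.
    have [e|nt] := eqVneq t.+1 cnt.
      rewrite /= ifF; last by clear -tc'; lia.
      by have /andP[] := h5 t tc'.
    by rewrite /= !ifF; [apply: h4 => //; clear -tc nt; lia|clear -tc'; lia..].
  + move=> t tc; case: eqP => [_|nt]; first exact: Vr.1.
    have tc' : (t < cnt)%N by clear -tc nt; lia.
    by have /andP[] := h5 t tc'.
  + move=> p cp; have [ux [uy [_ [pn _]]]] := cp.
    have := V_max pn; rewrite le_eqVlt => /orP[/eqP e|pV].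
      by exists cnt; rewrite ?eqxx // (Xinj pn Vr.1 e).
    have [t tc <-] := h6 p pV cp.
    by exists t; [exact: ltnW|rewrite ifF //; clear -tc; lia].
- move=> _ T s5 [gc5 h1 [h2 h3] _ _].
  split; last exact: leq_ltn_trans (leq0n _) h3.
  by [].
Qed.

End Gaps.

(** * Upper hulls of blocks *)

Definition init_com : com :=
  SetI vpow 1%N;; SetI vlen 1%N;;
  While (LtI vpow vn) (SetI vpow (vpow |+| vpow);; SetI vlen (vlen |+| 1%N));;
  SetI vblk (vlen |*| vlen);; SetI vM ((vn |-| 1%N) |/| vblk |+| 1%N);;
  SetI vx 0%N;; While (LtI vx vn) (SetA aIdx vx vx;; SetI vx (vx |+| 1%N)).

Definition block_com : com :=
  SetI vlo (vk |*| vblk);; SetI vhi (vlo |+| vblk);;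
  If (LtI vn vhi) (SetI vhi vn) Skip;;
  sort_com aIdx;; graham_com aIdx aChain;;
  SetA aEnd vk vtop;; SetI vk (vk |+| 1%N).

Definition chains_com : com := SetI vk 0%N;; While (LtI vk vM) block_com.

Section Init.
Variables (R : realFieldType) (W N : nat).
Hypothesis WN : (16 * N + 16 <= W)%N.
Implicit Types (s : store R).

(** The successor keeps the length positive for [n = 1], where the logarithm is 0. *)
Definition loglen n := (up_log 2 n).+1.
(** For positive [n] this is [n] over the block size, rounded up. *)
Definition blocks n := (n.-1 %/ (loglen n * loglen n)).+1.

Lemma loglen_sq_gt0 n : (0 < loglen n * loglen n)%N. Proof. by []. Qed.

Lemma blocksP n k : (0 < n)%N ->
  (k < blocks n)%N = (k * (loglen n * loglen n) < n)%N.
Proof.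
move=> n0; rewrite /blocks ltnS leq_divRL ?loglen_sq_gt0 //.
by rewrite -ltnS prednK.
Qed.

Lemma init_spec s n : iv s vn = n -> (0 < n)%N ->
  (2 * n + loglen n * loglen n < N)%N ->
  spec W init_com s (3 * loglen n + 3 * n + 6) (fun s' =>
    [/\ iv s' vlen = loglen n, iv s' vblk = (loglen n * loglen n)%N,
      iv s' vM = blocks n & forall t, (t < n)%N -> ar s' aIdx t = t]).
Proof.
move=> En n0; have [L EL] : exists L, L = loglen n by eexists.
rewrite -EL => nN; have L0 : (0 < L)%N by rewrite EL.
have LL : (L <= L * L)%N by rewrite leq_pmull.
have [b Eb] : exists b, b = (L * L)%N by eexists.
rewrite -Eb in nN LL *.
have b0 : (0 < b)%N by rewrite Eb muln_gt0 L0.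
do 2!assign.
apply: (spec_seq (T1 := (3 * L - 2)%N)); first by clear; lia.
pose I1 (j : nat) T s1 := [/\ iv s1 vn = n, iv s1 vpow = (2 ^ j)%N,
  iv s1 vlen = j.+1,
  (j < L)%N & (3 * (L - j.+1) < T)%N].
apply: (spec_while (I := I1) (a := 0%N)); last first.
- by split; rewrite /=; lia.
- move=> j T s1 [E1 E2 E3 E4 E5] /=; rewrite E1 E2 => qT.
  have jL : (j.+1 < L)%N.
    rewrite ltn_neqAle E4 andbT; apply: contraL qT => /eqP eL.
    by move: eL; rewrite -leqNgt EL => -[->]; exact: up_logP.
  exists 2%N; split; first lia.
  do 2!assign.
  exists j.+1; split; rewrite /= ?E2 ?E3 //.
  + by rewrite addnn -mul2n expnS.
  + by rewrite addn1.
  + by lia.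
- move=> j T s1 [E1 E2 E3 E4 E5] /=; rewrite E1 E2 => qF.
  have jL : j.+1 = L.
    apply/eqP; rewrite eqn_leq E4 EL ltnS /=; apply: up_log_min => //.
    by rewrite leqNgt qF.
  rewrite jL in E3.
  apply: spec_seti_seq.
  + by rewrite /= E3 -Eb; repeat split=> //; clear -nN WN; lia.
  + by clear; lia.
  rewrite /= E3 -Eb; apply: spec_seti_seq.
  + rewrite /= E1; have := leq_div (n - 1) b.
    by repeat split=> //; clear -nN WN H b0; lia.
  + by clear; lia.
  rewrite /= E1 subn1 addn1.
  have -> : ((n.-1 %/ b).+1 = blocks n)%N by rewrite /blocks -EL Eb.
  assign.
  pose I2 (_ : unit) T s2 := [/\ iv s2 vn = n, iv s2 vlen = L, iv s2 vblk = b,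
    iv s2 vM = blocks n & [/\ (iv s2 vx <= n)%N, (3 * (n - iv s2 vx) < T)%N &
      forall t, (t < iv s2 vx)%N -> ar s2 aIdx t = t]].
  apply: (spec_while (I := I2) (a := tt)).
  + by move=> _ T2 s2 [F1 F2 F3 F4 [F5 F6 F7]]; sidecond.
  + move=> _ T2 s2 [F1 F2 F3 F4 [F5 F6 F7]] /=; rewrite F1 => qF2.
    by split=> // t tn; apply: F7; lia.
  + move=> _ T2 s2 [F1 F2 F3 F4 [F5 F6 F7]] /=; rewrite F1 => qT2.
    exists 2%N; split; first lia.
    do 2!assign.
    exists tt; split=> //; rewrite /= addn1; split; [lia|lia|].
    move=> t; rewrite ltnS leq_eqVlt => /orP[/eqP->|tx]; first by rewrite eqxx.
    by rewrite ifF ?F7 //; lia.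
  + by split=> //; rewrite /=; split=> //; clear; lia.
- by move=> j T s1 [E1 E2 E3 E4 E5]; sidecond.
Qed.

Lemma chain_ok_eq x y n b (C E C' E' : nat -> nat) k :
  (forall t, (k * b <= t < k * b + b)%N -> C' t = C t) -> E' k = E k ->
  chain_ok (R := R) x y n b C E k -> chain_ok x y n b C' E' k.
Proof.
move=> hC hE [h1 h2 h3 h4 h5].
have hC' t : (k * b <= t < E k)%N -> C' t = C t by move=> ht; apply: hC; lia.
split; rewrite ?hE //.
- by move=> t lt th; rewrite !hC' ?h2 //; lia.
- by move=> t lt th; rewrite !hC' ?h3 //; lia.
- by move=> t ht; rewrite hC' //; exact: h4.
- move=> p hp ux uy hu; have [t ht hb] := h5 p hp ux uy hu.
  by exists t => //; rewrite hC'.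
Qed.

Lemma chains_spec s n b M lam : iv s vn = n -> iv s vblk = b -> iv s vM = M ->
  (0 < b)%N -> (b <= 2 ^ lam)%N -> (forall k, (k < M)%N = (k * b < n)%N) ->
  (n + b < N)%N -> (forall t, (t < n)%N -> ar s aIdx t = t) ->
  (forall p q, (p < n)%N -> (q < n)%N -> px s p = px s q -> p = q) ->
  spec W chains_com s (M * ((20 * b + 4) * lam + 15 * b + 15) + 2) (fun s' =>
    forall k, (k < M)%N -> chain_ok (px s) (py s) n b (ar s' aChain) (ar s'
      aEnd) k).
Proof.
move=> En Eb EM b0 lamP ME nN Aid Xinj.
have ML := M_le b0 ME.
have [Z EZ] : exists Z, Z = ((20 * b + 4) * lam + 15 * b + 15)%N by eexists.
rewrite -EZ; assign.
pose I (_ : unit) T s1 := let k := iv s1 vk in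
  [/\ [/\ px s1 = px s, py s1 = py s, iv s1 vn = n,
    iv s1 vblk = b & iv s1 vM = M],
     (k <= M)%N, (Z * (M - k) < T)%N,
     forall t, (k * b <= t < n)%N -> ar s1 aIdx t = t &
     forall j, (j < k)%N ->
       chain_ok (px s) (py s) n b (ar s1 aChain) (ar s1 aEnd) j].
apply: (spec_while (I := I) (a := tt)).
- by move=> _ T s1 [[E1 E2 E3 E4 E5] h1 h2 h3 h4]; split=> //;
    exact: leq_ltn_trans h2.
- move=> _ T s1 [[E1 E2 E3 E4 E5] h1 h2 h3 h4] /=; rewrite E5 => qF j jM.
  by apply: h4; clear -qF jM; lia.
- move=> _ T s1 [[E1 E2 E3 E4 E5] h1 h2 h3 h4] /=; rewrite E5.
  set k := iv s1 vk in h1 h2 h3 h4 *; move=> kM.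
  have hZ : (Z * (M - k.+1) + Z = Z * (M - k))%N by rewrite -mulnSr subnSK.
  rewrite -hZ in h2; exists Z.-1; split; first by clear -h2 EZ; lia.
  have h2' : (Z * (M - k.+1) < T - Z.-1.+1)%N.
    by move: h2; move: (Z * _)%N EZ => z Ez; clear -Ez; lia.
  have kbn : (k * b < n)%N by rewrite -ME.
  pose hi := minn (k * b + b) n.
  have hib : (k * b < hi <= k * b + b)%N by rewrite /hi; clear -kbn b0; lia.
  have hin : (hi <= n)%N by rewrite /hi geq_minr.
  clear h2 hZ.
  apply: spec_seti_seq.
    by rewrite /= E4 -/k; repeat split=> //; clear -WN nN kbn; lia.
    by clear -EZ; lia.
  apply: spec_seti_seq.
    by rewrite /= E4 -/k; repeat split=> //; clear -WN nN kbn; lia.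
    by clear -EZ; lia.
  rewrite /= E4 -/k; set s2 := seti _ _ _.
  apply: (spec_seq (T1 := 2)); first by clear -EZ; lia.
  have body s3 : px s3 = px s -> py s3 = py s -> iv s3 vn = n ->
    iv s3 vblk = b ->
    iv s3 vM = M -> iv s3 vk = k -> iv s3 vlo = (k * b)%N -> iv s3 vhi = hi ->
    ar s3 aIdx = ar s1 aIdx -> ar s3 aChain = ar s1 aChain ->
    ar s3 aEnd = ar s1 aEnd ->
    spec W (sort_com aIdx;; graham_com aIdx aChain;;
       SetA aEnd vk vtop;; SetI vk (vk |+| 1%N)) s3 (Z.-1.-2 - 2)
       (fun s' => exists a' : unit, I a' (T - Z.-1.+1)%N s').
    move=> F1 F2 F3 F4 F5 F6 F7 F8 F9 F10 F11.
    apply: (spec_seq (T1 := ((20 * b + 4) * lam + 2)%N)); first by clear -EZ;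
      lia.
    have A3 t : (k * b <= t < hi)%N -> ar s3 aIdx t = t.
      by move=> ht; rewrite F9 h3 //; clear -ht hin; lia.
    have := @sort_spec _ _ _ WN aIdx lam s3 (erefl _).
    rewrite F7 F8 F1 => /(_ _ _ _)/spec_frame Hs.
    apply: (spec_weaken (Hs _ _ _)).
    - by apply: leq_trans lamP; clear -hib; lia.
    - by clear -hib hin nN; lia.
    - by move=> t ht; rewrite A3 //; clear -ht hin nN; lia.
    - rewrite leq_add2r; apply: leq_mul => //; clear -hib; lia.
    move=> s4 [[p1 p2 p3] [f1 f2 f3]]; clear Hs.
    have [f3a f3b] := f3 isT.
    have A4 t : (k * b <= t < hi)%N -> (k * b <= ar s4 aIdx t < hi)%N.
      by move=> ht; have [t' ht' ->] := slice_perm_mem p1 ht; rewrite A3.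
    have un : uniq (slice (ar s4 aIdx) (k * b) hi).
      rewrite (perm_uniq p1) (eq_slice (g := id)) //.
      by rewrite /slice map_id iota_uniq.
    have inc4 : increasing (px s4) (ar s4 aIdx) (k * b) hi.
      move=> t lt th; rewrite f3a F1 lt_neqAle p2 // andbT.
      have nt := slice_uniq_neq un (t := t) (t' := t.+1).
      have {}nt : ar s4 aIdx t != ar s4 aIdx t.+1 by apply: nt => //;
        rewrite lt leqnn.
      apply: contra nt => /eqP /Xinj -> //.
        by have := A4 t; clear -lt th hin; lia.
      by have := A4 t.+1; clear -lt th hin; lia.
    have s4lo : iv s4 vlo = (k * b)%N by rewrite f1.
    have s4hi : iv s4 vhi = hi by rewrite f1.
    have s4v : [/\ iv s4 vn = n, iv s4 vblk = b, iv s4 vM = M & iv s4 vk = k].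
      by rewrite !f1.
    have s4C : ar s4 aChain = ar s1 aChain by rewrite f2.
    have s4E : ar s4 aEnd = ar s1 aEnd by rewrite f2.
    rewrite F1 in f3a; rewrite F2 in f3b; clear f1 f2 f3.
    apply: (spec_seq (T1 := (15 * b + 3)%N)); first by clear -EZ; lia.
    have := @graham_spec _ _ _ WN aIdx aChain s4 (erefl _).
    rewrite s4lo s4hi f3a f3b => /(_ _ _ _)/spec_frame Hg.
    rewrite f3a in inc4.
    apply: (spec_weaken (Hg _ _ inc4)).
    - by clear -hib hin nN; lia.
    - by move=> t /A4; clear -hin nN; lia.
    - by clear -hib; lia.
    move=> s5 [[g1 [g2 g3] g4 g5 g6] [f1 f2 f3]]; clear Hg.
    have [f3c f3d] := f3 isT.
    have [v1 v2 v3 v4] := s4v.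
    have s5k : iv s5 vk = k by rewrite f1.
    have s5v : [/\ iv s5 vn = n, iv s5 vblk = b & iv s5 vM = M] by rewrite !f1.
    have s5E : ar s5 aEnd = ar s1 aEnd by rewrite f2.
    have s5A : ar s5 aIdx = ar s4 aIdx by rewrite f2.
    rewrite f3a in f3c; rewrite f3b in f3d; clear f1 f2 f3.
    have [w1 w2 w3] := s5v.
    apply: spec_seta_seq.
    - by [].
    - by [].
    - by rewrite /= s5k; clear -kM ML nN WN; lia.
    - by clear -EZ; lia.
    apply: spec_seti.
    - by rewrite /= s5k; repeat split=> //; clear -kM ML nN WN; lia.
    - by clear -EZ; lia.
    exists tt; split; rewrite /= ?s5k ?addn1 //.
    - by move=> t ht; rewrite s5A p3 ?F9 ?h3 //; move: ht; rewrite mulSn /hi;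
        clear; lia.
    - move=> j; rewrite ltnS leq_eqVlt => /orP[/eqP->|jk].
        have sub p : (k * b <= p < hi)%N ->
            exists2 t, (k * b <= t < hi)%N & p = ar s4 aIdx t.
          move=> hp; have : p \in slice (ar s4 aIdx) (k * b) hi.
            by rewrite (perm_mem p1); apply/mem_slice; exists p => //;
              rewrite A3.
          by move/mem_slice.
        split; rewrite ?eqxx //.
        + by move=> t /g4[t' ht' ->]; exact: A4.
        + by move=> p /sub[t ht ->]; exact: g5.
      have jb : (j * b + b <= k * b)%N by rewrite -mulSnr leq_mul2r jk orbT.
      apply: chain_ok_eq (h4 j jk).
        by move=> t ht; rewrite g6 ?s4C //; clear -ht jb; lia.
      by rewrite /= ifF ?s5E //; clear -jk; lia.
  apply: spec_if; [by []|by []| |] => /=; rewrite E3 => q.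
    apply: spec_seti => //=.
    by apply: body => //; rewrite /= /hi ?E3; clear -q; lia.
  apply: spec_skip.
  by apply: body => //; rewrite /= /hi ?E3; clear -q; lia.
- split=> //; rewrite /=.
  + by rewrite subn0 mulnC addn2.
Qed.

End Init.

(** * Sampled directions *)

Definition normal_exp (i j : iexp) : rexp :=
  RB RDiv (RB RSub (RY i) (RY j)) (RB RSub (RX j) (RX i)).

(** The normal becomes point [n + vR]. As [vR] starts at 1 and is increased first, entry 1 of [aDir]
    stays free for the leftward direction. *)
Definition sample_step : com :=
  SetI vR (vR |+| 1%N);; SetI vu (vn |+| vR);;
  SetX vu (normal_exp (IG aChain vt) (IG aChain (vt |+| 1%N)));;
  SetY vu (RC 1);; SetA aDir vR vu;; SetI vt (vt |+| vlen).

(* Directions are stored behind the input as if they were points. *)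
Definition sample_com : com :=
  SetI vR 1%N;; SetI vk 0%N;;
  While (LtI vk vM)
    (SetI vt (vk |*| vblk);; SetI vtop (IG aEnd vk);;
     While (LtI (vt |+| 1%N) vtop) sample_step;;
     SetI vk (vk |+| 1%N)).

(** The sampled normals all have second coordinate 1, so the sorting routine for points, which
    compares abscissas, orders them by angle. The two horizontal directions bracket them and have
    the leftmost and the rightmost point as extreme points. *)
Definition dirs_com : com :=
  SetI vlo 2%N;; SetI vhi (vR |+| 1%N);; sort_com aDir;;
  SetI vR (vR |+| 1%N);;
  SetI vu (vn |+| 1%N);; SetX vu (RB RSub (RC 0) (RC 1));; SetY vu (RC 0);;
  SetA aDir 1%N vu;;
  SetI vu (vn |+| vR);; SetX vu (RC 1);; SetY vu (RC 0);; SetA aDir vR vu.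

Section Directions.
Variables (R : realFieldType) (W N : nat).
Hypothesis WN : (16 * N + 16 <= W)%N.
Variables (x y : nat -> R) (n b L M : nat) (C E : nat -> nat).
Hypothesis bL : b = (L * L)%N.
Hypothesis L_gt0 : (0 < L)%N.
Hypothesis ME : forall k, (k < M)%N = (k * b < n)%N.
Hypothesis chains : forall k, (k < M)%N -> chain_ok x y n b C E k.
Hypothesis nN : (n + b + M * L + 2 < N)%N.
Implicit Types (s : store R).

Definition samples_ok (X Y : nat -> R) (D : nat -> nat) r :=
  [/\ forall p, (p < n)%N -> X p = x p /\ Y p = y p,
     forall i, (1 < i < r)%N -> (n + 1 < D i < n + r)%N /\ Y (D i) = 1 &
     forall k m, (k < M)%N -> ((k * b + m * L).+1 < E k)%N ->
       exists2 i, (1 < i < r)%N & X (D i) =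
         normal x y (C (k * b + m * L)) (C (k * b + m * L).+1)].

(** A chain has at most [b = L * L] vertices, hence at most [L] sampled edges. The additional 1 in
    the bound is the reserved first entry. *)
Lemma sample_spec s : px s = x -> py s = y -> iv s vn = n -> iv s vblk = b ->
  iv s vlen = L -> iv s vM = M -> ar s aChain = C -> ar s aEnd = E ->
  spec W sample_com s ((7 * L + 5) * M + 3) (fun s' =>
    (0 < iv s' vR <= M * L + 1)%N /\
    samples_ok (px s') (py s') (ar s' aDir) (iv s' vR).+1).
Proof.
move=> Ex Ey En Eb EL EM EC EE.
have b0 : (0 < b)%N by rewrite bL muln_gt0 L_gt0.
have ML := M_le b0 ME.
have LM : (M <= M * L)%N by rewrite leq_pmulr.
do 2!assign.
pose base s1 := [/\ [/\ iv s1 vn = n, iv s1 vblk = b,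
  iv s1 vlen = L & iv s1 vM = M],
  ar s1 aChain = C /\ ar s1 aEnd = E, (0 < iv s1 vR)%N,
  forall p, (p < n)%N -> px s1 p = x p /\ py s1 p = y p &
  forall i, (1 < i <= iv s1 vR)%N -> ar s1 aDir i = (n + i)%N /\ py s1 (n + i)
    = 1].
pose cov s1 k m := forall k' m', (k' < k)%N || (k' == k) && (m' < m)%N ->
  (k' < M)%N -> ((k' * b + m' * L).+1 < E k')%N ->
  exists2 i, (1 < i <= iv s1 vR)%N & px s1 (n + i) =
         normal x y (C (k' * b + m' * L)) (C (k' * b + m' * L).+1).
have [Z EZ] : exists Z, Z = (7 * L + 5)%N by eexists.
rewrite -EZ.
pose I1 (_ : unit) T s1 := let k := iv s1 vk in
  [/\ base s1, (k <= M)%N, (iv s1 vR <= k * L + 1)%N, (Z * (M - k) < T)%N &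
      cov s1 k 0%N].
apply: (spec_while (I := I1) (a := tt)).
- by move=> _ T s1 [[[E1 E2 E3 E4] _ _ _ _] h1 h2 h3 h4]; split=> //;
    exact: leq_ltn_trans h3.
- move=> _ T s1 [[[E1 E2 E3 E4] [E5 E6] E7 E8 E9] h1 h2 h3 h4] /=;
    rewrite E4 => qF.
  have kM : iv s1 vk = M by clear -qF h1; lia.
  split; first by rewrite E7 -kM h2.
  split=> // [i hi|k m km tE].
    by have [-> ->] := E9 i hi; split=> //; clear -hi; lia.
  have [|i hi ei] := h4 k m _ km tE; first by rewrite kM km.
  by exists i => //; have [-> _] := E9 i hi.
- move=> _ T s1 [[[E1 E2 E3 E4] [E5 E6] E7 E8 E9] h1 h2 h3 h4] /=; rewrite E4.
  set k := iv s1 vk in h1 h2 h3 h4 *; move=> kM.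
  have hZ : (Z * (M - k.+1) + Z = Z * (M - k))%N by rewrite -mulnSr subnSK.
  rewrite -hZ in h3; exists Z.-1; split; first by clear -h3 EZ; lia.
  have h3' : (Z * (M - k.+1) < T - Z.-1.+1)%N.
    by move: h3; move: (Z * _)%N EZ => z Ez; clear -Ez; lia.
  have kbn : (k * b < n)%N by rewrite -ME.
  have kL : (k.+1 * L <= M * L)%N by rewrite leq_mul2r kM orbT.
  have [Eb2 inc con CN covk] := chains kM.
  apply: spec_seti_seq.
    by rewrite /= E2 -/k; repeat split=> //; clear -WN nN kbn; lia.
    by clear -EZ; lia.
  apply: spec_seti_seq.
    by rewrite /= -/k; split=> //; clear -WN nN kM ML; lia.
    by clear -EZ; lia.
  rewrite /= E2 E6 -/k.
  apply: (spec_seq (T1 := (7 * L + 1)%N)); first by clear -EZ; lia.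
  pose I2 (m : nat) T2 s2 := [/\ base s2, iv s2 vk = k /\ iv s2 vtop = E k,
    iv s2 vt = (k * b + m * L)%N, (m <= L)%N /\ (iv s2 vR <= k * L + m + 1)%N &
    (7 * (L - m) < T2)%N /\ cov s2 k m].
  have mlt m : ((k * b + m * L).+1 < E k)%N -> (m < L)%N.
    have Eb3 : (E k <= k * b + b)%N by clear -Eb2; lia.
    move=> h; rewrite -(ltn_pmul2r L_gt0) -bL; clear -h Eb3; lia.
  apply: (spec_while (I := I2) (a := 0%N)).
  + move=> m T2 s2 [[[F1 F2 F3 F4] [F5 F6] F7 F8 F9] [g0 g1] g2 [g3 g4] [g5
      g6]].
    split; last by clear -g5; lia.
    rewrite /= g2; have := leq_mul g3 (leqnn L); rewrite -bL => hm.
    by repeat split=> //; clear -WN nN kbn hm; lia.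
  + move=> m T2 s2 [[[F1 F2 F3 F4] [F5 F6] F7 F8 F9] [g0 g1] g2 [g3 g4] [g5
      g6]] /=.
    rewrite g1 g2 addn1 => qF2.
    apply: spec_seti.
    * by rewrite /= g0; repeat split=> //; clear -WN nN kM ML; lia.
    * by clear -EZ; lia.
    exists tt; split; rewrite /= ?g0 ?addn1 //.
      by apply: (leq_trans g4); rewrite mulSn; clear -g3; lia.
    move=> k' m' hk' k'M tE; apply: g6 => //.
    have [ek|nk] := eqVneq k' k; last by clear -nk hk'; lia.
    rewrite ek ltnn /=; rewrite ltnNge; apply/negP => mm'.
    move: tE; rewrite ek; have := leq_mul mm' (leqnn L).
    by clear -qF2; lia.
  + move=> m T2 s2 [[[F1 F2 F3 F4] [F5 F6] F7 F8 F9] [g0 g1] g2 [g3 g4] [g5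
      g6]] /=.
    rewrite g1 g2 addn1; set t := (k * b + m * L)%N in g2 *; move=> tE.
    have mL := mlt _ tE.
    exists 6%N; split; first by clear -g5 mL; lia.
    set r := iv s2 vR in F7 F9 g4 g6.
    have rN : (r + 1 <= M * L + 1)%N.
      by move: kL g4 mL; rewrite mulSn; clear; lia.
    have tn : (k * b <= t)%N /\ (t.+1 < n)%N.
      by split; [rewrite leq_addr|clear -tE Eb2; lia].
    have Ct : (k * b <= t < E k)%N by clear -tn tE; lia.
    have Ct1 : (k * b <= t.+1 < E k)%N by clear -tn tE; lia.
    have {}Ct : (C t < n)%N by move: (CN _ Ct); clear; lia.
    have {}Ct1 : (C t.+1 < n)%N by move: (CN _ Ct1); clear; lia.
    have xx : x (C t) < x (C t.+1) by apply: inc; [clear -tn; lia|].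
    do 2!assign.
    rewrite /= -/r F1 addn1.
    have [x1 y1] := F8 _ Ct; have [x2 y2] := F8 _ Ct1.
    apply: spec_setr_seq.
    * by [].
    * rewrite /= g2 F5 addn1 x1 x2 subr_eq0 gt_eqF //.
      by repeat split => //; clear -WN nN Ct Ct1 tn; lia.
    * by rewrite /=; clear -WN nN rN; lia.
    * by [].
    rewrite /= g2 F5 addn1 x1 x2 y1 y2.
    apply: spec_setr_seq; [by []|by []| |by []|].
      by rewrite /=; clear -WN nN rN; lia.
    rewrite /=.
    apply: spec_seta_seq; [by []|by []| |by []|].
      by rewrite /=; clear -WN nN rN; lia.
    rewrite /=.
    apply: spec_seti; [| by []|].
      by rewrite /= g2 F3; repeat split=> //; clear -WN nN tn mL bL L_gt0; nia.
    exists m.+1; split; rewrite /base /= ?F3 ?g2 //.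
    * split=> // [p pn|i hi].
        have hp : (p == n + r.+1)%N = false by clear -pn; lia.
        by rewrite hp; exact: F8.
      have [ei|ni] := eqVneq i r.+1.
        by rewrite ei eqxx.
      have [|e1 e2] := F9 i; first by clear -hi ni; lia.
      by rewrite ifF ?e1 ?e2 //; clear -ni; lia.
    * by rewrite /t mulSn; clear; lia.
    * by split=> //; rewrite -/r; clear -g4; lia.
    * split; first by clear -g5 mL; lia.
      move=> k' m' hk' k'M tE' /=.
      have [/andP[/eqP ek /eqP em]|nkm] := boolP ((k' == k) && (m' == m)).
        exists r.+1; first by clear -F7; lia.
        by rewrite eqxx ek em /normal.
      have [|i hi ei] := g6 k' m' _ k'M tE'; first by clear -hk' nkm; lia.
      exists i; first by clear -hi; lia.
      by rewrite ifF //; clear -hi; lia.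
  + split; rewrite /base /= ?mul0n ?addn0 ?subn0 //.
      by split=> //; rewrite -/k; clear -h2; lia.
- split; rewrite /base /=.
  + by rewrite Ex Ey; split=> //; move=> i; clear; lia.
  + by [].
  + by [].
  + by rewrite subn0; clear; lia.
  + by move=> k' m'; rewrite ltn0 andbF.
Qed.

Definition dirs_ok (X Y : nat -> R) (D : nat -> nat) r :=
  [/\ samples_ok X Y D r,
     [/\ (1 < r)%N, X (D 1%N) = -1, Y (D 1%N) = 0, X (D r) = 1 & Y (D r) = 0],
     forall i, (1 < i)%N -> (i.+1 < r)%N -> X (D i) <= X (D i.+1) &
     forall i, (0 < i <= r)%N -> (D i <= n + r)%N].

Lemma dirs_spec s q : iv s vn = n -> iv s vR = q -> (0 < q <= M * L + 1)%N ->
  samples_ok (px s) (py s) (ar s aDir) q.+1 -> forall kap, (q <= 2 ^ kap)%N ->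
  spec W dirs_com s ((20 * q + 4) * kap + 13) (fun s' => iv s' vR = q.+1 /\
    dirs_ok (px s') (py s') (ar s' aDir) q.+1).
Proof.
move=> En Eq q1 [h1 h2 h3] kap hkap.
have [Z EZ] : exists Z, Z = ((20 * q + 4) * kap)%N by eexists.
rewrite -EZ; do 2!assign.
rewrite /= Eq addn1; set s1 := seti _ _ _.
have [s1lo s1hi] : iv s1 vlo = 2 /\ iv s1 vhi = q.+1 by [].
have [s1n s1R] : iv s1 vn = n /\ iv s1 vR = q by [].
have [s1x s1y] : px s1 = px s /\ py s1 = py s by [].
have s1D : ar s1 aDir = ar s aDir by [].
clearbody s1.
apply: (spec_seq (T1 := (Z + 2)%N)); first by clear; lia.
have := @sort_spec _ _ _ WN aDir kap s1 (erefl _).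
rewrite s1lo s1hi s1x s1D => /(_ _ _ _)/spec_frame Hs.
apply: (spec_weaken (Hs _ _ _)).
- by apply: leq_trans hkap; clear; lia.
- by clear -q1 nN; lia.
- by move=> t /h2[Dt _]; clear -Dt nN q1; lia.
- by rewrite EZ leq_add2r leq_mul2r; apply/orP; right; clear; lia.
move=> s2 [[p1 p2 p3] [f1 f2 f3]]; clear Hs.
have [f3x f3y] := f3 isT; rewrite s1x in f3x; rewrite s1y in f3y.
have s2n : iv s2 vn = n by rewrite f1.
have s2R : iv s2 vR = q by rewrite f1.
clear f1 f2 f3.
do 2!assign.
rewrite /= s2R s2n !addn1.
do 2!(apply: spec_setr_seq; [by []|by []|rewrite /=|by clear; lia|];
  first by clear -WN nN; lia).
apply: spec_seta_seq; [rewrite /=|by []|rewrite /=|by clear; lia|];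
  try by clear -WN nN; lia.
apply: spec_seti_seq.
  by rewrite /= s2n; repeat split=> //; clear -WN nN q1; lia.
  by clear; lia.
rewrite /= s2n.
do 2!(apply: spec_setr_seq; [by []|by []|rewrite /=|by clear; lia|];
  first by clear -WN nN q1; lia).
apply: spec_seta; [by []|by []|by rewrite /=; clear -WN nN q1; lia|by clear;
  lia|].
rewrite /= mulr0n mulr1n sub0r; split=> //.
have D2 i : (1 < i < q.+1)%N -> exists2 i', (1 < i' < q.+1)%N &
    ar s2 aDir i = ar s aDir i'.
  by move=> hi; exact: slice_perm_mem p1 hi.
have D2n i : (1 < i < q.+1)%N -> (n + 1 < ar s2 aDir i < n + q.+1)%N.
  by case/D2 => i' /h2[hn _] ->.
have inner i : (1 < i < q.+1)%N -> ((i == q.+1) = false) * ((i == 1%N) = false)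
  *
    ((ar s2 aDir i == n + q.+1)%N = false) * ((ar s2 aDir i == n.+1)%N = false).
  by move=> hi; have := D2n i hi; clear -hi => h; do !split; lia.
have q1' : (q.+1 == 1)%N = false by clear -q1; lia.
split.
- split.
  + move=> p pn; rewrite f3x f3y.
    have hp : (p == n + q.+1)%N = false by clear -pn; lia.
    have hp' : (p == n.+1) = false by clear -pn; lia.
    by rewrite hp hp'; exact: h1.
  + move=> i hi; rewrite !inner // f3y; split; first exact: D2n.
    by have [i' /h2[_ e] ->] := D2 i hi.
  + move=> k m km tE; have [i hi ei] := h3 k m km tE.
    have : ar s aDir i \in slice (ar s2 aDir) 2 q.+1.
      by rewrite (perm_mem p1); apply/mem_slice; exists i.
    case/mem_slice => i' hi' e'; exists i' => //.
    by rewrite !inner // f3x -e'.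
- rewrite ?eqxx ?q1' [(1 == _)%N]eq_sym q1' ?eqxx /=.
  have -> : (n.+1 == (n + q.+1)%N) = false by clear -q1; lia.
  by rewrite ?eqxx; split => //; clear -q1; lia.
- move=> i i1 iq; rewrite !inner; [|clear -i1 iq; lia..].
  by rewrite f3x; apply: p2.
- move=> i hi; case: eqP => [//|ni]; case: eqP => [_|n1]; first by clear -q1;
    lia.
  by have := D2n i; clear -hi ni n1; lia.
Qed.

(** * Order of the sorted directions and distance of the peaks between them *)

Section Consequences.
Variables (X Y : nat -> R) (D : nat -> nat) (r : nat).
Hypothesis dirs : dirs_ok X Y D r.

Lemma dirs_cases i : (0 < i <= r)%N ->
  [\/ [/\ i = 1%N, X (D i) = -1 & Y (D i) = 0],
      [/\ i = r, X (D i) = 1 & Y (D i) = 0] |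
      (1 < i < r)%N /\ Y (D i) = 1].
Proof.
have [[_ h2 _] [r1 a1 a2 a3 a4] _ _] := dirs => hi.
have [->|i1] := eqVneq i 1%N; first by constructor 1.
have [->|ir] := eqVneq i r; first by constructor 2.
constructor 3; have hi' : (1 < i < r)%N by clear -hi i1 ir; lia.
by split=> //; have [] := h2 i hi'.
Qed.

Lemma dirs_le i j : (1 < i)%N -> (i <= j < r)%N -> X (D i) <= X (D j).
Proof.
have [_ _ h _] := dirs => i1; elim: j => [|j IH]; first by lia.
case/andP; rewrite leq_eqVlt => /orP[/eqP->//|ij] jr.
by apply: le_trans (IH _) (h j _ _) => //; clear -i1 ij jr; lia.
Qed.

Lemma dirs_upward i : (0 < i <= r)%N -> upward (X (D i)) (Y (D i)).
Proof.
case/dirs_cases => [[_ -> ->]|[_ -> ->]|[_ ->]]; last exact: upward1.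
  by split=> // _; rewrite oppr_eq0 oner_eq0.
by split=> // _; rewrite oner_eq0.
Qed.

Lemma turns_right_left (v : R * R) : turns_right (-1, 0) v.
Proof. by move=> dx dy /= dx0; rewrite mul0r addr0 mulN1r oppr_lt0 ltNge ltW.
  Qed.

Lemma turns_right_right (u : R * R) : turns_right u (1, 0).
Proof. by move=> dx dy /= dx0 _; rewrite mul0r addr0 mul1r. Qed.

Lemma dirs_turns i j : (0 < i)%N -> (i <= j <= r)%N ->
  turns_right (X (D i), Y (D i)) (X (D j), Y (D j)).
Proof.
move=> i0 ij; have hi : (0 < i <= r)%N by clear -i0 ij; lia.
have hj : (0 < j <= r)%N by clear -i0 ij; lia.
have [->//|nij] := eqVneq i j.
case: (dirs_cases hi) => [[_ -> ->]|[ir _ _]|[i1 Yi]].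
- exact: turns_right_left.
- by move: nij ij; rewrite ir; clear; lia.
case: (dirs_cases hj) => [[j1 _ _]|[_ -> ->]|[j1 Yj]].
- by move: nij ij i1; rewrite j1; clear; lia.
- exact: turns_right_right.
rewrite Yi Yj => dx dy /= dx0; have h : X (D i) <= X (D j).
  by apply: dirs_le; clear -i1 ij j1; lia.
nra.
Qed.

(** Upward directions are linearly ordered by angle: for [uy > 0] the sign of [X (D i) * uy - ux]
    decides against a sampled normal, and horizontal directions come first or last. *)
Lemma dirs_total i ux uy : (0 < i <= r)%N -> upward ux uy ->
  turns_right (X (D i), Y (D i)) (ux, uy) \/
  turns_right (ux, uy) (X (D i), Y (D i)).
Proof.
move=> hi [uy0 ux0]; case: (dirs_cases hi) => [[_ -> ->]|[_ -> ->]|[_ ->]].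
- by left; exact: turns_right_left.
- by right; exact: turns_right_right.
have [e|ny] := eqVneq uy 0.
  have := ux0 e; rewrite neq_lt e => /orP[u|u]; [right|left] => dx dy /= dx0.
    by rewrite mul0r addr0 nmulr_rlt0 // ltNge ltW.
  by rewrite mul0r addr0 pmulr_rlt0.
have y0 : 0 < uy by rewrite lt_def ny.
have [h|/ltW h] := leP (X (D i) * uy) ux; [left|right] => dx dy /= dx0 h2.
  have : uy * (X (D i) * dx + 1 * dy) < 0 by rewrite pmulr_rlt0.
  nra.
rewrite -(pmulr_rlt0 _ y0).
nra.
Qed.

(** Were the peaks [2 * L] apart, two sampled edges [t] and [t + L] would lie between them, the
    first falling in direction [D j] and the second rising in direction [D j.+1]. The normal of the
    second, itself one of the sorted directions, would then lie strictly between two consecutive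
    ones. *)
Lemma dirs_peak j k e1 e2 : (0 < j < r)%N -> (k < M)%N ->
  peak X Y (X (D j)) (Y (D j)) C (k * b) (E k) e1 ->
  peak X Y (X (D j.+1)) (Y (D j.+1)) C (k * b) (E k) e2 -> (e2 < e1 + 2 * L)%N.
Proof.
move=> jr kM [he1 _ pk1] [he2 pk2 _]; rewrite ltnNge; apply/negP => e12.
have [[h1 h2 h3] _ _ _] := dirs.
have [Eb inc con CN _] := chains kM.
have Cn t : (k * b <= t < E k)%N -> (C t < n)%N by move/CN; clear; lia.
have incX : increasing X C (k * b) (E k).
  move=> t lt tE; have [-> _] : X (C t) = x (C t) /\ Y (C t) = y (C t).
    by apply: h1; apply: Cn; clear -lt tE; lia.
  have [-> _] : X (C t.+1) = x (C t.+1) /\ Y (C t.+1) = y (C t.+1).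
    by apply: h1; apply: Cn; clear -lt tE; lia.
  exact: inc.
have XY t : (k * b <= t < E k)%N -> X (C t) = x (C t) /\ Y (C t) = y (C t).
  by move=> ht; apply: h1; exact: Cn.
have conX : concave X Y C (k * b) (E k).
  move=> t lt tE; have := con t lt tE; rewrite /cross.
  have [|-> ->] := XY t; first by clear -lt tE; lia.
  have [|-> ->] := XY t.+1; first by clear -lt tE; lia.
  by have [|-> ->] := XY t.+2; first by clear -lt tE; lia.
(* The quotient is rounded up, so that [t] is the first sampled position not before [e1]. *)
pose m := ((e1 - k * b + L.-1) %/ L)%N; pose t := (k * b + m * L)%N.
have tm := divn_eq (e1 - k * b + L.-1) L.
have tm2 := ltn_pmod (e1 - k * b + L.-1) L_gt0.
have te : (e1 <= t < e1 + L)%N.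
  by rewrite /t /m; clear -tm tm2 he1 L_gt0; lia.
have t'e : (k * b + m.+1 * L = t + L)%N by rewrite /t mulSn; clear; lia.
have tE : ((k * b + m.+1 * L).+1 < E k)%N.
  by rewrite t'e; clear -te e12 he2 L_gt0; lia.
have [i hi] := h3 k m.+1 kM tE; rewrite t'e => ei.
have [_ Yi] := h2 i hi.
have nt : normal x y (C t) (C t.+1) < normal x y (C (t + L)) (C (t + L).+1).
  by apply: (normal_lt inc con); clear -te he1 he2 e12 L_gt0; lia.
have nX t0 : (k * b <= t0)%N -> (t0.+1 < E k)%N ->
    normal X Y (C t0) (C t0.+1) = normal x y (C t0) (C t0.+1).
  move=> lt0 tE0; rewrite /normal.
  have [|-> ->] := XY t0; first by clear -lt0 tE0; lia.
  by have [|-> ->] := XY t0.+1; first by clear -lt0 tE0; lia.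
have lt : (k * b <= t)%N by rewrite leq_addr.
have fall : ~~ rises X Y (X (D j)) (Y (D j)) C t.
  apply: (fall_after (t := e1) _ incX conX).
  - by apply: dirs_upward; clear -jr; lia.
  - by clear -te he1; lia.
  - by clear -te e12 he2 L_gt0; lia.
  - by apply: pk1; clear -te e12 he2 L_gt0; lia.
have rise : rises X Y (X (D j.+1)) (Y (D j.+1)) C (t + L).
  by apply: pk2; clear -lt te e12; lia.
(* If [D j.+1] is a sampled normal, the rising edge [t + L] gives [X (D i) < X (D j.+1)], so [i] is
   at most [j] by sortedness; if it is the last direction, [i < r] suffices. The falling edge [t]
   then gives [X (D j) < X (D i)], a contradiction. *)
have ij : (i <= j)%N.
  rewrite leqNgt; apply/negP => ji.
  case: (@dirs_cases j.+1); first by clear -jr; lia.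
  - by case; clear -jr; lia.
  - by case=> jE _ _; move: hi ji; rewrite -jE; clear; lia.
  case=> j1 Yj; move: rise; rewrite Yj rises_normal; last first.
    by apply: incX; clear -lt te e12 he2; lia.
  rewrite nX; [|by clear -lt; lia|by clear -te e12 he2; lia].
  rewrite -ei ltNge dirs_le //.
    by clear -jr; lia.
  by clear -ji hi; lia.
case: (@dirs_cases j); first by clear -jr; lia.
- by case=> j1; move: hi ij; rewrite j1; clear; lia.
- by case=> jE; move: jr; rewrite -jE ltnn andbF.
case=> j1 Yj; move: fall; rewrite Yj rises_normal; last first.
  by apply: incX => //; clear -te e12 he2 L_gt0; lia.
rewrite nX //; last by clear -te e12 he2 L_gt0; lia.
rewrite -leNgt => h.
have : X (D i) <= X (D j) by apply: dirs_le; clear -hi ij jr; lia.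
by rewrite ei leNgt (le_lt_trans h nt).
Qed.

End Consequences.
End Directions.

(** * The whole algorithm *)

(** [vn] lives in integer register 0, where the length of the result is expected. *)
Definition copy_com : com :=
  SetI vi 0%N;;
  While (LtI vi vtop)
    (SetX vi (RX (IG aHull vi));; SetY vi (RY (IG aHull vi));;
     SetI vi (vi |+| 1%N));;
  SetI vn vtop.

Definition main_com : com :=
  init_com;; chains_com;; sample_com;; dirs_com;; rows_com;; gaps_com;;
  (SetI vlo 0%N;; SetI vhi vcnt;; graham_com aCand aHull);; copy_com.

Section Main.
Variables (R : realFieldType) (W N : nat).
Hypothesis WN : (16 * N + 16 <= W)%N.
Implicit Types (s : store R).

(* The copy may overwrite the input since entry t of c is not smaller than t. *)
Lemma copy_spec s c h : iv s vtop = h -> (h <= N)%N ->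
  (forall t, (t < h)%N -> ar s aHull t = c t) ->
  (forall t, (t < h)%N -> (t <= c t < N)%N) ->
  (forall t t', (t < t' < h)%N -> (c t < c t')%N) ->
  spec W copy_com s (4 * h + 3) (fun s' => iv s' vn = h /\
    forall t, (t < h)%N -> px s' t = px s (c t) /\ py s' t = py s (c t)).
Proof.
move=> Eh hN Ec cN cinc; assign.
apply: (spec_seq (T1 := (4 * h + 1)%N)); first by clear; lia.
pose I (_ : unit) T s1 := let i := iv s1 vi in
  [/\ iv s1 vtop = h, ar s1 aHull = ar s aHull, (i <= h)%N,
   (4 * (h - i) < T)%N &
   (forall t, (t < i)%N -> px s1 t = px s (c t) /\ py s1 t = py s (c t)) /\
   (forall t, (i <= t)%N -> px s1 t = px s t /\ py s1 t = py s t)].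
apply: (spec_while (I := I) (a := tt)).
- by move=> _ T s1 [E1 E2 h1 h2 [h3 h4]]; sidecond.
- move=> _ T s1 [E1 E2 h1 h2 [h3 h4]] /=; rewrite E1 => qF.
  assign.
  rewrite /=; split=> // t th; apply: h3; clear -qF th; lia.
- move=> _ T s1 [E1 E2 h1 h2 [h3 h4]] /=; rewrite E1.
  set i := iv s1 vi in h1 h2 h3 h4 *; move=> ih.
  have /andP[ic cn] := cN i ih; have [x1 y1] := h4 _ ic.
  have EH : ar s1 aHull i = c i by rewrite E2 Ec.
  exists 3%N; split; first by clear -h2 ih; lia.
  apply: spec_setr_seq; rewrite /= -/i ?EH ?x1 //.
  + by repeat split=> //; clear -WN cn ih hN; lia.
  + by clear -WN ih hN; lia.
  apply: spec_setr_seq; rewrite /= -/i ?EH ?y1 //.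
  + by repeat split=> //; clear -WN cn ih hN; lia.
  + by clear -WN ih hN; lia.
  apply: spec_seti; [rewrite /= -/i|by []|].
    by repeat split=> //; clear -WN ih hN; lia.
  exists tt; split; rewrite /= -/i ?addn1 //.
  + by clear -h2 ih; lia.
  + split=> t ti.
      have [->|nt] := eqVneq t i; first by [].
      by apply: h3; clear -ti nt; lia.
    have -> : (t == i) = false by clear -ti; lia.
    by apply: h4; clear -ti; lia.
- by split; rewrite /=; [|by []|by []|clear; lia|].
Qed.

Variables (x y : nat -> R) (n : nat).
Hypothesis n_gt0 : (0 < n)%N.
Hypothesis xinj : forall p q, (p < n)%N -> (q < n)%N -> x p = x q -> p = q.
Hypothesis promise : forall ux uy vx vy p q, upward ux uy -> upward vx vy ->
  best x y n ux uy p -> best x y n vx vy q -> x p <= x q -> (p <= q)%N.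

(** Each vertex of the chain is extreme in some direction, so the promise turns the order by
    abscissa into the order by index. This is what makes the final copy in place safe. *)
Lemma hull_of_ltn c h t t' : hull_of x y n c h -> (t < t' < h)%N ->
  (c t < c t')%N.
Proof.
move=> hh /andP[tt' t'h]; have [h0 inc _ cn _] := hh.
have xlt := increasing_lt inc (leq0n t) tt' t'h.
have [ux [uy [hu hb]]] := hull_of_best hh (ltn_trans tt' t'h).
have [vx [vy [hv hb']]] := hull_of_best hh t'h.
rewrite ltn_neqAle (promise hu hv hb hb' (ltW xlt)) andbT.
by apply: contraTneq xlt => ->; rewrite ltxx.
Qed.

Lemma hull_of_leq c h t : hull_of x y n c h -> (t < h)%N -> (t <= c t)%N.
Proof.
move=> hh; elim: t => // t IH th; apply: leq_ltn_trans (IH (ltnW th)) _.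
by apply: hull_of_ltn hh _; rewrite leqnn.
Qed.

Lemma chain_ok_agree (X Y : nat -> R) b C E k :
  (forall p, (p < n)%N -> X p = x p /\ Y p = y p) ->
  chain_ok x y n b C E k -> chain_ok X Y n b C E k.
Proof.
move=> xy [h1 h2 h3 h4 h5].
have cn t : (k * b <= t < E k)%N -> (C t < n)%N by move=> /h4; lia.
split=> //; first exact: (increasing_agree xy cn h2).
  exact: (concave_agree xy cn h3).
move=> p hp; apply: (covered_agree xy cn _ (h5 p hp)).
by clear -hp; lia.
Qed.

Definition loglog := up_log 2 (loglen n).

(** [2 ^ lam] bounds the block size [L * L], [2 ^ loglog.+1] the gap size [G], and [2 ^ rho] the
    number of directions. The summands are the phases of [main_com] in order. *)
Definition main_time :=
  let L := loglen n in let b := (L * L)%N in let M := blocks n in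
  let lam := (2 * loglog)%N in let r := (M * L + 2)%N in let rho := (2 * L +
    2)%N in
  let G := (2 * L)%N in
  let P := (8 * lam + 23 + 7 * G + (20 * G + 4) * loglog.+1)%N in
  let Q := (2 * (20 * G + 4) * L)%N in
  let cnt := ((M + r) * G + 1)%N in
  ((3 * L + 3 * n + 6) + ((M * ((20 * b + 4) * lam + 15 * b + 15) + 2) +
  (((7 * L + 5) * M + 3) + (((20 * (M * L + 1) + 4) * rho + 13) +
  ((((4 * lam + 18) * (M + r.+1) + 6) * rho + 4) + ((M * (P + Q) + r * P + 6) +
  ((15 * cnt + 5) + (4 * cnt + 3))))))))%N.

Lemma main_spec s : px s = x -> py s = y -> iv s vn = n ->
  (2 * n + loglen n * loglen n + blocks n * loglen n * loglen n * 8 + 10 < N)%N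
    ->
  spec W main_com s main_time (fun s' => exists c h, [/\ hull_of x y n c h,
    iv s' vn = h & forall t, (t < h)%N ->
      px s' t = x (c t) /\ py s' t = y (c t)]).
Proof.
move=> Ex Ey En; rewrite /main_time.
have [l El] : exists l, l = loglog by eexists.
have [L EL] : exists L, L = loglen n by eexists.
have [M EM] : exists M, M = blocks n by eexists.
have L0 : (0 < L)%N by rewrite EL.
have M0 : (0 < M)%N by rewrite EM.
have Ll : (L <= 2 ^ l)%N by rewrite El EL; exact: up_logP.
have nL : (n <= 2 ^ L.-1)%N by rewrite EL; exact: up_logP.
rewrite -El -EL -EM => NB.
have [b Eb] : exists b, b = (L * L)%N by eexists.
rewrite -Eb in NB *.
have b0 : (0 < b)%N by rewrite Eb muln_gt0 L0.
have ME k : (k < M)%N = (k * b < n)%N by rewrite EM Eb EL; exact: blocksP.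
have lamP : (b <= 2 ^ (2 * l))%N.
  by rewrite mul2n -addnn expnD Eb; exact: leq_mul.
have ML := M_le b0 ME.
have LM : (M <= M * L)%N by rewrite leq_pmulr.
have MLL : (M * L <= M * L * L)%N by rewrite leq_pmulr.
have LML : (L <= M * L * L)%N by rewrite -mulnA;
  apply: leq_trans (leq_pmull L L0) (leq_pmull _ M0).
set q' := (M * L + 1)%N; set rho := (2 * L + 2)%N.
pose T7 := (15 * ((M + (M * L + 2)) * (2 * L) + 1) + 5)%N.
apply: spec_seq (leq_addr _ _) _; rewrite addKn.
have Hi := init_spec WN En n_gt0.
rewrite -EL -EM -Eb in Hi.
apply: (spec_weaken (spec_frame (Hi _))) => //; first by clear -NB; lia.
move=> s1 [[i1 i2 i3 i4] [f1 f2 f3]]; clear Hi.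
have [f3a f3b] := f3 isT; rewrite Ex in f3a; rewrite Ey in f3b.
have s1n : iv s1 vn = n by rewrite f1.
clear f1 f2 f3.
apply: spec_seq (leq_addr _ _) _; rewrite addKn.
have Hc := chains_spec WN s1n i2 i3 b0 lamP ME.
apply: (spec_weaken (spec_frame (Hc _ i4 _))) => //.
  by clear -NB; lia.
  by rewrite f3a.
rewrite f3a f3b; move=> s2 [chains [f1 f2 f3]]; clear Hc.
have [s2x s2y] := f3 isT; rewrite f3a in s2x; rewrite f3b in s2y.
have s2n : iv s2 vn = n by rewrite f1.
have s2b : iv s2 vblk = b by rewrite f1.
have s2L : iv s2 vlen = L by rewrite f1.
have s2M : iv s2 vM = M by rewrite f1.
clear f1 f2 f3 f3a f3b i1 i2 i3 i4 s1n.
set C := ar s2 aChain in chains; set E := ar s2 aEnd in chains.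
apply: spec_seq (leq_addr _ _) _; rewrite addKn.
have nbN : (n + b + M * L + 2 < N)%N by clear -NB MLL; lia.
have Hs := sample_spec WN Eb L0 ME chains nbN s2x s2y s2n s2b s2L s2M (erefl _)
  (erefl _).
apply: (spec_weaken (spec_frame Hs)) => // s3 [[q1 smp] [f1 f2 _]]; clear Hs.
have s3n : iv s3 vn = n by rewrite f1.
have s3b : iv s3 vblk = b by rewrite f1.
have s3M : iv s3 vM = M by rewrite f1.
have s3C : ar s3 aChain = C by rewrite f2.
have s3E : ar s3 aEnd = E by rewrite f2.
clear f1 f2.
have [q Eq] : exists q, q = iv s3 vR by eexists.
rewrite -Eq in q1 smp; symmetry in Eq.
(* Both [M], which is at most [n], and [L] are at most [2 ^ L]; the additional 2 in [rho] absorbs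
   the two horizontal directions. *)
have qr : (M * L + 2 < 2 ^ rho)%N.
  have ML2 : (M <= 2 ^ L)%N.
    by apply: leq_trans ML (leq_trans nL _); rewrite leq_exp2l // leq_pred.
  have L2 : (L <= 2 ^ L)%N by exact: ltnW (ltn_expl _ _).
  have := leq_mul ML2 L2; rewrite -expnD addnn -mul2n /rho expnD.
  have := expn_gt0 2 (2 * L); move: (2 ^ (2 * L))%N (M * L)%N => z1 z2.
  by clear; lia.
apply: spec_seq (leq_addr _ _) _; rewrite addKn.
have Hd := dirs_spec WN Eb L0 nbN s3n Eq q1 smp (kap := rho).
apply: (spec_weaken (spec_frame (Hd _))).
- by clear -q1 qr; lia.
- rewrite leq_add2r leq_mul2r; apply/orP; right; rewrite leq_add2r leq_mul2l /=.
  by clear -q1; lia.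
move=> s4 [[s4R dirs] [f1 f2 _]]; clear Hd.
have s4n : iv s4 vn = n by rewrite f1.
have s4b : iv s4 vblk = b by rewrite f1.
have s4M : iv s4 vM = M by rewrite f1.
have s4C : ar s4 aChain = C by rewrite f2.
have s4E : ar s4 aEnd = E by rewrite f2.
clear f1 f2 s3n s3b s3M s3C s3E.
set X := px s4 in dirs; set Y := py s4 in dirs; set D := ar s4 aDir in dirs.
have [r Er] : exists r, r = q.+1 by eexists.
rewrite -Er in dirs s4R.
have r2 : (1 < r <= M * L + 2)%N by clear -Er q1; lia.
have [[XY _ _] [_ D1x D1y Drx Dry] _ Dn] := dirs.
have chainsX k : (k < M)%N -> chain_ok X Y n b C E k.
  by move=> kM; exact: chain_ok_agree XY (chains k kM).
have XYc p : (p < n)%N -> x p = X p /\ y p = Y p by move=> /XY[-> ->].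
have Xinj p p' : (p < n)%N -> (p' < n)%N -> X p = X p' -> p = p'.
  by move=> pn pn'; have [-> _] := XY _ pn; have [-> _] := XY _ pn';
    exact: xinj.
have promiseX ux uy vx vy p p' : upward ux uy -> upward vx vy ->
    best X Y n ux uy p -> best X Y n vx vy p' -> X p <= X p' -> (p <= p')%N.
  move=> hu hv /(best_agree XY) bp /(best_agree XY) bp'.
  have [-> _] := XY _ bp.1; have [-> _] := XY _ bp'.1; exact: promise bp bp'.
have rN : (r + 2 < N)%N by clear -r2 NB MLL; lia.
have D_up i : (0 < i <= r)%N -> (D i < N)%N /\ upward (X (D i)) (Y (D i)).
  move=> hi; split; last exact: dirs_upward dirs i hi.
  by have := Dn i hi; clear -r2 NB MLL; lia.
have D_tr := dirs_turns WN Eb L0 nbN dirs.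
have rc : rows_context X Y C E b M D r s4 by split.
have nbN2 : (n + b < N)%N by clear -nbN; lia.
have rrho : (r < 2 ^ rho)%N by clear -qr r2 Er q1; lia.
apply: spec_seq (leq_addr _ _) _; rewrite addKn.
have Hr := rows_spec WN n_gt0 b0 nbN2 lamP ME chainsX promiseX rN D_up D_tr rc
  rrho.
apply: (spec_weaken (spec_frame (Hr _))).
- by clear -r2; lia.
- rewrite leq_add2r leq_mul2r; apply/orP; right; rewrite leq_add2r leq_mul2l /=.
  by clear -r2; lia.
move=> s5 [V_ok fr]; clear Hr; have [f1 f2 f3] := fr.
set V := ar s5 aVtx in V_ok.
have gc : gaps_context X Y C E b M D V r s5.
  have [s5x s5y] := f3 isT.
  by split=> //; split=> //; rewrite ?f1 //; rewrite ?f2 //; split;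
    rewrite ?f1 ?f2.
have s5n : iv s5 vn = n by rewrite f1.
have s5x := f3 isT; clear f1 f2 f3 fr.
apply: spec_seq (leq_addr _ _) _; rewrite addKn.
have G_peak j k e1 e2 : (0 < j < r)%N -> (k < M)%N ->
    peak X Y (X (D j)) (Y (D j)) C (k * b) (E k) e1 ->
    peak X Y (X (D j.+1)) (Y (D j.+1)) C (k * b) (E k) e2 ->
    (e2 < e1 + 2 * L)%N.
  exact: (dirs_peak WN Eb L0 chains nbN dirs).
have V1 p : (p < n)%N -> X (V 1%N) <= X p.
  move=> pn; have [|_ bV] := V_ok 1%N; first by clear -r2; lia.
  have := beats_dot (bV p pn).
  by rewrite D1x D1y /dot !mul0r !addr0 !mulN1r lerN2.
have Vr p : (p < n)%N -> X p <= X (V r).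
  move=> pn; have [|_ bV] := V_ok r; first by clear -r2; lia.
  have := beats_dot (bV p pn).
  by rewrite Drx Dry /dot !mul0r !addr0 !mul1r.
have cntB : ((M + r) * (2 * L) + 1 <= (M + (M * L + 2)) * (2 * L) + 1)%N.
  by rewrite leq_add2r leq_mul2r; apply/orP; right; clear -r2; lia.
have cntB2 : ((M + (M * L + 2)) * (2 * L) + 1 < N)%N.
  by move: NB MLL LML; clear; nia.
have Hg := gaps_spec WN b0 nbN2 lamP ME chainsX Xinj promiseX rN D_up D_tr
   (dirs_total dirs) V_ok G_peak V1 Vr (gam := l.+1) (mu := L) _ _ _ _ _ gc.
apply: (spec_weaken (spec_frame (Hg _ _ _ _ _))).
- by rewrite muln_gt0.
- by rewrite expnS leq_mul2l.
- by apply: leq_trans ML (leq_trans nL _); rewrite leq_exp2l // leq_pred.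
- exact: leq_ltn_trans cntB cntB2.
- by clear -r2; lia.
- rewrite leq_add2r leq_add2l leq_mul2r; apply/orP; right; clear -r2; lia.
move=> s6 [[g1 g2 g3 g4] [f1 f2 f3]]; clear Hg.
have [s6x s6y] := f3 isT.
have {}s6x : px s6 = X by rewrite s6x; case: s5x.
have {}s6y : py s6 = Y by rewrite s6y; case: s5x.
have s6n : iv s6 vn = n by rewrite f1.
clear f1 f2 f3 s5x s5n gc.
have [cnt Ecnt] : exists cnt, cnt = iv s6 vcnt by eexists.
rewrite -Ecnt in g1 g2 g3 g4; symmetry in Ecnt.
have [cmax Ecmax] : exists z, z = ((M + (M * L + 2)) * (2 * L) + 1)%N by
  eexists.
rewrite -Ecmax in cntB cntB2 *.
have cc : (cnt <= cmax)%N by clear -g1 cntB; lia.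
apply: spec_seq (leq_addr _ _) _; rewrite addKn.
do 2!(apply: spec_seti_seq; [by sidecond|by clear; lia|]).
rewrite /= Ecnt; set s7 := seti _ _ _.
have [s7lo s7hi] : iv s7 vlo = 0%N /\ iv s7 vhi = cnt by [].
have s7n : iv s7 vn = n by [].
have s7x : px s7 = X by [].
have s7y : py s7 = Y by [].
have s7A : ar s7 aCand = ar s6 aCand by [].
clearbody s7.
have := @graham_spec _ _ _ WN aCand aHull s7 (erefl _).
rewrite s7lo s7hi s7x s7y s7A => /(_ _ _ g2)/spec_frame Hg.
apply: (spec_weaken (Hg _ _)).
- by clear -g1 cc cntB2; lia.
- by move=> t /g3; clear -nbN2; lia.
- by clear -cc; lia.
move=> s8 [[k1 [k2 k3] k4 k5 _] [f1 f2 f3]]; clear Hg.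
have [s8x s8y] := f3 isT; rewrite s7x in s8x; rewrite s7y in s8y.
clear f1 f2 f3.
set c := ar s8 aHull in k2 k3 k4 k5; set h := iv s8 vtop in k1 k2 k3 k4 k5.
have hullX : hull_of X Y n c h.
  split=> //; first by clear -k1; lia.
    by move=> t th; have [t' ht' ->] := k4 t th; exact: g3.
  (* The best input point in the given direction is a candidate. The final scan covers it, hence
     also every point it beats. *)
  move=> p pn ux uy hu.
  have [v bv] := best_exists X Y ux uy n_gt0.
  have [|t tc At] := g4 v; first by exists ux, uy.
  have [t' ht' hb] := k5 t tc ux uy hu.
  by exists t' => //; apply: beats_trans hb _; rewrite At; exact: bv.2.
have hull := hull_of_agree XYc hullX.
have h0 : (h <= cmax)%N by clear -k1 cc; lia.
have Hcp : spec W copy_com s8 (4 * h + 3) (fun s' => iv s' vn = h /\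
    forall t, (t < h)%N -> px s' t = px s8 (c t) /\ py s' t = py s8 (c t)).
  apply: copy_spec => //.
  - by clear -h0 cntB2; lia.
  - move=> t th; rewrite (hull_of_leq hull th) /=.
    by have [_ _ _ cn _] := hull; have := cn t th; clear -nbN2; lia.
  - by move=> t t' htt; exact: hull_of_ltn hull htt.
apply: (spec_weaken Hcp); first by clear -h0; lia.
move=> s9 [e1 e2]; exists c, h; split=> // t th.
have [-> ->] := e2 t th; rewrite s8x s8y; apply: XY.
by have [_ _ _ cn _] := hull; exact: cn.
Qed.

End Main.

(** * Running time and machine code *)

Section Time.
Local Open Scope nat_scope.

Lemma sqr_le_exp2 j : j.+1 * j.+1 <= 4 * 2 ^ j.
Proof.
elim: j => // -[_|[_|j IH]] //; rewrite expnS.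
by move: IH; move: (2 ^ j.+2) => z; nia.
Qed.

Lemma sqr_up_log n : 0 < n -> (up_log 2 n).+1 * (up_log 2 n).+1 <= 8 * n.
Proof.
move=> n0; have [n1|n1] := leqP n 1.
  have -> : n = 1 by lia.
  by rewrite up_log1.
have := up_log_gtn (isT : 1 < 2) n1.
have : 0 < up_log 2 n by rewrite up_log_gt0.
case: (up_log 2 n) => // j _; rewrite [j.+1.-1]/= => h.
have := sqr_le_exp2 j.+1; rewrite expnS; move: (2 ^ j) h => z; lia.
Qed.

(** The full blocks hold fewer than [n] points, and rounding up adds one block, of size at most
    [8 * n]. *)
Lemma blocks_sqr n : 0 < n -> blocks n * loglen n * loglen n <= 9 * n.
Proof.
move=> n0; rewrite -mulnA; set b := loglen n * loglen n.
have b8 : b <= 8 * n := sqr_up_log n0.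
have h : n.-1 %/ b * b <= n.-1 by exact: leq_divM.
by rewrite /blocks -/b mulSn; lia.
Qed.

(** Apart from [3 * n], every monomial of the time bound has degree at most 1 in [M], 2 in [L] and 1
    in the double logarithm [l], and is thus at most [M * L * L * l.+1]. The factor [20 * 100]
    generously bounds the sum of their coefficients. *)
Lemma main_time_le : exists c, forall n, 0 < n ->
  main_time n <= c * (n * (loglog n).+1).
Proof.
exists (20 * 100 * 9 + 3) => n n0.
suff h : main_time n <= 20 * 100 * (9 * (n * (loglog n).+1)) + 3 * n.
  apply: (leq_trans h); rewrite mulnDl mulnA leq_add2l leq_mul2l /=.
  by rewrite leq_pmulr.
have h9 := blocks_sqr n0; rewrite /main_time.
have M0 : 0 < blocks n by []; have L0 : 0 < loglen n by [].
move: (blocks n) (loglen n) (loglog n) h9 M0 L0 => M L l h9 M0 L0.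
have [u Eu] : exists u, u = M * L * L * l.+1 by eexists.
have hu : u <= 9 * (n * l.+1) by rewrite Eu mulnA leq_mul2r h9 orbT.
have mono a1 a2 a3 a4 : a1 <= M -> a2 <= L -> a3 <= L -> a4 <= l.+1 ->
    a1 * a2 * a3 * a4 <= u by move=> *; rewrite Eu !leq_mul.
have m1 := mono M L L l (leqnn _) (leqnn _) (leqnn _) (leqnSn _).
have m2 := mono M L L 1 (leqnn _) (leqnn _) (leqnn _) isT.
have m3 := mono M L 1 l (leqnn _) (leqnn _) L0 (leqnSn _).
have m4 := mono M L 1 1 (leqnn _) (leqnn _) L0 isT.
have m5 := mono M 1 1 l (leqnn _) L0 L0 (leqnSn _).
have m6 := mono M 1 1 1 (leqnn _) L0 L0 isT.
have m7 := mono 1 L L l M0 (leqnn _) (leqnn _) (leqnSn _).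
have m8 := mono 1 L L 1 M0 (leqnn _) (leqnn _) isT.
have m9 := mono 1 L 1 l M0 (leqnn _) L0 (leqnSn _).
have m10 := mono 1 L 1 1 M0 (leqnn _) L0 isT.
have m11 := mono 1 1 1 l M0 L0 L0 (leqnSn _).
have m12 := mono 1 1 1 1 M0 L0 L0 isT.
clear mono Eu h9 M0 L0; lia.
Qed.

End Time.

(** * The machine program and its asymptotic running time *)

Section Machine.
Variable R : realType.

Definition main_prog : program := compile main_com 0 ++ [:: Halt].

Definition input_store n (P : 'I_n -> plane R) : store R :=
  Store (fun v => if veq v vn then n else 0%N) (fun _ _ => 0%N)
    (fun i => rmem (input P) (2 * i)) (fun i => rmem (input P) (2 * i + 1)).

Lemma input_storeE n (P : 'I_n -> plane R) (i : 'I_n) :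
  P i = (px (input_store P) i, py (input_store P) i).
Proof.
rewrite /= !mul2n !addn1 /= odd_double uphalf_double doubleK /=.
by rewrite valK /= -surjective_pairing.
Qed.

Lemma represents_input W n (P : 'I_n -> plane R) : (n < W)%N ->
  represents W (input_store P) (input P).
Proof.
move=> nW; split=> //= [v|a i|[] i]; last by rewrite addn0.
- by case: v; split=> //=; lia.
- by split=> //; lia.
- by [].
Qed.

Lemma code_at_main : code_at main_prog 0 (compile main_com 0).
Proof.
move=> i hi; rewrite add0n !onthE /main_prog map_cat nth_cat size_map.
by rewrite hi.
Qed.

Lemma main_prog_computes :
  computes_upper_hull_in_time R main_prog 12 (fun n => csize main_com *
    main_time n)%N.
Proof.
move=> n P n0 gp pr.
(* [N] exceeds all array indices, whose bound in [NB] is at most [82 * n + 10]. The exponent 12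
   leaves a factor [2 ^ 11 = 2048] on top of [n + 2], enough for [16 * N + 16 = 1600 * n + 1616]. *)
pose s := input_store P; pose W := ((n + 2) ^ 12)%N;
  pose N := (100 * n + 100)%N.
have WN : (16 * N + 16 <= W)%N.
  have h : (2 ^ 11 <= (n + 2) ^ 11)%N by rewrite leq_exp2r // leq_addl.
  have := leq_mul (leqnn (n + 2)) h; rewrite -expnS -/W; apply: leq_trans.
  by rewrite (_ : 2 ^ 11 = 2048)%N // /N; lia.
have nW : (n < W)%N by clear -WN; rewrite /N in WN; lia.
have PE := input_storeE P.
have xinj := x_inj PE gp.
have prom := best_leq PE gp pr.
have NB : (2 * n + loglen n * loglen n + blocks n * loglen n * loglen n * 8 +
  10 < N)%N.
  have := blocks_sqr n0; have : (loglen n * loglen n <= 8 * n)%N := sqr_up_log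
    n0.
  by rewrite /N; move: (loglen n * loglen n)%N (_ * loglen n)%N; clear; lia.
have [t [s' [ex lt [c [h [hh vh xy]]]]]] :=
  main_spec WN n0 xinj prom (erefl (px s)) (erefl (py s)) (erefl (iv s vn)) NB.
have W8 : (8 < W)%N by clear -WN; lia.
have [t' [m' [lt' run pc' [r1 r2 r3]]]] :=
  compileP W8 ex (leqnn _) (represents_input P nW) code_at_main.
exists t', m'; split.
- by apply: leq_trans lt' _; rewrite leq_mul2l lt orbT.
- split; first exact: run.
  rewrite pc' /main_prog onthE map_cat nth_cat size_map size_compile add0n ltnn
    subnn //.
- rewrite /output; have -> : ireg m' 0 = h by case: (r1 vn) => /= ->.
  rewrite (_ : mkseq _ h = mkseq (fun t => (px s (c t), py s (c t))) h).
    exact: (upper_hullP PE gp hh).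
  apply/eq_in_map => j; rewrite mem_iota add0n => /andP[_ jh].
  have [x1 y1] := xy j jh.
  by rewrite -x1 -y1 -[px _ _](r3 false) -[py _ _](r3 true) addn0 addn1 mul2n.
Qed.

(** The estimate of a squared logarithm by 8 times its argument, applied to [loglen n] in place of
    [n], shows that the double logarithm is at most of the order of the square root of the
    logarithm. The constant is [24 = 8 * 3], with 3 from rounding in [loglen]. *)
Lemma loglog_ln n : (1 < n)%N ->
  (loglog n).+1%:R ^+ 2 * ln 2 <= 24 * ln n%:R :> R.
Proof.
move=> n1; have n0 : (0 < n)%N by exact: ltnW.
have ln2 : 0 < ln 2 :> R by apply: ln_gt0; rewrite ltr1n.
have ln2n : ln 2 <= ln n%:R :> R by rewrite ler_ln ?posrE ?ltr0n // ler_nat.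
have h1 : (loglog n).+1%:R ^+ 2 <= 8 * (loglen n)%:R :> R.
  by rewrite -natrX -natrM ler_nat -mulnn; exact: sqr_up_log.
have h2 : (loglen n)%:R * ln 2 <= 3 * ln n%:R :> R.
  have := up_log_gtn (isT : 1 < 2)%N n1.
  have : (0 < up_log 2 n)%N by rewrite up_log_gt0.
  rewrite /loglen; case: (up_log 2 n) => // j _; rewrite [j.+1.-1]/= => h.
  (* Here [loglen n] is [j + 2] and [2 ^ j < n]; the remaining [2 * ln 2] is at most [2 * ln n]. *)
  have : ln (2 ^+ j) <= ln n%:R :> R.
    by rewrite ler_ln ?posrE ?exprn_gt0 ?ltr0n // -natrX ler_nat ltnW.
  rewrite lnXn // -[_ *+ j]mulr_natl => h3.
  by rewrite -addn2 natrD mulrDl; lra.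
apply: le_trans (_ : 8 * ((loglen n)%:R * ln 2) <= _); last by lra.
by rewrite mulrA ler_pM2r.
Qed.

Lemma main_time_bigO kappa :
  (fun n : nat => (kappa * main_time n)%:R : R^o) =O_\oo
  (fun n : nat => n%:R * Num.sqrt (ln n%:R) : R^o).
Proof.
have ln2 : 0 < ln 2 :> R by apply: ln_gt0; rewrite ltr1n.
have [c hc] := main_time_le.
pose K : R := (kappa * c)%:R.
pose d : R := Num.sqrt (24 / ln 2).
have K0 : 0 <= K by [].
apply/eqO_exP; exists (K * d + 1).
  by rewrite ltr_wpDl // mulr_ge0 ?sqrtr_ge0.
near=> n.
have n1 : (1 < n)%N by near: n; exact: nbhs_infty_ge.
have lnn : 0 <= ln n%:R :> R by rewrite ln_ge0 // ler1n ltnW.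
rewrite ger0_norm // ger0_norm ?mulr_ge0 ?sqrtr_ge0 //.
have hl : (loglog n).+1%:R <= d * Num.sqrt (ln n%:R) :> R.
  have d0 : 0 <= 24 / ln 2 :> R by rewrite divr_ge0 // ltW.
  have -> : (loglog n).+1%:R = Num.sqrt ((loglog n).+1%:R ^+ 2) :> R.
    by rewrite sqrtr_sqr ger0_norm.
  rewrite /d -sqrtrM //; apply: ler_wsqrtr.
  by rewrite mulrAC ler_pdivlMr //; exact: loglog_ln.
have ht : (kappa * main_time n)%:R <= K * (n%:R * (loglog n).+1%:R) :> R.
  by rewrite /K -!natrM ler_nat -mulnA leq_mul2l hc ?orbT // ltnW.
apply: (le_trans ht); rewrite mulrDl mul1r ler_wpDr ?mulr_ge0 ?sqrtr_ge0 //.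
by rewrite -mulrA ler_wpM2l // mulrCA ler_wpM2l.
Unshelve. all: by end_near.
Qed.

End Machine.

Theorem theorem6 (R : realType) :
  exists (prog : program) (K : nat) (T : nat -> nat),
    computes_upper_hull_in_time R prog K T /\
    (fun n : nat => (T n)%:R : R^o) =O_\oo
      (fun n : nat => n%:R * Num.sqrt (ln n%:R) : R^o).
Proof.
exists main_prog, 12%N, (fun n => csize main_com * main_time n)%N; split.
  exact: main_prog_computes.
exact: main_time_bigO.
Qed.
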